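(* Let $n\geq 3$ and $r\geq 1$. Let $C_1,\dots,C_n\subset GL_r(\mathbb{C})$ be conjugacy classes whose collection of eigenvalues is multiplicatively generic. For each $i$, let $P^i$ be the partition of $r$ attached to $C_i$ as described in the context. Suppose that (1) $\prod_{i=1}^n \det(C_i)=1$, and (2) $\sum_{i=1}^n \gamma_{P^i}(\mu) < (n-2)\mu+2$ for every $\mu=2,\dots,r$. Then the multiplicative Deligne--Simpson problem is solvable for $(C_1,\dots,C_n)$: there exist $T_i\in C_i$, $i=1,\dots,n$, with $T_1T_2\cdots T_n=\mathrm{Id}_r$ such that the matrices $T_1,\dots,T_n$ have no common invariant subspace other than $0$ and $\mathbb{C}^r$.
   Context: Partitions: a partition $P=(m_1\geq m_2\geq\dots\geq m_\ell>0)$ of $r=|P|$ is drawn as a Young diagram whose $j$-th row has $m_j$ boxes. The conjugate partition $\widehat P=(n_1,\dots,n_{m_1})$ is given by $n_j=\#\{k: m_k\geq j\}$. The union $P\cup Q$ of two partitions is the partition whose parts are all parts of $P$ and of $Q$, arranged in non-increasing order. Level function: number the boxes of the Young diagram of $P$ by $1,\dots,r$, going from top to bottom within each column and from left to right across columns; $\gamma_P(k)$ is the column index of the box numbered $k$. Thus $\gamma_P:\{1,\dots,r\}\to\{1,\dots,m_1\}$ (e.g. for $P=(4,3,1)$: $\gamma_P=(1,1,1,2,2,3,3,4)$). Partition attached to a conjugacy class: for a conjugacy class $C\subset GL_r(\mathbb{C})$ with distinct eigenvalues $\lambda_1,\dots,\lambda_e$, let $P^{\lambda_j}$ be the partition recording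 the sizes of the Jordan blocks of eigenvalue $\lambda_j$ in the Jordan normal form of $C$, and set $P:=\widehat{P}^{\lambda_1}\cup\dots\cup\widehat{P}^{\lambda_e}$, a partition of $r$. Write $P^i$ for the partition attached to $C_i$. Multiplicative genericity: list the eigenvalues of $C_i$ with multiplicity as $\lambda_{i,1},\dots,\lambda_{i,r}$. The collection is multiplicatively generic if for every $m$ with $1\le m<r$ and all subsets $\Lambda_1,\dots,\Lambda_n\subset\{1,\dots,r\}$ with $|\Lambda_1|=\dots=|\Lambda_n|=m$, one has $\prod_{i=1}^n\prod_{k\in\Lambda_i}\lambda_{i,k}\neq 1$. *)

(* Defs.v *)
From HB Require Import structures.
From mathcomp Require Import all_boot all_order all_algebra.
From mathcomp Require Import reals complex.
Set Implicit Arguments. Unset Strict Implicit. Unset Printing Implicit Defensive.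
Import Order.TTheory GRing.Theory Num.Theory.
Local Open Scope ring_scope.

Section Defs.
Variable F : fieldType.

Definition conj_mx r (A B : 'M[F]_r) : Prop :=
  exists2 Q : 'M[F]_r, Q \in unitmx & B = Q *m A *m invmx Q.

(* Number of Jordan blocks of eigenvalue lam of size >= j (j >= 1) of A:
   rank (A - lam)^(j-1) - rank (A - lam)^j.  For j = 1..r these are the
   parts n_j of the conjugate partition \hat P^lam of the Jordan-block
   partition P^lam (zero parts dropped below). *)
Definition nblocks_ge r (A : 'M[F]_r) (lam : F) (j : nat) : nat :=
  (\rank ((A - lam%:M) ^+ j.-1) - \rank ((A - lam%:M) ^+ j))%N.

Definition dual_jordan_partition r (A : 'M[F]_r) (lam : F) : seq nat :=
  [seq nblocks_ge A lam j | j <- iota 1 r & (0 < nblocks_ge A lam j)%N].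

Definition attached_partition r (A : 'M[F]_r) (lams : seq F) : seq nat :=
  sort geq (flatten [seq dual_jordan_partition A lam | lam <- undup lams]).
End Defs.

(* Partitions as non-increasing sequences of positive parts. *)
Definition conj_partition (P : seq nat) : seq nat :=
  [seq count (fun m => j <= m)%N P | j <- iota 1 (head 0%N P)].

(* Level function gamma_P : numbering boxes column by column (top to bottom,
   then left to right), gamma_P k is the column of box k (1-based, 1 <= k <= |P|). *)
Definition level (P : seq nat) (k : nat) : nat :=
  nth 0%N (flatten [seq nseq (nth 0%N (conj_partition P) j.-1) j
                   | j <- iota 1 (head 0%N P)]) k.-1.

Definition mxprod (F : fieldType) r n (T : 'I_n -> 'M[F]_r) : 'M[F]_r :=
  \big[mulmx/1%:M]_(i < n) T i.

Definition mult_generic (F : fieldType) n r (lam : 'I_n -> r.-tuple F) : Prop :=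
  forall m : nat, (1 <= m < r)%N ->
  forall L : 'I_n -> {set 'I_r}, (forall i, #|L i| = m) ->
  \prod_(i < n) \prod_(k in L i) tnth (lam i) k != 1.

(* The matrices T i (acting on column vectors F^r) have no common invariant
   subspace other than 0 and F^r.  A subspace of column vectors is encoded as
   the row space of U (rows = transposed vectors); x |-> T x becomes
   x^T |-> x^T *m T^T. *)
Definition irreducible_family (F : fieldType) n r (T : 'I_n -> 'M[F]_r) : Prop :=
  forall U : 'M[F]_r, (forall i, stablemx U (T i)^T) ->
    (U == (0 : 'M[F]_r))%MS || (U == (1%:M : 'M[F]_r))%MS.

(* Main.v *)
Require Import Defs.
From HB Require Import structures.
From mathcomp Require Import all_boot all_order all_algebra all_fingroup.
From mathcomp Require Import boolp classical_sets reals topology normedtype sequences derive exp trigo complex.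
From mathcomp Require Import ring lra zify.
Set Implicit Arguments. Unset Strict Implicit. Unset Printing Implicit Defensive.
Import Order.TTheory GRing.Theory Num.Theory.

(** Let E_i be a triangular form of C_i adapted to the images of the partial
    products of the (C_i - lambda); the sizes of its scalar diagonal blocks are the
    parts of P^i.  Condition (2) on the level functions gives the strict inequality
    sum_i sum_j p_ij (m_ij - p_ij) < (n - 2) r1 (r - r1) for all ways of splitting
    the flags in a direct sum of bundles of ranks r1 and r - r1.  By a count of
    dimensions, the bundle O(1)^k + O^(r-k) with general flags g_i at n points then
    has no nontrivial idempotent endomorphism, so its endomorphisms have a single
    eigenvalue, and by duality it carries a logarithmic connection whose residues
    preserve the flags, with logarithms of the eigenvalues on the graded pieces;
    condition (1) makes their sum the integer k.  The monodromy consists of T_i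
    with product 1, each conjugate to a triangular matrix with the same diagonal as
    E_i, hence only in the closure of C_i.  Multiplicative genericity makes the
    family T_i irreducible.  By Schur's lemma the differential of the product along
    simultaneous conjugations is onto modulo scalars, so a Newton iteration can
    follow the segments from T_i to conjugates of E_i, which lie in C_i outside
    finitely many parameters, while keeping the product scalar; determinants and
    smallness force this scalar to be 1. *)

(** * Level functions *)

(** The duality argument prescribes each residue only on the graded pieces of its flag and leaves
    the part above them uncontrolled; this is why classes are first met in their closures and
    reached afterwards by deformation. Genericity survives this detour because it depends on
    characteristic polynomials only, so one argument gives irreducibility before and after the
    deformation. A logarithm is chosen per eigenvalue, not per index, so two exponents at one point
    never differ by a nonzero integer; a shift common to all exponents of the first point then
    brings [k] into the range [0 <= k < r]. The analysis uses no paths and no covering spaces: the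
    domains are discs and half-planes, derivatives are taken along segments, and a turn around a
    pole is cut into four overlapping discs. The poles are roots of unity, and eight additional ones
    with zero residue bring neighbours close enough for explicit discs to link the unit disc with
    the half-planes outside it. *)

Lemma sum_ltn B k : (\sum_(l < B) (l < k)%N = minn k B)%N.
Proof.
elim: B => [|B IH]; first by rewrite big_ord0 minn0.
by rewrite big_ord_recr /= IH; case: ltnP; lia.
Qed.

Section Lev.
Variables (B L : nat).
Implicit Type s p q : 'I_B -> nat.
(** The least number of columns that together hold [mu] boxes, capped at [L], obtained by counting
    the widths [c] that are too narrow. The rows [s j] need be neither sorted nor positive, so
    splitting every row into two pieces stays within the same formalism. *)
Definition lev s mu := \sum_(c < L) (\sum_j minn (s j) c < mu)%N.

Lemma lev_leq s mu t : (mu <= \sum_j minn (s j) t)%N -> (lev s mu <= t)%N.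
Proof.
move=> h; apply: (@leq_trans (\sum_(c < L) (c < t)%N)).
  apply: leq_sum => c _; case: ltnP => //= h2; case: ltnP => // tc.
  by move: h2; rewrite ltnNge (leq_trans h) //; apply: leq_sum => j _; lia.
elim: L => [|k IH]; first by rewrite big_ord0.
rewrite big_ord_recr /=; case: ltnP => kt /=; last by rewrite addn0.
apply: leq_trans kt; rewrite addn1 ltnS; apply: leq_trans (_ : \sum_(i < k) 1 <= k)%N.
  by apply: leq_sum => i _; case: ltnP.
by rewrite sum1_card card_ord.
Qed.

Lemma lev_geq s mu : (lev s mu < L)%N -> (mu <= \sum_j minn (s j) (lev s mu))%N.
Proof.
move=> lL; rewrite leqNgt; apply/negP => h.
have : (lev s mu < lev s mu)%N; last by rewrite ltnn.
rewrite {2}/lev; apply: (@leq_trans (\sum_(c < L) (c < (lev s mu).+1)%N)).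
  rewrite -big_mkcond -(big_ord_widen _ (fun=> 1%N)) ?sum1_card ?card_ord //.
apply: leq_sum => c _; case: ltnP => //= cl.
suff -> : (\sum_j minn (s j) c < mu)%N by [].
by apply: leq_ltn_trans h; apply: leq_sum => j _; lia.
Qed.

Lemma lev_le_L s mu : (lev s mu <= L)%N.
Proof.
apply: leq_trans (_ : \sum_(i < L) 1 <= L)%N; last by rewrite sum1_card card_ord.
by apply: leq_sum => i _; case: ltnP.
Qed.

(** Widths chosen for the two pieces add up, because [minn p a + minn q b <= minn (p + q) (a + b)]
    holds row by row. *)
Lemma lev_super s p q mu nu : (forall j, s j = p j + q j)%N ->
  (lev s (mu + nu) <= lev p mu + lev q nu)%N.
Proof.
move=> sE; case: (ltnP (lev p mu + lev q nu) L) => h; last exact: leq_trans (lev_le_L _ _) h.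
apply: lev_leq; have hp := @lev_geq p mu; have hq := @lev_geq q nu.
apply: leq_trans (leq_add (hp _) (hq _)) _; try lia.
by rewrite -big_split /=; apply: leq_sum => j _; rewrite sE; move: (lev p mu) (lev q nu) => a b; lia.
Qed.

Lemma lev0 s : lev s 0 = 0%N. Proof. by apply: big1. Qed.

Lemma lev1 s : (0 < \sum_j s j)%N -> (0 < L)%N -> lev s 1 = 1%N.
Proof.
move=> s0 L0; apply/eqP; rewrite eqn_leq lev_leq /=; last first.
  rewrite lt0n sum_nat_eq0; apply: contraL s0 => /forallP h; rewrite -eqn0Ngt sum_nat_eq0.
  by apply/forallP => j; have := h j; case: (s j).
rewrite /lev; case: L L0 => // l _; rewrite big_ord_recl /= big1 //.
Qed.

(** Column indices are added over all boxes by rows instead of by box number: row [j] contributes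
    [1 + ... + s j]. *)
Lemma sum_lev s r : \sum_j s j = r -> (r <= L)%N ->
  (2 * \sum_(1 <= mu < r.+1) lev s mu = \sum_j s j * (s j).+1)%N.
Proof.
move=> sr rL; rewrite /lev exchange_big /=.
have E1 (c : 'I_L) : (\sum_(1 <= mu < r.+1) (\sum_j minn (s j) c < mu) = \sum_j (s j - c))%N.
  have le : (\sum_j minn (s j) c <= r)%N by rewrite -sr; apply: leq_sum => j _; lia.
  have -> : (\sum_j (s j - c) = r - \sum_j minn (s j) c)%N.
    by rewrite -sr -sumnB; [apply: eq_bigr => j _; lia|move=> j _; lia].
  move: le; move: (\sum_j minn (s j) c)%N => x; elim: r {sr rL} => [|k IH] xk.
    by rewrite big_geq.
  rewrite big_nat_recr //=; case: (ltnP x k.+1) => h; last first.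
    have -> : x = k.+1 by lia.
    rewrite subnn addn0 big_nat big1 // => i ik; lia.
  by rewrite IH; lia.
rewrite (eq_bigr _ (fun c _ => E1 c)) exchange_big /= big_distrr /=.
apply: eq_bigr => j _; have jL : (s j <= L)%N.
  by apply: leq_trans rL; rewrite -sr (bigD1 j) //= leq_addr.
have : forall l, (2 * \sum_(c < l) (s j - c) = minn l (s j) * (2 * s j + 1 - minn l (s j)))%N.
  elim=> [|l IH]; first by rewrite big_ord0 min0n.
  rewrite big_ord_recr /= mulnDr IH; nia.
by move=> /(_ L) ->; nia.
Qed.
End Lev.

Lemma nth_flatten_nseq (f : nat -> nat) b a k : (k < \sum_(j < b) f (a + j))%N ->
  nth 0%N (flatten [seq nseq (f j) j | j <- iota a b]) k = (a + \sum_(c < b) (\sum_(j < c.+1) f (a + j) <= k))%N.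
Proof.
elim: b a k => [|b IH] a k; first by rewrite big_ord0.
have E0 c : (\sum_(j < c.+1) f (a + j) = f a + \sum_(j < c) f (a.+1 + j))%N.
  by rewrite big_ord_recl /= addn0; congr (_ + _)%N; apply: eq_bigr => j _; congr f; rewrite /bump /=; lia.
rewrite E0 => kl /=; rewrite nth_cat size_nseq big_ord_recl /= E0 big_ord0 addn0.
case: ltnP => ka.
  rewrite nth_nseq ka big1 ?addn0 // => c _; rewrite E0.
  by case: leqP => // h; lia.
rewrite IH; last by lia.
rewrite addnA addn1; congr (_ + _)%N; apply: eq_bigr => c _; congr nat_of_bool.
have -> : bump 0 c = c.+1 by [].
rewrite [in RHS]E0; by apply/idP/idP; lia.
Qed.

Lemma sum_count (P : seq nat) c : (\sum_(j < c) count (fun m => j.+1 <= m) P = \sum_(m <- P) minn m c)%N.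
Proof.
elim: P => [|m P IH]; first by rewrite big_nil big1.
rewrite big_cons -IH /= -[X in (X + _)%N](_ : \sum_(j < c) (j < m) = minn m c)%N -?big_split //.
by rewrite sum_ltn.
Qed.

(** Bridge to the level function of the theorem: sorting the rows and dropping the empty ones does
    not change how many boxes lie in the first [c] columns. *)
Lemma level_lev B L (s : 'I_B -> nat) P k :
  perm_eq P [seq x <- [seq s j | j <- enum 'I_B] | (0 < x)%N] -> sorted geq P ->
  (0 < k <= \sum_j s j)%N -> (\sum_j s j <= L)%N -> level P k = lev L s k.
Proof.
move=> pP sP /andP[k0 kS] SL.
have mE c : (\sum_(m <- P) minn m c = \sum_j minn (s j) c)%N.
  rewrite (perm_big _ pP) /= big_filter big_map big_mkcond /= big_enum /=.
  by apply: eq_bigr => j _; case: posnP => // ->; rewrite min0n.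
have hd m : m \in P -> (m <= head 0%N P)%N.
  case: (P) sP => //= x t; rewrite path_sortedE => [/andP[/allP h _]|]; last by move=> a b d /= ab bd; apply: leq_trans bd ab.
  by rewrite inE => /orP[/eqP -> //|/h].
have full c : (head 0%N P <= c)%N -> (\sum_(m <- P) minn m c = \sum_j s j)%N.
  move=> hc; have -> : (\sum_j s j = \sum_(m <- P) m)%N.
    rewrite [RHS](perm_big _ pP) /= [RHS]big_filter [RHS]big_map [RHS]big_mkcond /= [RHS]big_enum /=.
    by apply: eq_bigr => j _; case: posnP.
  by apply: eq_big_seq => m /hd mh; apply/minn_idPl; apply: leq_trans hc.
have hL : (head 0%N P <= L)%N.
  apply: leq_trans SL; rewrite -(full _ (leqnn _)); case: (P) => //= x t.
  by rewrite big_cons minnn leq_addr.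
pose f j := count (fun m => j <= m)%N P; set h := head 0%N P in hd full hL.
have -> : level P k = nth 0%N (flatten [seq nseq (f j) j | j <- iota 1 h]) k.-1.
  rewrite /level -/h; congr (nth _ (flatten _) _); apply/eq_in_map => j; rewrite mem_iota => /andP[j1 jh].
  rewrite /conj_partition -/h (nth_map 0%N) ?size_iota ?nth_iota; try lia.
  by congr nseq; rewrite /f; apply: eq_count => m; congr (_ <= _)%N; lia.
have fS c : (\sum_(j < c) f (1 + j) = \sum_(m <- P) minn m c)%N by rewrite -sum_count.
rewrite nth_flatten_nseq; last by rewrite fS full //; lia.
(* The term [c = 0] supplies the initial 1 of the one-based column index: width zero holds no box,
   and [0 < k]. *)
transitivity (\sum_(c < h.+1) (\sum_j minn (s j) c < k))%N.
  have z0 : (\sum_j minn (s j) 0 = 0)%N by apply: big1 => j _; rewrite minn0.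
  rewrite [RHS]big_ord_recl /= z0 k0.
  congr (_ + _)%N; apply: eq_bigr => c _; rewrite fS mE /= /bump /=; congr nat_of_bool.
  by rewrite add1n; apply/idP/idP; lia.
have E l : (h <= l)%N -> (\sum_(c < l) (\sum_j minn (s j) c < k) = \sum_(c < h) (\sum_j minn (s j) c < k))%N.
  elim: l => [|l IH]; first by rewrite leqn0 => /eqP ->.
  rewrite leq_eqVlt ltnS => /orP[/eqP -> //|hl]; rewrite big_ord_recr /= IH // -mE full //.
  by rewrite ltnNge kS addn0.
by rewrite E // /lev E.
Qed.

Local Open Scope ring_scope.

(** With the defect [D s mu], equal to [(n - 2) * mu] minus the sum of the levels, the hypothesis
    reads [D m mu + 1 >= 0], and the sum of [D + 1] is a quadratic expression in the ranks whose
    polarization compares the two sides below. So it suffices that the sums for [p] and [q] together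
    do not exceed the sum for [m]. *)
Theorem star_inequality n B L (m p : 'I_n -> 'I_B -> nat) r r1 :
  (2 < n)%N -> (forall i j, p i j <= m i j)%N -> (forall i, \sum_j m i j = r)%N ->
  (forall i, \sum_j p i j = r1)%N -> (0 < r1 < r)%N -> (r <= L)%N ->
  (forall mu, 2 <= mu <= r -> \sum_i lev L (m i) mu < (n - 2) * mu + 2)%N ->
  (\sum_i \sum_j p i j * (m i j - p i j) < (n - 2) * r1 * (r - r1))%N.
Proof.
move=> n2 pm mr pr r1r rL H2; pose q i j := (m i j - p i j)%N; pose r2 := (r - r1)%N.
have qr i : (\sum_j q i j = r2)%N.
  by rewrite /q sumnB => [|j _]; rewrite ?mr ?pr.
pose D (s : 'I_n -> 'I_B -> nat) mu : int := ((n - 2) * mu)%N%:Z - (\sum_i lev L (s i) mu)%N%:Z.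
have Dsup mu nu : D p mu + D q nu <= D m (mu + nu)%N.
  have : (\sum_i lev L (m i) (mu + nu) <= \sum_i lev L (p i) mu + \sum_i lev L (q i) nu)%N.
    rewrite -big_split; apply: leq_sum => i _; apply: lev_super => j.
    by rewrite subnKC.
  by rewrite /D mulnDr; lia.
have D0 s : D s 0%N = 0.
  by rewrite /D muln0 big1 // => i _; rewrite lev0.
have D1 s t : (forall i, \sum_j s i j = t)%N -> (0 < t)%N -> D s 1%N = -2%:Z.
  move=> st t0; rewrite /D (eq_bigr (fun=> 1%N)); first by rewrite sum1_card card_ord; lia.
  by move=> i _; rewrite lev1 ?st //; lia.
have sumD s t : (forall i, \sum_j s i j = t)%N -> (0 < t <= L)%N ->
   2 * (\sum_(2 <= mu < t.+1) (D s mu + 1)) = ((n - 2) * t ^ 2)%N%:Z - (\sum_i \sum_j s i j ^ 2)%N%:Z + 2.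
  move=> st /andP[t0 tL].
  (* [D s 1 = -2] for every nonempty [s], so moving the start of the sum from 1 to 2 costs the
     constant 1. It becomes the [+ 2] of the formula and in the end the strictness of the
     inequality. *)
  have -> : \sum_(2 <= mu < t.+1) (D s mu + 1) = \sum_(1 <= mu < t.+1) (D s mu + 1) + 1.
    by rewrite [in RHS]big_ltn // (D1 _ _ st t0); move: (\sum_(2 <= _ < _) _) => S; lia.
  have -> : \sum_(1 <= mu < t.+1) (D s mu + 1) =
     (\sum_(1 <= mu < t.+1) ((n - 2) * mu + 1))%N%:Z - (\sum_i \sum_(1 <= mu < t.+1) lev L (s i) mu)%N%:Z.
    rewrite exchange_big /= !(big_morph Posz PoszD (erefl _)) -sumrB.
    by apply: eq_bigr => mu _; rewrite /D ?(big_morph Posz PoszD (erefl _)) PoszD; lia.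
  have E1 : (2 * (\sum_(1 <= mu < t.+1) ((n - 2) * mu + 1)) = (n - 2) * (t * t.+1) + 2 * t)%N.
    elim: t {st t0 tL} => [|k IH]; first by rewrite big_geq // mul0n !muln0.
    by rewrite big_nat_recr //= mulnDr IH; nia.
  have E2 : (2 * (\sum_i \sum_(1 <= mu < t.+1) lev L (s i) mu) = \sum_i \sum_j s i j ^ 2 + n * t)%N.
    rewrite big_distrr /= (eq_bigr (fun i => \sum_j s i j ^ 2 + t)%N).
      by rewrite big_split /= sum_nat_const card_ord.
    by move=> i _; rewrite (sum_lev (st i) tL) -(st i) -big_split; apply: eq_bigr => j _; rewrite mulnS -mulnn addnC.
  have E3 : ((n - 2) * t + 2 * t = n * t)%N by rewrite -mulnDl subnK // ltnW.
  move: E1 E2 E3; rewrite expnS expn1 mulnS mulnDr.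
  set X := (\sum_(1 <= _ < _) _)%N; set Y := (\sum_i \sum_(1 <= _ < _) _)%N; set Z := (\sum_i _)%N.
  move: ((n - 2) * t)%N ((n - 2) * (t * t))%N (n * t)%N => a b c; lia.
have r12 : (r1 + r2 = r)%N by rewrite /r2; lia.
pose E mu : int := if (2 <= mu <= r)%N then D m mu + 1 else 0.
have E0 mu : 0 <= E mu.
  rewrite /E; case: ifP => // h; have := H2 _ h; rewrite /D; lia.
(* Let [a] be the last index with [D p a >= 0]. The terms of [p] beyond [a] contribute at most 0,
   those up to [a] are bounded by [D m mu], and those of [q] by [D m (a + nu)]; disjoint parts of
   the sum for [m] are used. *)
have [a [ar Da Dgt]] : exists a, [/\ (a <= r1)%N, 0 <= D p a & forall b, (a < b <= r1)%N -> D p b < 0].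
  pose P a := (a <= r1)%N && (0 <= D p a).
  have ex : exists a, P a by exists 0%N; rewrite /P D0.
  have ub a : P a -> (a <= r1)%N by case/andP.
  case: (ex_maxnP ex ub) => a /andP[h1 h2] h3; exists a; split=> // b /andP[ab br].
  rewrite ltNge; apply/negP => hb; have : (b <= a)%N by apply: h3; rewrite /P br.
  by rewrite leqNgt ab.
have Sb : \sum_(2 <= mu < r1.+1) (D p mu + 1) <= \sum_(0 <= mu < a.+1) E mu.
  apply: (@le_trans _ _ (\sum_(2 <= mu < r1.+1) (if (mu <= a)%N then E mu else 0))).
    rewrite big_nat_cond [X in _ <= X]big_nat_cond; apply: ler_sum => mu /andP[/andP[m2 mr1] _].
    case: leqP => h; last by have := Dgt mu; rewrite h -ltnS mr1 => /(_ isT); lia.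
    have mm : (2 <= mu <= r)%N by lia.
    by rewrite /E mm; have := Dsup mu 0%N; rewrite D0 addn0; lia.
  have r1p : (1 < r1.+1)%N by lia.
  rewrite [X in _ <= X](@big_nat_widen _ _ _ 0 a.+1 r1.+1) // [X in _ <= X]big_mkcond /= [X in _ <= X](@big_cat_nat _ _ _ 2) //=.
  by rewrite lerDr; apply: sumr_ge0 => mu _; case: ifP.
have Sg : \sum_(2 <= mu < r2.+1) (D q mu + 1) <= \sum_(1 <= nu < r2.+1) E (a + nu)%N.
  rewrite (@big_ltn _ _ _ 1) ?ltnS; last by rewrite /r2; lia.
  apply: (@le_trans _ _ (\sum_(2 <= nu < r2.+1) E (a + nu)%N)); last by rewrite lerDr.
  rewrite big_nat_cond [X in _ <= X]big_nat_cond; apply: ler_sum => mu /andP[/andP[m2 mr2] _].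
  have mm : (2 <= a + mu <= r)%N by lia.
  by rewrite /E mm; have := Dsup a mu; lia.
have Sa : \sum_(0 <= mu < a.+1) E mu + \sum_(1 <= nu < r2.+1) E (a + nu)%N <= \sum_(2 <= mu < r.+1) (D m mu + 1).
  have -> : \sum_(1 <= nu < r2.+1) E (a + nu)%N = \sum_(a.+1 <= mu < (a + r2).+1) E mu.
    have ea : ((a + r2).+1 - a = r2.+1)%N by lia.
    by rewrite -[a.+1]add1n big_addn ea; apply: eq_bigr => k _; rewrite addnC.
  rewrite -big_cat_nat //=; last by rewrite ltnS leq_addr.
  apply: (@le_trans _ _ (\sum_(0 <= mu < r.+1) E mu)).
    rewrite [X in _ <= X](@big_cat_nat _ _ _ (a + r2).+1) //=; last by lia.
    by rewrite lerDl; apply: sumr_ge0.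
  rewrite (@big_ltn _ _ _ 0) // (@big_ltn _ _ _ 1); last by lia.
  rewrite {1 2}/E /= !add0r big_nat_cond [X in _ <= X]big_nat_cond; apply: ler_sum => mu /andP[/andP[m2 mr1] _].
  by rewrite /E m2 -ltnS mr1.
have S1 := sumD _ _ pr; have S2 := sumD _ _ qr; have S3 := sumD _ _ mr.
have Q : (\sum_i \sum_j m i j ^ 2 = \sum_i \sum_j p i j ^ 2 + \sum_i \sum_j q i j ^ 2 + 2 * \sum_i \sum_j p i j * q i j)%N.
  rewrite big_distrr -!big_split; apply: eq_bigr => i _ /=; rewrite big_distrr -!big_split; apply: eq_bigr => j _ /=.
  have mE : m i j = (p i j + q i j)%N by rewrite subnKC.
  by rewrite mE sqrnD.
have R : ((n - 2) * r ^ 2 = (n - 2) * r1 ^ 2 + (n - 2) * r2 ^ 2 + 2 * ((n - 2) * r1 * r2))%N.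
  rewrite -[in LHS]r12 sqrnD !mulnDr; congr (_ + _)%N.
  by rewrite muln0 addn0 addnn -mul2n -[in RHS]mulnA.
have c1 : (0 < r1 <= L)%N by lia.
have c2 : (0 < r2 <= L)%N by lia.
have c3 : (0 < r <= L)%N by lia.
move: (S1 c1) (S2 c2) (S3 c3); rewrite Q R -/r2 => h1 h2 h3; rewrite -/(q _ _).
have -> : (\sum_i \sum_j p i j * (m i j - p i j) = \sum_i \sum_j p i j * q i j)%N by [].
move: h1 h2 h3 Sa Sb Sg; lia.
Qed.

(** * Parabolic maps for general flags *)

Lemma zmod_swap (V : zmodType) (p q s t : V) : p - q - (s - t) = p - s - (q - t).
Proof. by rewrite !opprB !addrA [LHS]addrAC [RHS]addrAC; congr (_ + _); rewrite addrAC. Qed.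

(** * Linear maps between spaces of matrices *)

Section GeneralLinear.
Variable F : fieldType.

Lemma sum_mxvec m n (G : 'I_(m * n) -> F) : \sum_k G k = \sum_a \sum_b G (mxvec_index a b).
Proof. by rewrite pair_bigA (reindex _ (curry_mxvec_bij _ _)) /=; apply: eq_bigr => -[a b]. Qed.

Lemma tr_lin_mx m n (f : 'M[F]_(m, n) -> 'M[F]_(m, n)) :
  \tr (lin_mx f) = \sum_a \sum_b f (delta_mx a b) a b.
Proof.
rewrite /mxtrace sum_mxvec; apply: eq_bigr => a _; apply: eq_bigr => b _.
by rewrite mxE /= vec_mx_delta mxvecE.
Qed.

(** A rank factorization [C *m B] of an idempotent satisfies [B *m C = 1%:M], and the trace does not
    see the order of the factors. *)
Lemma idem_trace n (P : 'M[F]_n) : P *m P = P -> \tr P = (\rank P)%:R.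
Proof.
move=> PP; have BC : row_base P *m col_base P = 1%:M.
  have [Rr BR] := row_freeP (row_base_free P); have [Lr LC] := row_fullP (col_base_full P).
  have E := mulmx_base P; move: E BR LC; set C := col_base P; set B := row_base P => E BR LC.
  have h1 : Lr *m (C *m B *m (C *m B)) *m Rr = (Lr *m C) *m (B *m C) *m (B *m Rr) by rewrite !mulmxA.
  have h2 : Lr *m (C *m B) *m Rr = (Lr *m C) *m (B *m Rr) by rewrite !mulmxA.
  have PP' : C *m B *m (C *m B) = C *m B by rewrite E PP.
  by move: h1; rewrite PP' h2 LC BR !mul1mx mulmx1.
have -> : \tr P = \tr (col_base P *m row_base P) by rewrite mulmx_base.
by rewrite mxtrace_mulC BC mxtrace1.
Qed.

(** Linear duality: what vanishes on the kernel of [M] is a function of the image. Residues will be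
    produced in this way from a vanishing condition on endomorphisms. *)
Lemma linear_factor d w q (M : 'M[F]_(d, w)) (l : 'M[F]_(d, q)) :
  (forall v : 'rV_d, v *m M = 0 -> v *m l = 0) -> exists nu : 'M_(w, q), M *m nu = l.
Proof.
move=> h; exists (pinvmx M *m l); apply/row_matrixP => i; rewrite mulmxA !row_mul.
apply/eqP; rewrite [row i l]rowE -subr_eq0 -mulmxBl; apply/eqP/h.
by rewrite mulmxBl mulmxKpV ?row_sub // rowE subrr.
Qed.

Lemma nonroot (s : nat -> F) (p : {poly F}) N : injective s -> p != 0 -> exists2 k, (N <= k)%N & ~~ root p (s k).
Proof.
move=> si p0; case: (boolP (all (root p) [seq s k | k <- iota N (size p)])) => h.
  have := max_poly_roots p0 h; rewrite map_inj_uniq // iota_uniq size_map size_iota ltnn => /(_ isT) //.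
move: h; rewrite -has_predC => /hasP [x /mapP[k]]; rewrite mem_iota => /andP[Nk _] -> /= h.
by exists k.
Qed.

Lemma lin_mxE m n p q (f : 'M[F]_(m, n) -> 'M[F]_(p, q)) : linear f ->
  forall A, mxvec A *m lin_mx f = mxvec (f A).
Proof.
move=> lf A; pose fl : {linear 'M[F]_(m, n) -> 'M[F]_(p, q)} := HB.pack f (GRing.isLinear.Build F _ _ _ f lf).
exact: (mul_vec_lin fl A).
Qed.

Lemma lin_fun0 m n p q (f : 'M[F]_(m, n) -> 'M[F]_(p, q)) : linear f -> f 0 = 0.
Proof. by move=> lf; have := lf (-1) 0 0; rewrite scaler0 addr0 scaleN1r addNr. Qed.

Lemma mx_invM m (A B : 'M[F]_m) : A \in unitmx -> B \in unitmx -> invmx (A *m B) = invmx B *m invmx A.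
Proof.
move=> Au Bu; have u : A *m B \in unitmx by rewrite unitmx_mul Au.
by apply: (can_inj (mulKmx u)); rewrite mulmxV // -mulmxA mulKVmx // mulmxV.
Qed.

Lemma mxvec_mul_inj m n p (X Y : 'M[F]_(m * n, p)) : (forall A : 'M_(m, n), mxvec A *m X = mxvec A *m Y) -> X = Y.
Proof.
move=> h; apply/row_matrixP => i; rewrite !rowE.
by have := h (vec_mx (delta_mx 0 i)); rewrite vec_mxK.
Qed.

Lemma mul_delta_mul m n (X : 'M[F]_m) (Y : 'M[F]_n) a b i j : (X *m delta_mx a b *m Y) i j = X i a * Y b j.
Proof.
rewrite -(mul_delta_mx (0 : 'I_1)) mulmxA -colE -mulmxA -rowE mxE big_ord1 !mxE //.
Qed.
End GeneralLinear.

Section ConstantRank.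
Variable F : numFieldType.

Lemma natS_inj : injective (fun k => k.+1%:R : F).
Proof. by move=> i j /eqP; rewrite eqr_nat => /eqP []. Qed.

(** Where the rank is maximal, the first-order variation sends the kernel into the image. Otherwise
    a basis of the image together with [v *m M1] would have rank [k + 1]; this persists at a generic
    [t] for the rows obtained from the family after division of the last one by [t], so the family
    would exceed rank [k]. *)
Lemma const_rank d w (M0 M1 M2 : 'M[F]_(d, w)) (v : 'rV_d) :
  (forall t : F, (\rank (M0 + t *: M1 + t ^+ 2 *: M2)%R <= \rank M0)%N) ->
  v *m M0 = 0 -> (v *m M1 <= M0)%MS.
Proof.
move=> mx vM; apply/negPn/negP => nle; set k := \rank M0.
pose U : 'M[F]_(k, d) := row_base M0 *m pinvmx M0.
have UM : U *m M0 = row_base M0 by rewrite mulmxKpV // eq_row_base.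
pose N0 := col_mx (row_base M0) (v *m M1).
have fN : row_free N0.
  have r0 : \rank (row_base M0) = k by rewrite eq_row_base.
  have h : (k < \rank (row_base M0 + v *m M1)%MS)%N.
    rewrite -{1}r0 (ltn_leqif (mxrank_leqif_sup (addsmxSl _ _))) addsmx_sub negb_and.
    by rewrite !eq_row_base nle orbT.
  by rewrite /row_free eqn_leq rank_leq_row /= -addsmxE addn1.
have [C NC] := row_freeP fN.
pose q (X0 X1 X2 : 'M[F]_(k + 1, w)) : {poly F} :=
  \det (map_mx polyC (X0 *m C) + 'X *: map_mx polyC (X1 *m C) + 'X^2 *: map_mx polyC (X2 *m C)).
have qE X0 X1 X2 t : (q X0 X1 X2).[t] = \det ((X0 + t *: X1 + t ^+ 2 *: X2) *m C).
  rewrite /q -horner_evalE -det_map_mx; congr (\det _); apply/matrixP => i j.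
  by rewrite !mulmxDl -!scalemxAl !mxE /= /horner_eval !hornerE.
pose N2 : 'M[F]_(k + 1, w) := col_mx (U *m M2) 0.
pose p := q N0 (col_mx (U *m M1) (v *m M2)) N2.
have p0 : p != 0.
  apply: contraTneq (oner_neq0 F) => p0; have := qE N0 (col_mx (U *m M1) (v *m M2)) N2 0.
  rewrite -/p p0 horner0 scale0r expr0n scale0r !addr0 NC det1 => <-.
  by rewrite eqxx.
have [j _] := nonroot 0 natS_inj p0; set t := _%:R; rewrite /root qE => dt.
have t0 : t != 0 by rewrite pnatr_eq0.
pose Mt := M0 + t *: M1 + t ^+ 2 *: M2.
have E : col_mx U v *m Mt = block_mx 1%:M 0 0 t%:M *m
    (N0 + t *: col_mx (U *m M1) (v *m M2) + t ^+ 2 *: N2).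
  have -> : N0 + t *: col_mx (U *m M1) (v *m M2) + t ^+ 2 *: N2 =
     col_mx (U *m Mt) (v *m M1 + t *: (v *m M2)).
    rewrite /N0 /N2 !scale_col_mx !add_col_mx scaler0 addr0; congr col_mx.
    by rewrite /Mt !mulmxDr -!scalemxAr UM.
  rewrite mul_block_col !mul1mx !mul0mx addr0 add0r mul_col_mx; congr col_mx.
  by rewrite mul_scalar_mx scalerDr scalerA -expr2 /Mt !mulmxDr -!scalemxAr vM add0r.
have full : (k + 1 <= \rank (N0 + t *: col_mx (U *m M1) (v *m M2) + t ^+ 2 *: N2)%R)%N.
  set Nt := (N0 + _ + _); have e : \rank (Nt *m C) = (k + 1)%N by apply: mxrank_unit; rewrite unitmxE unitfE.
  by move: (mxrankM_maxl Nt C); rewrite e.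
have := mx t; rewrite leqNgt => /negP; apply; rewrite -/Mt -/k -addn1.
apply: leq_trans full _; apply: leq_trans (mxrankM_maxr (col_mx U v) _); rewrite E.
rewrite eqmxMfull // row_full_unit unitmxE det_ublock det1 mul1r det_scalar expr1 unitfE //.
Qed.
End ConstantRank.

(** * Block triangular matrices and their diagonal blocks *)

Section Blocks.
Variables (F : fieldType) (r : nat) (rho : 'I_r -> nat).
Definition bt (X : 'M[F]_r) := forall a b, X a b != 0 -> (rho a <= rho b)%N.
Definition blk j (X : 'M[F]_r) : 'M[F]_r := \matrix_(a, b) (if (rho a == j) && (rho b == j) then X a b else 0).

Lemma btM X Y : bt X -> bt Y -> bt (X *m Y).
Proof.
move=> tX tY a b; apply: contraNT => h; rewrite mxE big1 // => c _.
apply/eqP; rewrite mulf_eq0; apply/negPn/negP; rewrite negb_or => /andP[/tX h1 /tY h2].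
by move: h; rewrite (leq_trans h1).
Qed.

Lemma btD X Y : bt X -> bt Y -> bt (X + Y).
Proof.
move=> tX tY a b; rewrite mxE; have [->|/tX //] := eqVneq (X a b) 0.
by rewrite add0r; exact: tY.
Qed.

Lemma btZ k X : bt X -> bt (k *: X).
Proof. by move=> tX a b; rewrite mxE mulf_eq0 negb_or => /andP[_]; exact: tX. Qed.

Lemma bt_scalar k : bt k%:M.
Proof. by move=> a b; have [-> //|ab] := eqVneq a b; rewrite mxE (negbTE ab) mulr0n eqxx. Qed.

Lemma blkM j X Y : bt X -> bt Y -> blk j (X *m Y) = blk j X *m blk j Y.
Proof.
move=> tX tY; apply/matrixP => a b; rewrite !mxE; case: (boolP (rho a == j)) => [/eqP aj|aj] /=; last first.
  by rewrite big1 // => c _; rewrite !mxE (negbTE aj) mul0r.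
case: (boolP (rho b == j)) => [/eqP bj|bj] /=; last first.
  by rewrite big1 // => c _; rewrite !mxE (negbTE bj) andbF mulr0.
apply: eq_bigr => c _; rewrite !mxE aj bj eqxx andbT /=; case: eqP => // /eqP cj.
apply/eqP; rewrite mul0r mulf_eq0; apply/negPn/negP; rewrite negb_or => /andP[/tX h1 /tY h2].
by case/negP: cj; rewrite eqn_leq -{1}bj h2 -aj h1.
Qed.

Lemma tr_blk j X : \tr (blk j X) = \sum_(a | rho a == j) X a a.
Proof. by rewrite /mxtrace [RHS]big_mkcond; apply: eq_bigr => a _; rewrite mxE andbb. Qed.

(** Diagonal blocks of an idempotent are idempotent, so their traces are ranks: the dimensions that
    a direct summand takes from the graded pieces of a flag. *)
Lemma blk_idem j X : bt X -> X *m X = X ->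
  exists2 p, (p <= #|[pred a | rho a == j]|)%N & \sum_(a | rho a == j) X a a = p%:R.
Proof.
move=> tX XX; exists (\rank (blk j X)); last by rewrite -tr_blk idem_trace // -blkM // XX.
have -> : \rank (blk j X) = \rank (rowsub (fun k : 'I_#|[pred a | rho a == j]| => enum_val k) (blk j X)).
  apply/eqmx_rank/andP; split; last first.
    by apply/row_subP => k; rewrite row_rowsub row_sub.
  apply/row_subP => a; case: (boolP (rho a == j)) => aj; last first.
    by have -> : row a (blk j X) = 0; [apply/rowP => b; rewrite !mxE (negbTE aj)|exact: sub0mx].
  have aP : a \in [pred a | rho a == j] by [].
  have -> : row a (blk j X) = row (enum_rank_in aP a) (rowsub (fun k : 'I_#|[pred a | rho a == j]| => enum_val k) (blk j X)).
    by rewrite row_rowsub enum_rankK_in.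
  exact: row_sub.
exact: rank_leq_row.
Qed.

End Blocks.

Section NilTrace.
Variable F : closedFieldType.

Lemma tr_nil r (X : 'M[F]_r) s : X ^+ s = 0 -> \tr X = 0.
Proof.
case: r X => [|r] X Xs; first by rewrite /mxtrace big_ord0.
have [e eE] := closed_field_poly_normal (char_poly X).
rewrite (monicP (char_poly_monic X)) scale1r in eE.
have e0 x : x \in e -> x = 0.
  move=> xe; have : root (char_poly X) x by rewrite eE root_prod_XsubC.
  rewrite -eigenvalue_root_char => /eigenvalueP[v vX v0].
  have : v *m X ^+ s = x ^+ s *: v.
    elim: s {Xs} => [|s IH]; first by rewrite mulmx1 scale1r.
    by rewrite exprSr -mulmxE mulmxA IH -scalemxAl vX scalerA exprSr.
  by rewrite Xs mulmx0 => /esym/eqP; rewrite scaler_eq0 (negbTE v0) orbF expf_eq0 => /andP[_ /eqP].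
have := char_poly_trace X (ltn0Sn r); rewrite eE.
have -> : \prod_(z <- e) ('X - z%:P) = 'X^(size e).
  rewrite (eq_big_seq (fun=> 'X)) ?big_const_seq ?count_predT ?iter_mulr_1 // => z /e0 ->.
  by rewrite subr0.
have se : size e = r.+1.
  by have := size_char_poly X; rewrite eE size_prod_XsubC => -[].
rewrite se coefXn /=; have -> : (r == r.+1) = false by apply/eqP; lia.
by move/eqP; rewrite eq_sym oppr_eq0 => /eqP.
Qed.

(** Taking a diagonal block is multiplicative on block triangular matrices, so the block of
    [X - l%:M] is nilpotent and has trace zero. *)
Lemma blk_nil r (rho : 'I_r -> nat) j (X : 'M[F]_r) l s : bt rho X -> (X - l%:M) ^+ s = 0 ->
  \sum_(a | rho a == j) X a a = l * #|[pred a | rho a == j]|%:R.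
Proof.
move=> tX Xs; have tY : bt rho (X - l%:M).
  by apply: btD => //; rewrite -raddfN; exact: bt_scalar.
have bs k : blk rho j ((X - l%:M) ^+ k.+1) = blk rho j (X - l%:M) ^+ k.+1.
  elim: k => [|k IH] //; rewrite exprSr [RHS]exprSr -IH; apply: blkM => //.
  by elim: k {IH} => [|k IH] //; rewrite exprSr; exact: btM.
have : \tr (blk rho j (X - l%:M)) = 0.
  apply: (@tr_nil _ _ s.+1); rewrite -bs exprS Xs mulr0; apply/matrixP => a b.
  by rewrite !mxE; case: ifP.
rewrite tr_blk; under eq_bigr do rewrite !mxE eqxx mulr1n.
by rewrite sumrB sumr_const => /eqP; rewrite subr_eq0 => /eqP ->; rewrite mulr_natr.
Qed.
End NilTrace.

Section Triangular.
Variables (F : fieldType) (r : nat) (rho : 'I_r -> nat).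
(** Stronger than block triangular: the diagonal blocks are themselves diagonal. *)
Definition tri (X : 'M[F]_r) := forall a b, X a b != 0 -> a = b \/ (rho a < rho b)%N.

Lemma triM_diag (X Y : 'M[F]_r) a : tri X -> tri Y -> (X *m Y) a a = X a a * Y a a.
Proof.
move=> tX tY; rewrite mxE (bigD1 a) //= big1 ?addr0 // => c ca.
apply/eqP; rewrite mulf_eq0; apply/negPn/negP; rewrite negb_or => /andP[/tX h1 /tY h2].
by case: h1 h2 ca => [->|h1] [e|h2] ca; rewrite ?eqxx // in ca; [rewrite e ltnn in h1 | have := ltn_trans h1 h2; rewrite ltnn].
Qed.

Lemma triM (X Y : 'M[F]_r) : tri X -> tri Y -> tri (X *m Y).
Proof.
move=> tX tY a b; apply: contraNP => h; rewrite mxE big1 // => c _.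
apply/eqP; rewrite mulf_eq0; apply/negPn/negP; rewrite negb_or => /andP[/tX h1 /tY h2].
by apply: h; case: h1 h2 => [->|h1] [<-|h2]; [left|right|right|right; exact: ltn_trans h2].
Qed.

(** Induction from the highest level downwards: in row [a] the unknown [Y a b] carries the nonzero
    factor [X a a], and only rows of higher level interfere. *)
Lemma tri_solve (X Y Z : 'M[F]_r) : tri X -> tri Z -> (forall a, X a a != 0) -> X *m Y = Z -> tri Y.
Proof.
move=> tX tZ X0 XY.
have [m rm] : exists m, forall a, (rho a <= m)%N by exists (\max_a rho a) => a; exact: leq_bigmax.
suff H k : forall a b, (m - rho a < k)%N -> Y a b != 0 -> a = b \/ (rho a < rho b)%N.
  by move=> a b; apply: (H m.+1); rewrite ltnS leq_subr.
elim: k => // k IH a b ak; apply: contraNP => h.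
have : (X *m Y) a b = 0.
  by rewrite XY; apply/eqP/negPn/negP => /tZ.
rewrite mxE (bigD1 a) //= big1 ?addr0; last first.
  move=> c ca; apply/eqP; rewrite mulf_eq0; apply/negPn/negP; rewrite negb_or => /andP[/tX h1 h2].
  case: h1 => [e|h1]; first by rewrite e eqxx in ca.
  have := IH c b _ h2; case=> [|e|h3]; last by apply: h; right; exact: ltn_trans h3.
    by have := rm a; have := rm c; lia.
  by apply: h; right; rewrite -e.
by move/eqP; rewrite mulf_eq0 (negbTE (X0 a)).
Qed.
End Triangular.

(** * Endomorphisms of a sum of copies of O(1) and O, with flags at points *)

Section Parabolic.
Variables (F : numClosedFieldType) (n r : nat) (c : pred 'I_r) (z : 'I_n -> F) (rho : 'I_n -> 'I_r -> nat).
Local Notation U := 'M[F]_(r, r + r).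

(** Endomorphisms of the bundle with summand O(1) at the indices in [c] and O elsewhere: the entry
    from [b] to [a] is a constant, a polynomial of degree at most one, or zero, according to the two
    summands. Masking arbitrary [r] by [2r] matrices, instead of passing to a subspace, keeps the
    domain a full matrix space, on which linear maps have matrices. *)
Definition mask0 (X : 'M[F]_r) : 'M[F]_r := \matrix_(a, b) (if ~~ c a && c b then 0 else X a b).
Definition mask1 (X : 'M[F]_r) : 'M[F]_r := \matrix_(a, b) (if c a && ~~ c b then X a b else 0).
Definition pa0 (w : U) := mask0 (lsubmx w).
Definition pa1 (w : U) := mask1 (rsubmx w).
Definition ev (w : U) x := pa0 w + x *: pa1 w.
Definition mulA (w v : U) : U := row_mx (pa0 w *m pa0 v) (pa0 w *m pa1 v + pa1 w *m pa0 v).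
Definition oneA : U := row_mx 1%:M 0.

Lemma pa0_linear : linear pa0.
Proof. by move=> k u v; apply/matrixP => a b; rewrite !mxE; case: ifP; rewrite ?mulr0 ?addr0. Qed.
Lemma pa1_linear : linear pa1.
Proof. by move=> k u v; apply/matrixP => a b; rewrite !mxE; case: ifP; rewrite ?mulr0 ?addr0. Qed.
Lemma ev_linear x : linear (ev^~ x).
Proof.
move=> k u v; rewrite /ev pa0_linear pa1_linear scalerDr scalerA [x * k]mulrC -scalerA.
by rewrite scalerDr addrACA.
Qed.

Lemma pa0_mul w v : pa0 (mulA w v) = pa0 w *m pa0 v.
Proof.
apply/matrixP => a b; rewrite mxE row_mxKl; case: ifP => // /andP[ca cb].
rewrite mxE big1 // => d _; rewrite !mxE ca cb andbT /=.
by case: (c d); rewrite ?mul0r ?mulr0.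
Qed.

Lemma pa1_mul w v : pa1 (mulA w v) = pa0 w *m pa1 v + pa1 w *m pa0 v.
Proof.
apply/matrixP => a b; rewrite mxE row_mxKr; case: ifP => // /negbT; rewrite negb_and negbK => h.
rewrite mxE ![(_ *m _) a b]mxE !big1 ?addr0 // => d _; rewrite !mxE;
  by move: h; case: (c a); case: (c b); case: (c d) => //=; rewrite ?mul0r ?mulr0.
Qed.

Lemma pa1_pa1 w v : pa1 w *m pa1 v = 0.
Proof.
apply/matrixP => a b; rewrite mxE [RHS]mxE big1 // => d _; rewrite !mxE.
by case: (c d); rewrite ?andbF ?mul0r ?mulr0 //= andbF mul0r.
Qed.

Lemma ev_mul w v x : ev (mulA w v) x = ev w x *m ev v x.
Proof.
rewrite /ev pa0_mul pa1_mul mulmxDl !mulmxDr -!scalemxAl -!scalemxAr pa1_pa1 !scaler0 addr0.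
by rewrite scalerDr addrA.
Qed.

Lemma pa0_one : pa0 oneA = 1%:M.
Proof.
apply/matrixP => a b; rewrite mxE row_mxKl !mxE; case: ifP => // /andP[ca cb].
by case: eqP => // ab; rewrite ab cb in ca.
Qed.
Lemma pa1_one : pa1 oneA = 0.
Proof. by apply/matrixP => a b; rewrite mxE row_mxKr !mxE; case: ifP. Qed.
Lemma ev_one x : ev oneA x = 1%:M.
Proof. by rewrite /ev pa0_one pa1_one scaler0 addr0. Qed.

Lemma tr_pa1 w : \tr (pa1 w) = 0.
Proof. by apply: big1 => a _; rewrite mxE andbN. Qed.

Lemma ev_inj w v x y : x != y -> ev w x = ev v x -> ev w y = ev v y -> pa0 w = pa0 v /\ pa1 w = pa1 v.
Proof.
move=> xy hx hy; have h1 : pa1 w = pa1 v.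
  have : (x - y) *: pa1 w = (x - y) *: pa1 v.
    have E u : (x - y) *: pa1 u = ev u x - ev u y by rewrite /ev opprD addrACA subrr add0r scalerBl.
    by rewrite !E hx hy.
  by apply: scalerI; rewrite subr_eq0.
by split=> //; apply: (addIr (x *: pa1 v)); rewrite -{1}h1.
Qed.

Lemma mulA_pa w w' v v' : pa0 w = pa0 w' -> pa1 w = pa1 w' -> pa0 v = pa0 v' -> pa1 v = pa1 v' -> mulA w v = mulA w' v'.
Proof. by rewrite /mulA => -> -> -> ->. Qed.

Lemma mulAA u v w : mulA (mulA u v) w = mulA u (mulA v w).
Proof.
rewrite {1 3}/mulA !pa0_mul !pa1_mul !mulmxA; congr row_mx.
by rewrite mulmxDl mulmxDr !mulmxA addrA.
Qed.

(** Coordinates on the quotient of all matrices by the stabilizer of the flag. The quotient is a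
    bimodule over the stabilizer, which is the content of [low_mul]. *)
Definition low i (X : 'M[F]_r) : 'M[F]_r := \matrix_(a, b) (if (rho i b < rho i a)%N then X a b else 0).

Lemma low_linear i : linear (low i).
Proof. by move=> k u v; apply/matrixP => a b; rewrite !mxE; case: ifP; rewrite ?mulr0 ?addr0. Qed.

Lemma lowP i X : low i X = 0 <-> bt (rho i) X.
Proof.
split=> [/matrixP h a b|h].
  by apply: contraNT; rewrite -ltnNge => ab; have := h a b; rewrite !mxE ab => /eqP.
apply/matrixP => a b; rewrite !mxE; case: ltnP => // ab; apply/eqP/negPn/negP => /h.
by rewrite leqNgt ab.
Qed.

Lemma lowD i X Y : low i (X + Y) = low i X + low i Y.
Proof. by have := low_linear i 1 X Y; rewrite !scale1r. Qed.

Lemma low_sub i X : bt (rho i) (X - low i X).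
Proof.
move=> a b; rewrite !mxE; case: ltnP => // ab; by rewrite subrr eqxx.
Qed.

Lemma low_mul i P X Q : bt (rho i) P -> bt (rho i) Q -> low i (P *m low i X *m Q) = low i (P *m X *m Q).
Proof.
move=> bP bQ; rewrite -{2}[X](subrK (low i X)) mulmxDr mulmxDl lowD.
suff -> : low i (P *m (X - low i X) *m Q) = 0 by rewrite add0r.
by apply/lowP/btM => //; apply: btM => //; exact: low_sub.
Qed.

Definition phi (g : 'I_n -> 'M[F]_r) i w := g i *m ev w (z i) *m invmx (g i).

Lemma phi_linear g i : linear (phi g i).
Proof. by move=> k u v; rewrite /phi ev_linear mulmxDr mulmxDl -scalemxAr -scalemxAl. Qed.

Lemma phi_mul g i w v : g i \in unitmx -> phi g i (mulA w v) = phi g i w *m phi g i v.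
Proof. by move=> gu; rewrite /phi ev_mul !mulmxA mulmxKV. Qed.

Lemma tr_phi g i w : g i \in unitmx -> \tr (phi g i w) = \tr (pa0 w).
Proof.
move=> gu; rewrite /phi mxtrace_mulC mulKmx // /ev mxtraceD mxtraceZ tr_pa1 mulr0 addr0 //.
Qed.

Definition stackf (h : 'I_n -> 'M[F]_r) : 'M[F]_(n, r * r) := \matrix_(i, j) mxvec (h i) 0 j.

Lemma row_stack h i : vec_mx (row i (stackf h)) = h i.
Proof. by apply: (can_inj mxvecK); rewrite vec_mxK; apply/rowP => j; rewrite !mxE. Qed.

Lemma stackf_inj h h' : stackf h = stackf h' -> forall i, h i = h' i.
Proof. by move=> e i; rewrite -!row_stack e. Qed.

Lemma stackf_ext h h' : (forall i, h i = h' i) -> stackf h = stackf h'.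
Proof. by move=> e; apply/matrixP => i j; rewrite !mxE e. Qed.

Lemma stackD k h h' : stackf (fun i => k *: h i + h' i) = k *: stackf h + stackf h'.
Proof. by apply/matrixP => i j; rewrite !mxE linearD linearZ !mxE. Qed.

Definition Rf g w := stackf (fun i => low i (phi g i w)).

Lemma Rf_linear g : linear (Rf g).
Proof.
move=> k u v; rewrite /Rf -stackD; apply: stackf_ext => i.
by rewrite phi_linear low_linear.
Qed.

Lemma Rf_ker g w : Rf g w = 0 <-> forall i, bt (rho i) (phi g i w).
Proof.
split=> [h i|h].
  apply/lowP; rewrite -(row_stack (fun i => low i (phi g i w))) -/(Rf g w) h.
  by rewrite raddf0 raddf0.
have -> : 0 = stackf (fun=> 0) by apply/matrixP => i j; rewrite !mxE linear0 mxE.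
by apply: stackf_ext => i; apply/lowP.
Qed.

Definition RM g := lin_mx (Rf g).
(** General position of the flags, encoded as maximal rank of the obstruction map. Existence then
    follows from the bound on ranks, with no dense open set. *)
Definition maximal g := (forall i, g i \in unitmx) /\
  forall g', (forall i, g' i \in unitmx) -> (\rank (RM g') <= \rank (RM g))%N.

Lemma exists_maximal : exists g, maximal g.
Proof.
pose P k := `[< exists2 g, (forall i, g i \in unitmx) & \rank (RM g) = k >].
have ex : exists k, P k.
  by exists (\rank (RM (fun=> 1%:M))); apply/asboolP; exists (fun=> 1%:M) => // i; exact: unitmx1.
have ub k : P k -> (k <= r * (r + r))%N by move=> /asboolP[g _ <-]; exact: rank_leq_row.
case: (ex_maxnP ex ub) => k /asboolP[g gu gk] kmax; exists g; split=> // g' gu'.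
by rewrite gk; apply: kmax; apply/asboolP; exists g'.
Qed.

Section Maximal.
Variable g : 'I_n -> 'M[F]_r.
Hypothesis gmax : maximal g.
Let gu i : g i \in unitmx. Proof. by case: gmax. Qed.

Definition ins i (X : 'M[F]_r) := stackf (fun k => if k == i then X else 0).

Lemma ins_linear i : linear (ins i).
Proof.
move=> k X Y; rewrite /ins -stackD; apply: stackf_ext => j.
by case: ifP; rewrite ?scaler0 ?addr0.
Qed.

(** The first-order change of the obstruction at [i] when the flag there is moved by
    [1%:M + t *: xi]. *)
Definition brk w i xi := ins i (low i (xi *m phi g i w - phi g i w *m xi)).

(** For [a != b] the elementary matrix has square zero, so moving the flag by [1%:M + t *: xi]
    changes the obstruction map by an exact quadratic polynomial in [t]; by maximality and
    [const_rank] its linear coefficient maps kernel elements into the image. For [a = b] the flag is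
    preserved and the bracket vanishes. *)
Lemma deform_elem w i a b : Rf g w = 0 -> exists w', Rf g w' = brk w i (delta_mx a b).
Proof.
move=> w0; set xi := delta_mx a b; have [ab|ab] := eqVneq a b.
  exists 0; rewrite (lin_fun0 (Rf_linear g)).
  have bx : bt (rho i) xi.
    move=> a' b'; rewrite mxE ab; have [->|_] := eqVneq a' b; last by rewrite mulr0n eqxx.
    by have [-> //|_] := eqVneq b' b; rewrite mulr0n eqxx.
  rewrite /brk; have -> : low i (xi *m phi g i w - phi g i w *m xi) = 0.
    have bw := (Rf_ker g w).1 w0 i; apply/lowP/btD; first exact: btM.
    by rewrite -scaleN1r; apply: btZ; exact: btM.
  by rewrite (lin_fun0 (ins_linear i)).
pose f1 w := brk w i xi; pose f2 w := ins i (low i (- (xi *m phi g i w *m xi))).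
have xx : xi *m xi = 0 by rewrite /xi mul_delta_mx_0 // eq_sym.
have l1 : linear f1.
  move=> k u v; rewrite /f1 /brk phi_linear -ins_linear -low_linear; congr (ins _ (low _ _)).
  by rewrite mulmxDr mulmxDl -scalemxAr -scalemxAl scalerBr opprD addrACA.
have l2 : linear f2.
  move=> k u v; rewrite /f2 phi_linear -ins_linear -low_linear; congr (ins _ (low _ _)).
  by rewrite mulmxDr mulmxDl -scalemxAr -scalemxAl opprD scalerN.
have [||D DE] := submxP (@const_rank F _ _ (RM g) (lin_mx f1) (lin_mx f2) (mxvec w) _ _).
- move=> t; pose h := 1%:M + t *: xi; have hK : h *m (1%:M - t *: xi) = 1%:M.
    by rewrite /h mulmxDl !mulmxBr !mul1mx mulmx1 -scalemxAl -scalemxAr xx !scaler0 subr0 subrK.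
  have [hu _] := mulmx1_unit hK.
  have hV : invmx h = 1%:M - t *: xi by apply: (can_inj (mulKmx hu)); rewrite mulmxV // hK.
  pose g' k := if k == i then h *m g i else g k.
  have -> : RM g + t *: lin_mx f1 + t ^+ 2 *: lin_mx f2 = RM g'; last first.
    by case: gmax => _; apply=> k; rewrite /g'; case: ifP => // _; rewrite unitmx_mul hu gu.
  have HX (X : 'M[F]_r) : h *m (X *m (1%:M - t *: xi)) = X + t *: (xi *m X - X *m xi) - t ^+ 2 *: (xi *m X *m xi).
    rewrite /h mulmxBr mulmx1 -scalemxAr mulmxBr mulmxDl !mul1mx -scalemxAl mulmxDl mul1mx -!scalemxAl.
    by rewrite -scalemxAr scalerA -expr2 mulmxA scalerBr opprD !addrA.
  apply: mxvec_mul_inj => A; have key : Rf g' A = t ^+ 2 *: f2 A + (t *: f1 A + Rf g A).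
    rewrite /f1 /f2 /brk /ins /Rf -!stackD; apply: stackf_ext => k.
    case: eqP => [->|/eqP ki]; last by rewrite !scaler0 !add0r /phi /g' (negbTE ki).
    have -> : phi g' i A = h *m (phi g i A *m invmx h).
      by rewrite /phi /g' eqxx mx_invM // !mulmxA.
    rewrite hV HX -!low_linear; congr (low _ _).
    by rewrite scalerN [RHS]addrC [in RHS](addrC _ (phi g i A)).
  rewrite !mulmxDr -!scalemxAr !lin_mxE //; try exact: Rf_linear.
  rewrite -!linearZ -!linearD /= key; congr mxvec.
  by rewrite [LHS]addrC [in LHS](addrC (Rf g A)).
- by rewrite /RM lin_mxE ?w0 ?linear0 //; exact: Rf_linear.
exists (vec_mx D); apply: (can_inj mxvecK); rewrite -lin_mxE ?vec_mxK; last exact: Rf_linear.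
by rewrite -DE lin_mxE.
Qed.

Lemma deform w i xi : Rf g w = 0 -> exists w', Rf g w' = brk w i xi.
Proof.
move=> w0; rewrite [xi]matrix_sum_delta.
pose S X := exists w', Rf g w' = brk w i X.
have Rf0 := lin_fun0 (Rf_linear g).
have brkl : linear (brk w i).
  move=> k u v; rewrite /brk -ins_linear -low_linear; congr (ins _ (low _ _)).
  by rewrite mulmxDr mulmxDl -scalemxAr -scalemxAl scalerBr opprD addrACA.
have S0 : S 0.
  by exists 0; rewrite Rf0 (lin_fun0 brkl).
have SD k X Y : S X -> S Y -> S (k *: X + Y).
  by move=> [u hu] [v hv]; exists (k *: u + v); rewrite Rf_linear brkl hu hv.
have SD1 X Y : S X -> S Y -> S (X + Y) by move=> hX hY; rewrite -[X]scale1r; exact: SD.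
apply: (big_ind S) => // a _; apply: (big_ind S) => // b _.
by rewrite -[X in S X]addr0; apply: SD => //; exact: deform_elem.
Qed.

(** The dimension of the space of homomorphisms from summand [b] to summand [a], which is 2, 1 or 0.
    Over the two orders it adds up to 2. *)
Definition mult a b : F := (~~ (~~ c a && c b))%:R + (c a && ~~ c b)%:R.

(** Generality of the flags makes the compressed endomorphisms [e w f] surject onto the compressed
    obstruction spaces. The dimensions of both spaces are ranks of projections, hence traces, which
    are the two sums of products of diagonal entries. *)
Lemma half_count e f : (exists i j : 'I_n, z i != z j) -> Rf g e = 0 -> Rf g f = 0 ->
  (forall i, ev e (z i) *m ev e (z i) = ev e (z i)) ->
  (forall i, ev f (z i) *m ev f (z i) = ev f (z i)) ->
  (forall i, ev f (z i) *m ev e (z i) = 0) ->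
  \sum_i \sum_a \sum_(b | (rho i b < rho i a)%N) phi g i e a a * phi g i f b b
    <= \sum_a \sum_b mult a b * (pa0 e a a * pa0 f b b).
Proof.
move=> [i1 [i2 zz]] e0 f0 ee ff fe.
have be i : bt (rho i) (phi g i e) := (Rf_ker g e).1 e0 i.
have bf i : bt (rho i) (phi g i f) := (Rf_ker g f).1 f0 i.
have pe i : phi g i e *m phi g i e = phi g i e by rewrite -phi_mul // /phi ev_mul ee.
have pf i : phi g i f *m phi g i f = phi g i f by rewrite -phi_mul // /phi ev_mul ff.
have pfe i : phi g i f *m phi g i e = 0 by rewrite -phi_mul // /phi ev_mul fe mulmx0 mul0mx.
have G1 (P Q Y : 'M[F]_r) : P *m P = P -> Q *m P = 0 -> - (P *m Y *m Q) *m P - P *m - (P *m Y *m Q) = P *m Y *m Q.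
  by move=> PP QP; rewrite mulNmx mulmxN opprK -!mulmxA QP !mulmx0 oppr0 add0r !mulmxA PP.
have G2 (P Q Y : 'M[F]_r) : P *m P = P -> Q *m Q = Q -> P *m (P *m Y *m Q) *m Q = P *m Y *m Q.
  by move=> PP QQ; rewrite -!mulmxA QQ !mulmxA PP.
have idA u : (forall i, ev u (z i) *m ev u (z i) = ev u (z i)) -> pa0 (mulA u u) = pa0 u /\ pa1 (mulA u u) = pa1 u.
  by move=> uu; apply: (ev_inj zz); rewrite ev_mul uu.
have [ee0 ee1] := idA _ ee; have [ff0 ff1] := idA _ ff.
pose Pf w := mulA (mulA e w) f.
pose Qf (X : 'M[F]_(n, r * r)) := stackf (fun i => low i (phi g i e *m low i (vec_mx (row i X)) *m phi g i f)).
have mul_lin u v : linear (fun w => mulA (mulA u w) v).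
  have lin1 w : linear (mulA w).
    move=> k x y; rewrite /mulA pa0_linear pa1_linear scale_row_mx add_row_mx !mulmxDr -!scalemxAr.
    by congr row_mx; rewrite scalerDr addrACA.
  have lin2 w : linear (mulA^~ w).
    move=> k x y; rewrite /mulA pa0_linear pa1_linear scale_row_mx add_row_mx !mulmxDl -!scalemxAl.
    by congr row_mx; rewrite scalerDr addrACA.
  by move=> k x y; rewrite lin1 lin2.
have lP : linear Pf := mul_lin e f.
have lQ : linear Qf.
  move=> k x y; rewrite /Qf -stackD; apply: stackf_ext => i.
  by rewrite linearD linearZ /= linearD linearZ /= low_linear mulmxDr mulmxDl -scalemxAr -scalemxAl low_linear.
have PP : lin_mx Pf *m lin_mx Pf = lin_mx Pf.
  apply: mxvec_mul_inj => A; rewrite mulmxA (lin_mxE lP) (lin_mxE lP); congr mxvec; rewrite /Pf.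
  rewrite -!mulAA; rewrite [mulA (mulA _ f) f]mulAA.
  have -> : mulA (mulA e e) A = mulA e A by apply: mulA_pa.
  by apply: mulA_pa.
have QQ : lin_mx Qf *m lin_mx Qf = lin_mx Qf.
  apply: mxvec_mul_inj => A; rewrite mulmxA !lin_mxE //; congr mxvec; rewrite {1}/Qf.
  apply: stackf_ext => i; rewrite row_stack [LHS]low_mul // [LHS]low_mul //.
  by rewrite G2.
have trP : \tr (lin_mx Pf) = \sum_a \sum_b mult a b * (pa0 e a a * pa0 f b b).
  rewrite tr_lin_mx; apply: eq_bigr => a _; rewrite big_split_ord /= -big_split /=; apply: eq_bigr => b _.
  have l0 : pa0 (delta_mx a (lshift r b)) = (~~ (~~ c a && c b))%:R *: delta_mx a b.
    apply/matrixP => i j; rewrite !mxE eq_lshift; have [->|_] := eqVneq i a; last by rewrite /= mulr0; case: ifP.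
    have [->|_] := eqVneq j b; last by rewrite /= mulr0; case: ifP.
    by rewrite /= mulr1; case: (~~ c a && c b).
  have l1 : pa0 (delta_mx a (rshift r b)) = 0.
    by apply/matrixP => i j; rewrite !mxE eq_lrshift andbF; case: ifP.
  have l2 : pa1 (delta_mx a (rshift r b)) = (c a && ~~ c b)%:R *: delta_mx a b.
    apply/matrixP => i j; rewrite !mxE eq_rshift; have [->|_] := eqVneq i a; last by rewrite /= mulr0; case: ifP.
    have [->|_] := eqVneq j b; last by rewrite /= mulr0; case: ifP.
    by rewrite /= mulr1; case: (c a && ~~ c b).
  rewrite /Pf {1}/mulA row_mxEl {1}/mulA row_mxEr !pa0_mul !pa1_mul l0 l1 l2 !mulmx0 !mul0mx !addr0 !add0r.
  have S k : (pa0 e *m (k *: delta_mx a b) *m pa0 f) a b = k * (pa0 e a a * pa0 f b b).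
    by rewrite -scalemxAr -scalemxAl [LHS]mxE mul_delta_mul.
  by rewrite !S /mult -mulrDl.
have trQ : \tr (lin_mx Qf) = \sum_i \sum_a \sum_(b | (rho i b < rho i a)%N) phi g i e a a * phi g i f b b.
  rewrite tr_lin_mx; apply: eq_bigr => i _.
  rewrite sum_mxvec.
  apply: eq_bigr => a _; rewrite [RHS]big_mkcond; apply: eq_bigr => b _.
  rewrite mxE mxvecE mxE.
  have -> : vec_mx (row i (delta_mx i (mxvec_index a b))) = delta_mx a b :> 'M[F]_r.
    by rewrite rowE mul_delta_mx vec_mx_delta.
  case: ifP => // ab; have -> : low i (delta_mx a b) = delta_mx a b.
    apply/matrixP => x y; rewrite !mxE; have [->|_] := eqVneq x a; last by case: ifP.
    by have [->|_] := eqVneq y b; [rewrite ab|case: ifP].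
  exact: mul_delta_mul.
have lRP : linear (fun w => Rf g (Pf w)) by move=> k u v; rewrite lP Rf_linear.
have sub : (lin_mx Qf <= lin_mx (fun w => Rf g (Pf w)))%MS.
  apply/row_subP => k; rewrite rowE -[delta_mx 0 k]vec_mxK lin_mxE //; set X := vec_mx _.
  pose xi i := phi g i e *m low i (vec_mx (row i X)) *m phi g i f.
  (* Since [f e = 0], the bracket of [- xi i] with [e] is [xi i] itself, so [deform] reaches every
     element of the compressed obstruction space. *)
  have ex i : exists w', Rf g w' = ins i (low i (xi i)).
    have [w' hw'] := @deform e i (- xi i) e0; exists w'; rewrite hw' /brk; congr (ins _ (low _ _)).
    exact: G1.
  have [wf hwf] := choice ex; pose w := \sum_i wf i.
  have Rw : Rf g w = Qf X.
    have -> : Rf g w = \sum_i Rf g (wf i).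
      rewrite /w; elim/big_rec2: _ => [|i x y _ <-]; last by have := Rf_linear g 1 (wf i) y; rewrite !scale1r.
      by rewrite (lin_fun0 (Rf_linear g)).
    rewrite (eq_bigr _ (fun i _ => hwf i)); apply/matrixP => i j; rewrite summxE (bigD1 i) //= big1 ?addr0.
      by rewrite !mxE eqxx.
    by move=> k' /negbTE ki; rewrite mxE eq_sym ki linear0 mxE.
  have -> : Qf X = Rf g (Pf w).
    rewrite /Rf; apply: stackf_ext => i; rewrite /Pf !phi_mul // -[RHS]low_mul //.
    have -> : low i (phi g i w) = low i (xi i).
      by have := stackf_inj Rw i; rewrite /= => ->.
    by rewrite low_mul // /xi G2.
  by rewrite -(lin_mxE lRP w) submxMl.
have : (\rank (lin_mx Qf) <= \rank (lin_mx Pf))%N.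
  apply: leq_trans (mxrankS sub) _.
  have -> : lin_mx (fun w => Rf g (Pf w)) = lin_mx Pf *m RM g.
    by apply: mxvec_mul_inj => A; rewrite mulmxA !lin_mxE //; exact: Rf_linear.
  exact: mxrankM_maxl.
by rewrite -(ler_nat F) -!idem_trace // trP trQ.
Qed.
End Maximal.
End Parabolic.

(** * Absence of idempotents and existence of residues *)

Section Lifting.
Variables (F : numClosedFieldType) (n r B : nat) (c : pred 'I_r) (z : 'I_n -> F) (rho : 'I_n -> 'I_r -> nat).
Hypothesis n2 : (2 < n)%N.
Hypothesis z_inj : injective z.
Hypothesis rhoB : forall i a, (rho i a < B)%N.
Let m i (j : 'I_B) := #|[pred a | rho i a == j]|.
Hypothesis star : forall (p : 'I_n -> 'I_B -> nat) r1, (forall i j, p i j <= m i j)%N ->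
  (forall i, \sum_j p i j = r1)%N -> (0 < r1 < r)%N ->
  (\sum_i \sum_j p i j * (m i j - p i j) < (n - 2) * r1 * (r - r1))%N.
Variable g : 'I_n -> 'M[F]_r.
Hypothesis gmax : maximal c z rho g.
Let gu i : g i \in unitmx. Proof. by case: gmax. Qed.

Lemma two_points : exists i j : 'I_n, z i != z j.
Proof.
have h0 : (0 < n)%N by lia.
have h1 : (1 < n)%N by lia.
by exists (Ordinal h0), (Ordinal h1); apply/eqP => /z_inj /(congr1 val).
Qed.

Lemma sum_rows (i : 'I_n) (h : 'I_r -> F) : \sum_a h a = \sum_(j < B) \sum_(a | rho i a == j) h a.
Proof.
by rewrite (partition_big (fun a => Ordinal (rhoB i a)) xpredT).
Qed.

(** A summand of rank [r1] and its complement of rank [r2] give two counts, one in each direction.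
    Added, they read [n r1 r2 - sum p (m - p) <= 2 r1 r2], which contradicts [star]. *)
Lemma no_idempotent e : Rf c z rho g e = 0 ->
  (forall i, ev c e (z i) *m ev c e (z i) = ev c e (z i)) ->
  \tr (pa0 c e) = 0 \/ \tr (pa0 c e) = r%:R.
Proof.
move=> e0 ee; pose f := oneA F r - e.
have evf i : ev c f (z i) = 1%:M - ev c e (z i).
  by rewrite /f addrC -scaleN1r ev_linear ev_one scaleN1r addrC.
have phf i : phi c z g i f = 1%:M - phi c z g i e.
  by rewrite /phi evf mulmxBr mulmxBl mulmx1 mulmxV.
have be i : bt (rho i) (phi c z g i e) := (Rf_ker c z rho g e).1 e0 i.
have f0 : Rf c z rho g f = 0.
  apply/Rf_ker => i; rewrite phf; apply: btD; first exact: bt_scalar.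
  by rewrite -scaleN1r; apply: btZ.
have ff i : ev c f (z i) *m ev c f (z i) = ev c f (z i).
  by rewrite evf mulmxBr mulmx1 mulmxBl mul1mx ee subrr subr0.
have fe i : ev c f (z i) *m ev c e (z i) = 0 by rewrite evf mulmxBl mul1mx ee subrr.
have ef i : ev c e (z i) *m ev c f (z i) = 0 by rewrite evf mulmxBr mulmx1 ee subrr.
have h1 := half_count gmax two_points e0 f0 ee ff fe.
have h2 := half_count gmax two_points f0 e0 ff ee ef.
have pe i : phi c z g i e *m phi c z g i e = phi c z g i e by rewrite -phi_mul // /phi ev_mul ee.
have ex i : exists p : 'I_B -> nat, forall j, (p j <= m i j)%N /\ \sum_(a | rho i a == j) phi c z g i e a a = (p j)%:R.
  have E (j : 'I_B) : exists p, (p <= m i j)%N /\ \sum_(a | rho i a == j) phi c z g i e a a = p%:R.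
    by have [p h h'] := blk_idem j (be i) (pe i); exists p.
  by have [p hp] := choice E; exists p.
have [p hp] := choice ex.
have trp i : (\sum_j p i j)%:R = \tr (pa0 c e).
  rewrite -(tr_phi c z e (gu i)) /mxtrace (sum_rows i) natr_sum.
  by apply: eq_bigr => j _; rewrite (hp i j).2.
have h0 : (0 < n)%N by lia.
pose i0 := Ordinal h0; pose r1 := (\sum_j p i0 j)%N.
have pr i : (\sum_j p i j = r1)%N by apply/eqP; rewrite -(eqr_nat F) !trp.
have sm i : (\sum_j m i j = r)%N.
  have : \sum_(a < r) (1 : F) = r%:R by rewrite sumr_const card_ord.
  rewrite (sum_rows i) (eq_bigr (fun j => (m i j)%:R)) => [|j _]; last by rewrite sumr_const.
  by rewrite -natr_sum => /eqP; rewrite eqr_nat => /eqP.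
have r1r : (r1 <= r)%N by rewrite -(sm i0); apply: leq_sum => j _; exact: (hp i0 j).1.
have [r10|r1p] := posnP r1; first by left; rewrite -(trp i0) -/r1 r10.
have [r1l|] := ltnP r1 r; last by move=> h; right; rewrite -(trp i0) -/r1; congr _%:R; apply/eqP; rewrite eqn_leq r1r.
have := @star p r1 (fun i j => (hp i j).1) pr; rewrite r1p r1l => /(_ isT).
suff : ((n - 2) * r1 * (r - r1) <= \sum_i \sum_j p i j * (m i j - p i j))%N by rewrite leqNgt => /negbTE ->.
set T := r1%:R : F; have TE : \tr (pa0 c e) = T by rewrite -(trp i0).
have rT : (r - r1)%:R = r%:R - T by rewrite natrB.
pose SS := \sum_i \sum_j (p i j)%:R * ((m i j)%:R - (p i j)%:R) : F.
have lhs : (\sum_i \sum_a \sum_(b | (rho i b < rho i a)%N) phi c z g i e a a * phi c z g i f b b) +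
   (\sum_i \sum_a \sum_(b | (rho i b < rho i a)%N) phi c z g i f a a * phi c z g i e b b) =
   n%:R * (T * (r%:R - T)) - SS.
  rewrite -big_split /SS; have -> : n%:R * (T * (r%:R - T)) = \sum_(i < n) T * (r%:R - T).
    by rewrite sumr_const card_ord mulr_natl.
  rewrite -sumrB; apply: eq_bigr => i _ /=.
  have E1 : T * (r%:R - T) = \sum_a \sum_b phi c z g i e a a * phi c z g i f b b.
    have -> : r%:R - T = \sum_b phi c z g i f b b.
      by rewrite -[RHS]/(\tr _) phf raddfB /= mxtrace1 tr_phi // TE.
    by rewrite -TE -(tr_phi c z e (gu i)) /mxtrace mulr_suml; apply: eq_bigr => a _; rewrite mulr_sumr.
  have E2 : \sum_j (p i j)%:R * ((m i j)%:R - (p i j)%:R) =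
     \sum_a \sum_(b | rho i b == rho i a) phi c z g i e a a * phi c z g i f b b.
    rewrite [RHS](sum_rows i); apply: eq_bigr => j _.
    have -> : (m i j)%:R - (p i j)%:R = \sum_(b | rho i b == j) phi c z g i f b b.
      have ent (X : 'M[F]_r) b : (1%:M - X) b b = 1 - X b b by rewrite !mxE eqxx.
      rewrite (eq_bigr (fun b => 1 - phi c z g i e b b)) => [|b _]; last by rewrite phf ent.
      by rewrite sumrB (hp i j).2 sumr_const.
    rewrite -(hp i j).2 mulr_suml; apply: eq_bigr => a /eqP aj; rewrite aj mulr_sumr //.
  rewrite E1 E2 [X in _ + X](exchange_big_dep xpredT) //= -sumrB -big_split; apply: eq_bigr => a _ /=.
  rewrite [X in _ = X - _](bigID (fun b => rho i b == rho i a)) /= addrAC subrr add0r.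
  rewrite [RHS](bigID (fun b => (rho i b < rho i a)%N)) /=; congr (_ + _).
    by apply: eq_bigl => b; case: ltngtP.
  by apply: eq_big => [b|b _]; [case: ltngtP|rewrite mulrC].
have rhs : (\sum_a \sum_b mult F c a b * (pa0 c e a a * pa0 c f b b)) +
   (\sum_a \sum_b mult F c a b * (pa0 c f a a * pa0 c e b b)) = 2 * (T * (r%:R - T)).
  have -> : r%:R - T = \sum_b pa0 c f b b.
    have pf : pa0 c f = 1%:M - pa0 c e.
      by rewrite /f addrC -scaleN1r pa0_linear pa0_one scaleN1r addrC.
    by rewrite -[RHS]/(\tr _) pf raddfB /= mxtrace1 TE.
  rewrite -TE /mxtrace mulr_suml mulr_sumr [X in _ + X]exchange_big -big_split; apply: eq_bigr => a _ /=.
  rewrite mulr_sumr mulr_sumr -big_split; apply: eq_bigr => b _ /=.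
  rewrite [pa0 c f b b * _]mulrC -mulrDl; congr (_ * _).
  by rewrite /mult; case: (c a); case: (c b); rewrite /= ?addr0 ?add0r.
have := lerD h1 h2; rewrite lhs rhs => hh.
have SSE : SS = (\sum_i \sum_j p i j * (m i j - p i j))%:R.
  rewrite natr_sum; apply: eq_bigr => i _; rewrite natr_sum; apply: eq_bigr => j _.
  by rewrite natrM natrB // (hp i j).1.
rewrite -(ler_nat F) -SSE !natrM rT natrB 1?ltnW // -/T -mulrA mulrBl lerBlDr -lerBlDl.
by move: hh; rewrite lerBlDr -lerBlDl.
Qed.
End Lifting.

Section LiftingS.
Variables (F : numClosedFieldType) (n r' B : nat).
Local Notation r := r'.+1.
Variables (c : pred 'I_r) (z : 'I_n -> F) (rho : 'I_n -> 'I_r -> nat).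
Hypothesis n2 : (2 < n)%N.
Hypothesis z_inj : injective z.
Hypothesis rhoB : forall i a, (rho i a < B)%N.
Hypothesis star : forall (p : 'I_n -> 'I_B -> nat) r1, (forall i j, p i j <= #|[pred a | rho i a == j]|)%N ->
  (forall i, \sum_j p i j = r1)%N -> (0 < r1 < r)%N ->
  (\sum_i \sum_j p i j * (#|[pred a | rho i a == j]| - p i j) < (n - 2) * r1 * (r - r1))%N.
Variable g : 'I_n -> 'M[F]_r.
Hypothesis gmax : maximal c z rho g.
Let gu i : g i \in unitmx. Proof. by case: gmax. Qed.

Lemma horner_alg_elem p w : exists v, (forall x, ev c v x = horner_mx (ev c w x) p) /\
   (Rf c z rho g w = 0 -> Rf c z rho g v = 0).
Proof.
elim/poly_ind: p => [|p k [v [vE v0]]].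
  exists 0; split; last by rewrite (lin_fun0 (Rf_linear c z rho g)).
  by move=> x; rewrite rmorph0 (lin_fun0 (ev_linear c x)).
exists (k *: oneA F r + mulA c v w); split.
  move=> x; rewrite ev_linear ev_mul ev_one vE rmorphD rmorphM /= horner_mx_X horner_mx_C addrC.
  by rewrite scalemx1.
move=> w0; have bw := (Rf_ker c z rho g w).1 w0; have bv := (Rf_ker c z rho g v).1 (v0 w0).
apply/Rf_ker => i; rewrite phi_linear phi_mul //; apply: btD; last exact: btM.
by apply: btZ; rewrite /phi ev_one mulmx1 mulmxV //; exact: bt_scalar.
Qed.

(** Otherwise a Bezout identity would yield a nontrivial idempotent that is a polynomial in [w]. *)
Lemma single_eigenvalue w : Rf c z rho g w = 0 ->
  exists l s, forall i, (ev c w (z i) - l%:M) ^+ s = 0.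
Proof.
move=> w0; have h0 : (0 < n)%N by lia.
(* The product over all points annihilates [w] at every [z i], so a single polynomial gives the
   idempotent in all these fibres at once. *)
pose i0 := Ordinal h0; pose A := \prod_i char_poly (ev c w (z i)).
have A0 : A != 0 by apply/prodf_neq0 => i _; rewrite monic_neq0 // char_poly_monic.
have Az i : horner_mx (ev c w (z i)) A = 0.
  by rewrite /A (bigD1 i) //= rmorphM /= Cayley_Hamilton mul0r.
have [l lr] : exists l, root (char_poly (ev c w (z i0))) l.
  by apply/closed_rootP; rewrite size_char_poly.
have [s [Q]] := multiplicity_XsubC A l; rewrite A0 /= => Ql AE.
have cop : coprimep (('X - l%:P) ^+ s) Q.
  by apply: coprimep_expl; rewrite coprimep_sym coprimep_XsubC.
have [[u v] /= uv] := Bezout_eq1_coprimepP _ _ cop.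
have [e [eE e0]] := horner_alg_elem (v * Q) w.
have ee i : ev c e (z i) *m ev c e (z i) = ev c e (z i).
  rewrite !eE -[_ *m _]/(_ * _) -rmorphM.
  have -> : v * Q * (v * Q) = v * Q - (v * u) * A.
    by rewrite AE -[v * Q in RHS]mulr1 -uv; ring.
  by rewrite [LHS]rmorphB (rmorphM _ (v * u) A) /= Az mulr0 subr0.
have [tr0|trr] := no_idempotent n2 z_inj rhoB star gmax (e0 w0) ee.
  (* Trace zero is excluded by an eigenvector for [l] at [z i0], on which [v * Q] acts as 1. *)
  have : ev c e (z i0) = 0.
    apply/eqP; rewrite -mxrank_eq0 -(eqr_nat F) -idem_trace //.
    by rewrite /ev mxtraceD mxtraceZ tr_pa1 mulr0 addr0 tr0.
  move=> ez; have := lr; rewrite -eigenvalue_root_char => /eigenvalueP[x xl x0].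
  have hx q : x *m horner_mx (ev c w (z i0)) q = q.[l] *: x.
    elim/poly_ind: q => [|q k IH]; first by rewrite rmorph0 mulmx0 horner0 scale0r.
    rewrite rmorphD rmorphM /= horner_mx_X horner_mx_C mulmxDr -[_ * ev _ _ _]/(_ *m _) mulmxA IH -scalemxAl xl.
    by rewrite scalerA mul_mx_scalar -scalerDl !hornerE.
  have := hx (v * Q); rewrite -eE ez mulmx0 => /esym/eqP; rewrite scaler_eq0 (negbTE x0) orbF => /eqP vQ.
  have := congr1 (horner^~ l) uv; rewrite hornerD [(v * Q).[l]]vQ addr0 hornerM horner_exp hornerXsubC subrr.
  case: s {cop uv} AE => [|s] AE.
    have : root A l by rewrite /A (bigD1 i0) //= rootM lr.
    by rewrite AE expr0 mulr1 (negbTE Ql).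
  by rewrite expr0n mulr0 hornerC => /esym/eqP; rewrite oner_eq0.
exists l, s => i; have e1 : ev c e (z i) = 1%:M.
  have : \rank (ev c e (z i)) == r.
    rewrite -(eqr_nat F) -idem_trace // -trr /ev mxtraceD mxtraceZ tr_pa1 mulr0 addr0 //.
  move=> rk; have u1 : ev c e (z i) \in unitmx by rewrite -row_free_unit /row_free.
  by apply: (can_inj (mulKmx u1)); rewrite mulmx1 ee.
have -> : (ev c w (z i) - l%:M) ^+ s = horner_mx (ev c w (z i)) (('X - l%:P) ^+ s).
  by rewrite rmorphXn rmorphB /= horner_mx_X horner_mx_C.
have -> : ('X - l%:P) ^+ s = u * ('X - l%:P) ^+ s * ('X - l%:P) ^+ s + v * A.
  by rewrite -[LHS]mul1r -uv AE; ring.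
have h : horner_mx (ev c w (z i)) (u * ('X - l%:P) ^+ s) = 0.
  have := congr1 (horner_mx (ev c w (z i))) uv.
  rewrite (rmorphD _ (u * ('X - l%:P) ^+ s) (v * Q)) /= -eE e1 rmorph1 => hh.
  by apply: (addIr 1); rewrite add0r hh [LHS]rmorph1.
rewrite (rmorphD _ (u * ('X - l%:P) ^+ s * ('X - l%:P) ^+ s) (v * A)) (rmorphM _ (u * ('X - l%:P) ^+ s) (('X - l%:P) ^+ s)) (rmorphM _ v A) /=.
by rewrite Az mulr0 addr0 h mul0r.
Qed.

Variable theta : 'I_n -> nat -> F.
Hypothesis degree : \sum_i \sum_a theta i (rho i a) = #|c|%:R.

(** [ell] is the obstruction to residues with the given graded pieces. On an endomorphism preserving
    the flags, [single_eigenvalue] turns it into [l] times the degree minus the sum of the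
    exponents, which is zero. By duality it factors through the obstruction map, and the factor is
    the correction [N]. *)
Theorem parabolic_lift : exists N : 'I_n -> 'M[F]_r,
  (forall i a b, N i a b != 0 -> (rho i a < rho i b)%N) /\
  forall w, \sum_i \tr (ev c w (z i) *m (invmx (g i) *m (\matrix_(a, b) (theta i (rho i a) *+ (a == b)) + N i) *m g i)) = \sum_(a | c a) pa0 c w a a.
Proof.
pose Th i : 'M[F]_r := \matrix_(a, b) (theta i (rho i a) *+ (a == b)).
have trTh X i : \tr (X *m Th i) = \sum_a X a a * theta i (rho i a).
  apply: eq_bigr => a _; rewrite mxE (bigD1 a) //= big1 => [|b ba]; rewrite !mxE ?eqxx ?addr0 ?mulr1n //.
  by rewrite (negbTE ba) mulr0n mulr0.
pose ell w := \sum_(a | c a) pa0 c w a a - \sum_i \tr (phi c z g i w *m Th i).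
have el : linear (fun w => (ell w)%:M : 'M_1).
  move=> k u v; rewrite scale_scalar_mx -raddfD /=; congr _%:M; rewrite /ell pa0_linear.
  rewrite (eq_bigr (fun a => k * pa0 c u a a + pa0 c v a a)); last first.
    by move=> a _; have ent (X Y : 'M[F]_r) : (k *: X + Y) a a = k * X a a + Y a a; [rewrite !mxE|exact: ent].
  rewrite [X in _ - X](eq_bigr (fun i => k * \tr (phi c z g i u *m Th i) + \tr (phi c z g i v *m Th i))); last first.
    by move=> i _; rewrite phi_linear mulmxDl -scalemxAl mxtraceD mxtraceZ.
  by rewrite !big_split /= -!mulr_sumr mulrBr opprD addrACA.
have kill w : Rf c z rho g w = 0 -> ell w = 0.
  move=> w0; have [l [s hs]] := single_eigenvalue w0.
  have bw := (Rf_ker c z rho g w).1 w0.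
  have hph i : (phi c z g i w - l%:M) ^+ s = 0.
    have E k : (phi c z g i w - l%:M) ^+ k = g i *m (ev c w (z i) - l%:M) ^+ k *m invmx (g i).
      elim: k => [|k IH]; first by rewrite mulmx1 mulmxV.
      rewrite !exprSr IH -!mulmxE.
      have -> : phi c z g i w - l%:M = g i *m (ev c w (z i) - l%:M) *m invmx (g i).
        by rewrite mulmxBr mulmxBl -/(phi c z g i w) mul_mx_scalar -scalemxAl mulmxV // scalemx1.
      by rewrite !mulmxA mulmxKV.
    by rewrite E hs mulmx0 mul0mx.
  have h0 : (0 < n)%N by lia.
  pose i0 := Ordinal h0.
  have K : \sum_(a | c a) pa0 c w a a = l * #|c|%:R.
    have b0 : bt (fun a => (~~ c a : nat)) (ev c w (z i0)).
      move=> a b; rewrite !mxE; case: (c a); case: (c b) => //=; rewrite ?eqxx // mulr0 addr0 eqxx //.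
    have := blk_nil 0 b0 (hs i0); rewrite (eq_bigl c) => [|a]; last by rewrite eqb0 negbK.
    rewrite (eq_bigr (fun a => pa0 c w a a)) => [->|a ca]; last by rewrite !mxE ca /= mulr0 addr0.
    by congr (_ * _%:R); apply: eq_card => a; rewrite !inE eqb0 negbK.
  rewrite /ell K -degree mulr_sumr -sumrB big1 // => i _.
  rewrite trTh (sum_rows rhoB i) [X in _ - X](sum_rows rhoB i) mulr_sumr -sumrB big1 // => j _.
  rewrite (eq_bigr (fun=> theta i j)) => [|a /eqP -> //].
  rewrite [X in _ - X](eq_bigr (fun a => phi c z g i w a a * theta i j)) => [|a /eqP -> //].
  by rewrite -mulr_suml (blk_nil j (bw i) (hph i)) sumr_const -[theta i j *+ _]mulr_natl; ring.
have [|nu nuE] := @linear_factor F _ _ _ (RM c z rho g) (lin_mx (fun w => (ell w)%:M : 'M_1)).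
  move=> v; rewrite -[v]vec_mxK !lin_mxE //; last exact: Rf_linear.
  by move=> /eqP; rewrite -[0](linear0 mxvec) (can_eq mxvecK) => /eqP /kill ->; rewrite raddf0 linear0.
(* The trace pairing makes the entries above the blocks dual to those below, hence the transposed
   index [b a]. *)
pose N i : 'M[F]_r := \matrix_(a, b) (if (rho i a < rho i b)%N then nu (mxvec_index i (mxvec_index b a)) (mxvec_index 0 0) else 0).
exists N; split.
  by move=> i a b; rewrite mxE; case: ifP => //; rewrite eqxx.
move=> w.
have : \sum_i \tr (phi c z g i w *m N i) = ell w.
  have := congr1 (fun X => mxvec w *m X) nuE; rewrite mulmxA !lin_mxE //; last exact: Rf_linear.
  have hv : mxvec ((ell w)%:M : 'M_1) 0 (mxvec_index 0 0) = ell w by rewrite mxvecE mxE eqxx.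
  move=> /matrixP /(_ 0 (mxvec_index 0 0)); rewrite hv => <-.
  rewrite mxE sum_mxvec; apply: eq_bigr => i _; rewrite sum_mxvec; apply: eq_bigr => a _.
  rewrite [LHS]mxE; apply: eq_bigr => b _.
  rewrite [X in _ = X * _]mxvecE [X in _ = X * _]mxE [X in _ = X * _]mxvecE [X in _ = X * _]mxE [X in _ * X = _]mxE.
  by case: ifP; rewrite ?mulr0 ?mul0r.
move=> hN; transitivity (\sum_i \tr (phi c z g i w *m Th i) + \sum_i \tr (phi c z g i w *m N i)).
  rewrite -big_split; apply: eq_bigr => i _ /=; rewrite -mxtraceD -mulmxDr -/(Th i) /phi.
  by rewrite -!mulmxA [RHS]mxtrace_mulC !mulmxA.
by rewrite hN /ell addrC subrK.
Qed.

(** The trace identity is tested on elementary endomorphisms. The resulting equations say that the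
    system with residues [A i] at [z i] becomes regular at infinity in the frame with entries [x] on
    [c] and 1 elsewhere. *)
Lemma lift_entries : exists N : 'I_n -> 'M[F]_r,
  let A i := invmx (g i) *m (\matrix_(a, b) (theta i (rho i a) *+ (a == b)) + N i) *m g i in
  [/\ forall i a b, N i a b != 0 -> (rho i a < rho i b)%N,
   forall a b, c a = c b -> \sum_i A i a b = ((a == b) && c a)%:R &
   forall a b, ~~ c a -> c b -> \sum_i A i a b = 0 /\ \sum_i z i * A i a b = 0].
Proof.
have [N [N1 N2]] := parabolic_lift; exists N; move=> A.
have trd (a b : 'I_r) (X : 'M[F]_r) : \tr (delta_mx b a *m X) = X a b.
  rewrite -[delta_mx b a]mul1mx /mxtrace; under eq_bigr do rewrite mul_delta_mul.
  rewrite (bigD1 b) //= big1 => [|d /negbTE db]; rewrite !mxE ?eqxx ?db ?mul0r //.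
  by rewrite mul1r addr0.
have e0 a b : ~~ (~~ c b && c a) -> pa0 c (row_mx (delta_mx b a) 0 : 'M[F]_(r, r + r)) = delta_mx b a /\ pa1 c (row_mx (delta_mx b a) 0 : 'M[F]_(r, r + r)) = 0 :> 'M[F]_r.
  move=> h; split; apply/matrixP => i j; rewrite mxE ?row_mxKl ?row_mxKr !mxE; last by case: ifP.
  case: ifP => // /andP[ci cj]; have [ib|//] := eqVneq i b; have [ja|//] := eqVneq j a.
  by rewrite ib ja in ci cj; rewrite ci cj in h.
have e1 a b : c b && ~~ c a -> pa0 c (row_mx 0 (delta_mx b a) : 'M[F]_(r, r + r)) = 0 /\ pa1 c (row_mx 0 (delta_mx b a) : 'M[F]_(r, r + r)) = delta_mx b a :> 'M[F]_r.
  move=> h; split; apply/matrixP => i j; rewrite mxE ?row_mxKl ?row_mxKr !mxE; first by case: ifP.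
  case: ifP => // hh; have [ib|//] := eqVneq i b; have [ja|//] := eqVneq j a.
  by rewrite ib ja h in hh.
have S0 a b : ~~ (~~ c b && c a) -> \sum_i A i a b = ((a == b) && c a)%:R.
  move=> h; have [p0 p1] := e0 _ _ h; have := N2 (row_mx (delta_mx b a) 0 : 'M[F]_(r, r + r)).
  rewrite p0; under eq_bigr do rewrite /ev p0 p1 scaler0 addr0 trd.
  move=> ->; have [->|ab] := eqVneq a b.
    case: (boolP (c b)) => cb /=; last by rewrite big1 // => d cd; rewrite mxE; case: eqP => // e; rewrite e (negbTE cb) in cd.
    by rewrite (bigD1 b) //= mxE !eqxx big1 ?addr0 // => d /andP[_ /negbTE db]; rewrite mxE db.
  rewrite big1 // => d _; rewrite mxE; have [->|//] := eqVneq d b; by rewrite eq_sym (negbTE ab).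
split=> // a b; first by move=> ab; apply: S0; rewrite ab andNb.
move=> ca cb; split; first by rewrite S0 ?(negbTE ca) ?andbF.
have [|p0 p1] := e1 a b; first by rewrite cb ca.
have := N2 (row_mx 0 (delta_mx b a) : 'M[F]_(r, r + r)); rewrite p0.
under eq_bigr do rewrite /ev p0 p1 add0r -scalemxAl mxtraceZ trd.
by move=> ->; rewrite big1 // => d _; rewrite mxE.
Qed.
End LiftingS.

(** * Triangular forms and genericity *)

Lemma sum_dec (P : nat -> bool) B j : (forall l, P l.+1 -> P l) -> (j < B)%N -> (j < \sum_(l < B) P l)%N = P j.
Proof.
move=> dec jB; have dec' l l' : (l <= l')%N -> P l' -> P l.
  elim: l' => [|l' IH]; first by rewrite leqn0 => /eqP ->.
  by rewrite leq_eqVlt ltnS => /orP[/eqP -> //|/IH h] /dec.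
case: (boolP (P j)) => Pj.
  apply: (@leq_trans (\sum_(l < B) (l < j.+1)%N)); first by rewrite sum_ltn; lia.
  by apply: leq_sum => l _; case: ltnP => // h; rewrite (dec' _ _ _ Pj).
apply/negbTE; rewrite -leqNgt; apply: (@leq_trans (\sum_(l < B) (l < j)%N)); last by rewrite sum_ltn; lia.
apply: leq_sum => l _; case: (boolP (P l)) => // Pl; case: ltnP => // h.
by rewrite (dec' _ _ h Pl) in Pj.
Qed.

Section Determinants.

(** A permutation other than the identity that meets only nonzero entries would never lower the
    level and would raise it somewhere, yet it preserves the total level. *)
Lemma det_tri (A : comNzRingType) r (rho : 'I_r -> nat) (X : 'M[A]_r) :
  (forall a b, X a b != 0 -> a = b \/ (rho a < rho b)%N) -> \det X = \prod_a X a a.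
Proof.
move=> tX; rewrite /determinant (bigD1 (1%g : 'S_r)) //= odd_perm1 mul1r [X in _ + X]big1 ?addr0 => [|s s1].
  by apply: eq_bigr => i _; rewrite perm1.
have [/existsP[i /eqP Xi]|/existsPn h] := boolP [exists i, X i (s i) == 0].
  by rewrite (bigD1 i) //= Xi mul0r mulr0.
have le i : (rho i <= rho (s i))%N by case: (tX _ _ (h i)) => [<-|/ltnW].
have [i si] : exists i, s i != i.
  apply/existsP; apply: contraNT s1 => /existsPn hs; apply/eqP/permP => i.
  by rewrite perm1; apply/eqP; have := hs i; rewrite negbK.
have : (\sum_i rho i < \sum_i rho (s i))%N.
  rewrite (bigD1 i) //= [X in (_ < X)%N](bigD1 i) //= -addSn; apply: leq_add; last exact: leq_sum.
  by case: (tX _ _ (h i)) => // e; rewrite -e eqxx in si.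
have <- : (\sum_i rho i = \sum_i rho (s i))%N by exact: (reindex_inj (@perm_inj _ s)).
by rewrite ltnn.
Qed.

Variable F : fieldType.

Lemma char_poly_tri r (rho : 'I_r -> nat) (X : 'M[F]_r) : tri rho X ->
  char_poly X = \prod_a ('X - (X a a)%:P).
Proof.
move=> tX; rewrite /char_poly (@det_tri _ _ rho).
  by apply: eq_bigr => a _; rewrite !mxE eqxx.
move=> a b; rewrite !mxE; have [->|ab] := eqVneq a b; first by left.
by rewrite mulr0n sub0r oppr_eq0 polyC_eq0 => /tX.
Qed.

Lemma char_poly_conj r (P A : 'M[F]_r) : P \in unitmx -> char_poly (P *m A *m invmx P) = char_poly A.
Proof.
move=> Pu; rewrite /char_poly /char_poly_mx.
have PP : map_mx polyC P *m map_mx polyC (invmx P) = 1%:M by rewrite -map_mxM mulmxV // map_mx1.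
have -> : 'X%:M - map_mx polyC (P *m A *m invmx P) =
   map_mx polyC P *m ('X%:M - map_mx polyC A) *m map_mx polyC (invmx P).
  rewrite mulmxBr mulmxBl !map_mxM; congr (_ - _).
  by rewrite mul_mx_scalar -scalemxAl PP scalemx1.
by rewrite !det_mulmx mulrAC -det_mulmx PP det1 mul1r.
Qed.

Lemma char_poly_restrict m k (T : 'M[F]_(m + k)) (b : 'M[F]_(m, m + k)) (c : 'M[F]_m) :
  row_free b -> b *m T = c *m b -> char_poly c %| char_poly T.
Proof.
move=> bf bT; have rb : \rank b = m by apply/eqP.
pose L := col_ebase b; pose P := row_ebase b.
have Lu : L \in unitmx := col_ebase_unit b; have Pu : P \in unitmx := row_ebase_unit b.
have bE : b = L *m row_mx 1%:M 0 *m P by rewrite -pid_mx_row -[in LHS](mulmx_ebase b) rb.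
pose T' := P *m T *m invmx P; pose c' := invmx L *m c *m L.
have cc : char_poly c' = char_poly c.
  by have := @char_poly_conj _ (invmx L) c; rewrite invmxK unitmx_inv; apply.
rewrite -cc -(char_poly_conj T Pu) -/T' -[T']submxK.
have E : row_mx 1%:M 0 *m T' = row_mx c' 0 :> 'M_(m, m + k).
  have -> : row_mx c' 0 = c' *m row_mx 1%:M 0 :> 'M_(m, m + k) by rewrite mul_mx_row mulmx1 mulmx0.
  have h : L *m row_mx 1%:M 0 *m P *m T = c *m (L *m row_mx 1%:M 0 *m P) by rewrite -bE.
  apply: (can_inj (mulKmx Lu)); apply: (can_inj (mulmxK Pu)).
  by rewrite /T' !mulmxA mulmxKV // h /c' !mulmxA mulmxV // mul1mx.
move: E; rewrite -[T']submxK mul_row_block !mul1mx !mul0mx !addr0 => /eq_row_mx[-> ->].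
rewrite submxK /char_poly /char_poly_mx map_block_mx map_mx0 scalar_mx_block opp_block_mx add_block_mx.
by rewrite oppr0 addr0 det_lblock dvdp_mulr.
Qed.

Lemma char_poly_restrict_eq m k r (e : (m + k)%N = r) (T : 'M[F]_r) (b : 'M[F]_(m, r)) (c : 'M[F]_m) :
  row_free b -> b *m T = c *m b -> char_poly c %| char_poly T.
Proof. case: r / e T b => T b; exact: char_poly_restrict. Qed.

Lemma mxbig_rcons r (I : Type) (s : seq I) x (G : I -> 'M[F]_r) :
  \big[mulmx/1%:M]_(i <- rcons s x) G i = (\big[mulmx/1%:M]_(i <- s) G i) *m G x.
Proof.
elim: s => [|y s IH] /=; first by rewrite big_cons !big_nil mulmx1 mul1mx.
by rewrite !big_cons IH mulmxA.
Qed.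

Lemma mxbig_tr r (I : Type) (s : seq I) (G : I -> 'M[F]_r) :
  (\big[mulmx/1%:M]_(i <- s) G i)^T = \big[mulmx/1%:M]_(i <- rev s) (G i)^T.
Proof.
elim: s => [|x s IH]; first by rewrite !big_nil trmx1.
by rewrite big_cons trmx_mul IH rev_cons mxbig_rcons.
Qed.
End Determinants.

(** * Genericity excludes common invariant subspaces *)

Section Irreducible.
Variables (F : closedFieldType) (n r : nat) (lam : 'I_n -> r.-tuple F) (T : 'I_n -> 'M[F]_r) (s : seq 'I_n).
Hypothesis cp : forall i, char_poly (T i) = \prod_(x <- lam i) ('X - x%:P).
Hypothesis gen : mult_generic lam.
Hypothesis sE : perm_eq s (index_enum 'I_n).
Hypothesis T1 : \big[mulmx/1%:M]_(i <- s) T i = 1%:M.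

(** The restrictions to a stable subspace have product 1. Each has a characteristic polynomial
    dividing that of [T i], so its determinant is a product of as many eigenvalues as the dimension,
    against genericity. The order [s] of the factors is left free because transposition reverses
    it. *)
Lemma generic_stable (U : 'M[F]_r) : (forall i, stablemx U (T i)) -> \rank U = 0%N \/ \rank U = r.
Proof.
move=> st; have [|r0] := posnP (\rank U); [by left|]; right; apply/eqP; apply: contraT => rU.
have mr : (1 <= \rank U < r)%N by rewrite r0 ltn_neqAle rU rank_leq_row.
pose b := row_base U; pose c i := b *m T i *m pinvmx b.
have bT i : b *m T i = c i *m b.
  by rewrite /c mulmxKpV // eq_row_base (submx_trans _ (st i)) // submxMr // eq_row_base.
have bf : row_free b := row_base_free U.
have c1 : \big[mulmx/1%:M]_(i <- s) c i = 1%:M.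
  have E (t : seq 'I_n) : b *m \big[mulmx/1%:M]_(i <- t) T i = (\big[mulmx/1%:M]_(i <- t) c i) *m b.
    elim: t => [|x t IH]; first by rewrite !big_nil mulmx1 mul1mx.
    by rewrite !big_cons mulmxA bT -mulmxA IH mulmxA.
  by apply: (row_free_inj bf); rewrite -E T1 mulmx1 mul1mx.
have d1 : \prod_i \det (c i) = 1.
  have dE (t : seq 'I_n) : \det (\big[mulmx/1%:M]_(i <- t) c i) = \prod_(i <- t) \det (c i).
    elim: t => [|x t IH]; first by rewrite !big_nil det1.
    by rewrite !big_cons det_mulmx IH.
  by rewrite -(perm_big _ sE) -dE c1 det1.
have sub i : exists L : {set 'I_r}, #|L| = \rank U /\ \det (c i) = \prod_(k in L) tnth (lam i) k.
  have dv : char_poly (c i) %| \prod_(k <- enum 'I_r) ('X - (tnth (lam i) k)%:P).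
    have -> : \prod_(k <- enum 'I_r) ('X - (tnth (lam i) k)%:P) = char_poly (T i).
      rewrite cp [in RHS](tuple_map_ord (lam i)) /= big_map; apply: eq_big_seq => //.
    have rr : (\rank U + (r - \rank U) = r)%N by rewrite subnKC // rank_leq_row.
    exact: (@char_poly_restrict_eq _ _ _ _ rr (T i) b (c i) bf (bT i)).
  have [ms hm] := dvdp_prod_XsubC dv; pose t := mask ms (enum 'I_r).
  have ut : uniq t by rewrite mask_uniq // enum_uniq.
  have E : char_poly (c i) = \prod_(k <- t) ('X - (tnth (lam i) k)%:P).
    by apply/eqP; rewrite -eqp_monic ?char_poly_monic // monic_prod_XsubC.
  have st' : size t = \rank U.
    have := size_char_poly (c i); rewrite E -(big_map (fun k => tnth (lam i) k) xpredT (fun x => 'X - x%:P)).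
    by rewrite size_prod_XsubC size_map => -[].
  exists [set k in t]; split; first by rewrite cardsE (card_uniqP ut).
  have := char_poly_det (c i); rewrite E => h.
  have -> : \prod_(k in [set k in t]) tnth (lam i) k = \prod_(k <- t) tnth (lam i) k.
    by rewrite big_uniq //; apply: eq_bigl => k; rewrite inE.
  have : (\prod_(k <- t) ('X - (tnth (lam i) k)%:P))`_0 = (-1) ^+ \rank U * \prod_(k <- t) tnth (lam i) k.
    rewrite -horner_coef0 horner_prod -st'; elim: (t) => [|x t' IH]; first by rewrite !big_nil mul1r.
    by rewrite !big_cons IH hornerXsubC sub0r /= exprS; ring.
  rewrite h => /(congr1 ( *%R ((-1) ^+ \rank U))); rewrite !mulrA -!exprD addnn -mul2n exprM sqrrN expr1n.
  by rewrite expr1n !mul1r.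
have [L hL] := choice sub.
have := gen mr (fun i => (hL i).1).
by rewrite -(eq_bigr _ (fun i _ => (hL i).2)) d1 eqxx.
Qed.

Lemma schur (Z : 'M[F]_r) : (0 < r)%N -> (forall i, Z *m T i = T i *m Z) -> exists mu, Z = mu%:M.
Proof.
move=> r0 ZT; have [mu] : exists mu, root (char_poly Z) mu.
  by apply/closed_rootP; rewrite size_char_poly; case: (r) r0.
rewrite -eigenvalue_root_char => ev0; exists mu.
have [|h|h] := @generic_stable (kermx (Z - mu%:M)).
- move=> i; apply/sub_kermxP; rewrite -mulmxA.
  have -> : T i *m (Z - mu%:M) = (Z - mu%:M) *m T i.
    by rewrite mulmxBr mulmxBl ZT mul_mx_scalar mul_scalar_mx.
  by rewrite mulmxA mulmx_ker mul0mx.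
- by move: ev0; rewrite /eigenvalue /eigenspace -mxrank_eq0 h.
- apply/eqP; rewrite -subr_eq0 -mxrank_eq0; move: h; rewrite mxrank_ker => h.
  have := subnK (rank_leq_row (Z - mu%:M)); rewrite h => /eqP.
  by rewrite -[X in _ == X]addn0 eqn_add2l.
Qed.
End Irreducible.

(** * Triangular forms adapted to the images of partial products *)

Section ExactForm.
Variables (F : fieldType) (r B : nat) (A : 'M[F]_r) (ls : nat -> F).
Fixpoint fprod j : 'M[F]_r := if j is j'.+1 then fprod j' *m (A - (ls j')%:M) else 1%:M.
Hypothesis fB : fprod B = 0.

Lemma fprod_comm j x : fprod j *m (A - x%:M) = (A - x%:M) *m fprod j.
Proof.
elim: j => [|j IH] /=; first by rewrite mul1mx mulmx1.
rewrite -mulmxA; have -> : (A - (ls j)%:M) *m (A - x%:M) = (A - x%:M) *m (A - (ls j)%:M).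
  have zm (V : zmodType) (p q s t : V) : p - q - (s - t) = p - s - (q - t).
    by rewrite !opprB !addrA [LHS]addrAC [RHS]addrAC; congr (_ + _); rewrite addrAC.
  by rewrite !mulmxBr !mulmxBl !mul_mx_scalar !mul_scalar_mx !scale_scalar_mx zm [x * _]mulrC.
by rewrite mulmxA IH -mulmxA.
Qed.

Lemma fprodS j : (fprod j.+1 <= fprod j)%MS.
Proof. by rewrite /= fprod_comm submxMl. Qed.

Lemma fprod_le j k : (j <= k)%N -> (fprod k <= fprod j)%MS.
Proof.
elim: k => [|k IH]; first by rewrite leqn0 => /eqP ->.
rewrite leq_eqVlt ltnS => /orP[/eqP -> //|/IH h]; exact: submx_trans (fprodS k) h.
Qed.

(** The depth of the last image in the filtration by [fprod] whose dimension still exceeds [a]. *)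
Definition rlab (a : 'I_r) := (\sum_(j < B) (a < \rank (fprod j.+1))%N)%N.

Lemma rlabP j a : (j <= B)%N -> (j <= rlab a)%N = (a < \rank (fprod j))%N.
Proof.
case: j => [|j] jB; first by rewrite /= mxrank1 ltn_ord.
rewrite /rlab (@sum_dec (fun j => (a < \rank (fprod j.+1))%N)) // => l h.
by apply: leq_trans h _; apply: mxrankS; exact: fprodS.
Qed.

Lemma rlab_lt a : (rlab a < B)%N.
Proof.
rewrite ltnNge; apply/negP => h; have h2 : (B <= rlab a)%N by [].
by move: h2; rewrite rlabP // fB mxrank0.
Qed.

Lemma card_rlab j : (j < B)%N -> #|[pred a | rlab a == j]| = (\rank (fprod j) - \rank (fprod j.+1))%N.
Proof.
move=> jB; have cd k : (k <= r)%N -> #|[pred a : 'I_r | (a < k)%N]| = k.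
  move=> kr; rewrite -sum1_card -(big_ord_widen _ (fun=> 1%N) kr) sum1_card card_ord //.
have le : (\rank (fprod j.+1) <= \rank (fprod j))%N := mxrankS (fprodS j).
rewrite -[in RHS](cd _ (rank_leq_row (fprod j))) -[in RHS](cd _ (rank_leq_row (fprod j.+1))).
rewrite -(cardID [pred a : 'I_r | (a < \rank (fprod j.+1))%N] [pred a : 'I_r | (a < \rank (fprod j))%N]).
rewrite (@eq_card _ [predI _ & _] [pred a : 'I_r | (a < \rank (fprod j.+1))%N]) => [|a].
  rewrite addKn; apply: eq_card => a; rewrite !inE -!rlabP //; last by rewrite ltnW.
  by rewrite -leqNgt eqn_leq.
by rewrite !inE andbC; case: ltnP => //= h; rewrite (leq_trans h).
Qed.

Lemma adapted_basis : exists2 Q : 'M[F]_r, Q \in unitmx & forall a, (row a Q <= fprod (rlab a))%MS.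
Proof.
(* Rows are chosen one at a time. Independence of the first [k] rows is phrased through vectors [u]
   supported on the first [k] coordinates, so that the matrix stays square. *)
suff H k : (k <= r)%N -> exists Q : 'M[F]_r, (forall a : 'I_r, (a < k)%N -> (row a Q <= fprod (rlab a))%MS) /\
    (forall u : 'rV_r, (forall a : 'I_r, (k <= a)%N -> u 0 a = 0) -> u *m Q = 0 -> u = 0).
  have [Q [Q1 Q2]] := H r (leqnn r); exists Q => [|a]; last exact: Q1.
  rewrite -row_free_unit -kermx_eq0; apply/rowV0P => v /sub_kermxP; apply: Q2 => a.
  by rewrite leqNgt ltn_ord.
elim: k => [|k IH] kr.
  by exists 0; split=> // u u0 _; apply/rowP => a; rewrite u0 // mxE.
have [Q [Q1 Q2]] := IH (ltnW kr); pose a0 := Ordinal kr.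
(* The image at the level of [a0] has dimension above [k], hence is not contained in the span of the
   [k] rows already chosen. *)
have nle : ~~ (fprod (rlab a0) <= (pid_mx k : 'M_r) *m Q)%MS.
  apply/negP => /mxrankS; rewrite leqNgt => /negP; apply.
  have : (k < \rank (fprod (rlab a0)))%N by have := rlabP a0 (ltnW (rlab_lt a0)); rewrite leqnn => /esym.
  apply: leq_ltn_trans; apply: leq_trans (mxrankM_maxl _ _) _; rewrite rank_pid_mx //; exact: ltnW.
have [x xv] := row_subPn nle; set v := row x _ in xv.
pose Q' : 'M[F]_r := \matrix_i (if i == a0 then v else row i Q).
exists Q'; split=> [a ak|u u0 uQ].
  rewrite rowK; case: eqP => [->|/eqP an]; first exact: row_sub.
  by apply: Q1; move: ak; rewrite ltnS leq_eqVlt => /orP[/eqP e|//]; case/eqP: an; exact: val_inj.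
pose u' : 'rV_r := \row_a (if a == a0 then 0 else u 0 a).
have E : u *m Q' = u 0 a0 *: v + u' *m Q.
  rewrite !mulmx_sum_row (bigD1 a0) //= rowK eqxx [in RHS](bigD1 a0) //= mxE eqxx scale0r add0r.
  by congr (_ + _); apply: eq_bigr => a /negbTE an; rewrite rowK mxE an.
have u'0 (a : 'I_r) : (k <= a)%N -> u' 0 a = 0.
  rewrite mxE; case: eqP => // /eqP an ka; apply: u0; rewrite ltn_neqAle ka andbT.
  by apply: contra an => /eqP e; apply/eqP/val_inj.
have u'D : u' *m pid_mx k = u'.
  apply/rowP => a; rewrite mxE (bigD1 a) //= big1 => [|b ba]; rewrite !mxE ?eqxx /=; last first.
    by move: ba; rewrite -val_eqE /= => /negbTE ->; rewrite mulr0.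
  case: ltnP => ka; rewrite ?mulr1 ?mulr0 addr0 //.
  by have := u'0 _ ka; rewrite mxE => ->.
rewrite uQ in E; have u00 : u 0 a0 = 0.
  apply/eqP; apply: contraNT xv => un.
  have -> : v = (- (u 0 a0)^-1 *: u') *m ((pid_mx k : 'M_r) *m Q).
    rewrite mulmxA -scalemxAl u'D -scalemxAl.
    have -> : u' *m Q = - (u 0 a0 *: v) by apply/eqP; rewrite -addr_eq0 addrC -E.
    by rewrite scaleNr scalerN opprK scalerA mulVf // scale1r.
  exact: submxMl.
have : u' = 0 by apply: Q2 => //; rewrite u00 scale0r add0r in E.
move=> e; apply/rowP => a; have := congr1 (fun X : 'rV_r => X 0 a) e; rewrite !mxE.
by case: eqP => [->|].
Qed.

Definition gsup (rho : 'I_r -> nat) j (w : 'rV[F]_r) := forall b, w 0 b != 0 -> (j <= rho b)%N.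

(** The last clause is what remembers the conjugacy class and not only its closure: the vectors of
    level at least [j] are exactly the [j]-th image, so step [j] maps them onto those of level at
    least [j.+1]. *)
Lemma exact_form : exists2 Q : 'M[F]_r, Q \in unitmx & let E := Q *m A *m invmx Q in
  [/\ tri rlab E, forall a, E a a = ls (rlab a) &
   forall j u, (j < B)%N -> gsup rlab j.+1 u -> exists2 y, gsup rlab j y & y *m (E - (ls j)%:M) = u].
Proof.
have [Q Qu Qr] := adapted_basis; exists Q => // E.
have R2 j w : gsup rlab j w -> (w *m Q <= fprod j)%MS.
  move=> gw; rewrite mulmx_sum_row; apply: summx_sub => b _.
  have [->|/gw jb] := eqVneq (w 0 b) 0; first by rewrite scale0r sub0mx.
  by apply: scalemx_sub; apply: submx_trans (Qr b) (fprod_le jb).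
have R3 j (u : 'rV_r) : (j <= B)%N -> (u <= fprod j)%MS -> exists2 w, gsup rlab j w & u = w *m Q.
  move=> jB uV; pose d := \rank (fprod j).
  have sub : ((pid_mx d : 'M_r) *m Q <= fprod j)%MS.
    apply/row_subP => a; rewrite row_mul; apply: R2 => b; rewrite !mxE.
    case: (boolP ((a == b :> nat) && (a < d)%N)) => [/andP[/eqP ab ad] _|]; last by rewrite eqxx.
    by rewrite rlabP // -ab.
  have eqr : (fprod j <= (pid_mx d : 'M_r) *m Q)%MS.
    rewrite -(mxrank_leqif_sup sub).2 mxrankMfree ?row_free_unit // rank_pid_mx ?rank_leq_row //.
  have /submxP[x xE] := submx_trans uV eqr; exists (x *m pid_mx d); last by rewrite -mulmxA.
  move=> b; rewrite rlabP // mxE; apply: contraNT => bd; rewrite big1 // => a _.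
  rewrite mxE; case: (boolP ((a == b :> nat) && (a < d)%N)) => [/andP[/eqP ab ad]|]; rewrite ?mulr0 //.
  by move: bd; rewrite -ab ad.
have EQ x : (E - x%:M) *m Q = Q *m (A - x%:M).
  by rewrite mulmxBl mulmxBr /E mulmxKV // mul_scalar_mx mul_mx_scalar.
have step a : exists2 w, gsup rlab (rlab a).+1 w & row a (E - (ls (rlab a))%:M) = w.
  have [|w gw wE] := R3 (rlab a).+1 (row a Q *m (A - (ls (rlab a))%:M)) (rlab_lt a).
    by rewrite /= submxMr // Qr.
  exists w => //; apply: (can_inj (mulmxK Qu)); rewrite -wE -!row_mul EQ //.
split.
- move=> a b; have [->|ab] := eqVneq a b; first by left.
  move=> Eab; right; have [w gw wE] := step a; apply: gw; rewrite -wE !mxE (negbTE ab) mulr0n subr0.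
  by move: Eab; rewrite !mxE.
- move=> a; have [w gw wE] := step a; apply/eqP; rewrite -subr_eq0; apply/negPn/negP => h.
  have : w 0 a != 0 by rewrite -wE mxE mxE [in X in _ + X]mxE [(_%:M) a a]mxE eqxx mulr1n.
  by move=> /gw; rewrite ltnn.
- move=> j u jB gu; have := R2 _ _ gu; rewrite /= => /submxP[x xE].
  have [|y gy yE] := R3 j (x *m fprod j) (ltnW jB); first exact: submxMl.
  exists y => //; apply: (can_inj (mulmxK Qu)); rewrite -mulmxA EQ mulmxA -yE -mulmxA -xE.
  by [].
Qed.
End ExactForm.

(** * Segments towards the exact form *)

Section Path.
Variables (F : fieldType) (r B : nat) (rho : 'I_r -> nat) (ls : nat -> F) (E X : 'M[F]_r).
Hypothesis rhoB : forall a, (rho a < B)%N.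
Hypotheses (tE : tri rho E) (dE : forall a, E a a = ls (rho a)).
Hypotheses (tX : tri rho X) (dX : forall a, X a a = ls (rho a)).
Hypothesis surj : forall j u, (j < B)%N -> gsup rho j.+1 u -> exists2 y, gsup rho j y & y *m (E - (ls j)%:M) = u.

Definition strict (Z : 'M[F]_r) := forall a b, Z a b != 0 -> (rho a < rho b)%N.

(** Infinitesimal conjugation by block triangular matrices moves [E] in every strictly triangular
    direction. The rows of [Y] are found from the highest level down: once the later rows are known,
    the equation for a row of level [j] has its right-hand side in level above [j], where [surj]
    solves it. *)
Lemma commutator_surj Z : strict Z -> exists2 Y, bt rho Y & Y *m E - E *m Y = Z.
Proof.
move=> sZ; suff H k : (k <= B)%N -> exists Y : 'M[F]_r, forall a, (B - k <= rho a)%N ->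
    gsup rho (rho a) (row a Y) /\ row a (Y *m E - E *m Y) = row a Z.
  have [Y hY] := H B (leqnn B); exists Y.
    by move=> a b Yab; have [|gY _] := hY a; [rewrite subnn|apply: gY; rewrite mxE].
  by apply/row_matrixP => a; apply: (hY a _).2; rewrite subnn.
elim: k => [|k IH] kB; first by exists 0 => a; rewrite subn0 leqNgt rhoB.
have [Y hY] := IH (ltnW kB); pose j := (B - k.+1)%N; have jB : (j < B)%N by rewrite /j; lia.
pose w a : 'rV_r := row a Z + \sum_(b | (j < rho b)%N) E a b *: row b Y.
have gw a : rho a = j -> gsup rho j.+1 (w a).
  move=> aj b; apply: contraNT => nb; rewrite !mxE summxE; apply/eqP.
  have -> : Z a b = 0 by apply/eqP; apply: contraNT nb => /sZ; rewrite aj.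
  rewrite add0r big1 // => d jd; rewrite !mxE.
  have [|gY _] := hY d; first by rewrite /j in jd; lia.
  have -> : Y d b = 0; last by rewrite mulr0.
  by apply/eqP; apply: contraNT nb => Ydb; apply: leq_trans jd (gY b _); rewrite mxE.
have ex a : exists y, rho a = j -> gsup rho j y /\ y *m (E - (ls j)%:M) = w a.
  have [aj|aj] := eqVneq (rho a) j; last by exists 0 => e; rewrite e eqxx in aj.
  by have [y gy yE] := surj jB (gw a aj); exists y.
have [y hy] := choice ex; pose Y' : 'M[F]_r := \matrix_a (if rho a == j then y a else row a Y).
have rE a (W : 'M[F]_r) : row a (E *m W) = E a a *: row a W + \sum_(b | (rho a < rho b)%N) E a b *: row b W.
  rewrite row_mul mulmx_sum_row (bigD1 a) //= mxE; congr (_ + _).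
  rewrite (bigID (fun b => (rho a < rho b)%N)) /= [X in _ + X]big1 ?addr0 => [|b /andP[ba nb]].
    apply: eq_big => [b|b _]; last by rewrite mxE.
    by case: ltnP => ab; rewrite ?andbF ?andbT //; apply: contraTneq ab => ->; rewrite ltnn.
  rewrite mxE; have -> : E a b = 0; last by rewrite scale0r.
  apply/eqP; apply: contraNT nb => /tE[e|//]; by rewrite e eqxx in ba.
exists Y' => a; rewrite leq_eqVlt => /orP[/eqP ja|ja].
  have aj : rho a = j by [].
  have [gy yE] := hy a aj; rewrite rowK aj eqxx; split=> //.
  rewrite raddfB /= row_mul rowK aj eqxx rE rowK aj eqxx dE aj.
  rewrite (eq_bigr (fun b => E a b *: row b Y)) => [|b jb]; last by rewrite rowK gtn_eqF.
  move: yE; rewrite mulmxBr mul_mx_scalar /w => /(congr1 (fun X => X - \sum_(b | (j < rho b)%N) E a b *: row b Y)).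
  by rewrite addrK opprD addrA.
have aj : (j < rho a)%N by [].
have [|gY YE] := hY a; first by rewrite /j in aj; lia.
rewrite rowK gtn_eqF //; split=> //; rewrite -YE !raddfB /= !row_mul; congr (_ - _).
  by rewrite rowK gtn_eqF.
rewrite -!row_mul !rE rowK gtn_eqF //; congr (_ + _); apply: eq_bigr => b ab.
by rewrite rowK gtn_eqF // (ltn_trans aj).
Qed.

Let btm (Y : 'M[F]_r) : 'M[F]_r := \matrix_(a, b) (if (rho a <= rho b)%N then Y a b else 0).
Let stm (Y : 'M[F]_r) : 'M[F]_r := \matrix_(a, b) (if (rho a < rho b)%N then Y a b else 0).

Lemma strict_comm Y Z : bt rho Y -> tri rho Z -> (forall a, Z a a = ls (rho a)) -> strict (Y *m Z - E *m Y).
Proof.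
move=> bY tZ dZ a b; apply: contraNT; rewrite -leqNgt => ba; apply/eqP.
have YE0 x y : (rho y < rho x)%N -> Y x y = 0.
  by move=> xy; apply/eqP; apply: contraTT xy => /bY; rewrite -leqNgt.
have z0 (W : 'M[F]_r) x y : tri rho W -> x != y -> ~~ (rho x < rho y)%N -> W x y = 0.
  by move=> tW xy nxy; apply/eqP; apply: contraNT nxy => /tW[e|//]; rewrite e eqxx in xy.
rewrite !mxE (bigD1 b) //= [X in _ - X](bigD1 a) //= big1 ?addr0 => [|d db]; last first.
  case: (ltnP (rho d) (rho b)) => db'; last by rewrite (z0 _ _ _ tZ db) ?mulr0 // -leqNgt.
  by rewrite YE0 ?mul0r // (leq_trans db').
rewrite big1 ?addr0 => [|d da]; last first.
  case: (ltnP (rho a) (rho d)) => da'; last by rewrite (z0 _ _ _ tE) ?mul0r // 1?eq_sym // -leqNgt.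
  by rewrite YE0 ?mulr0 // (leq_ltn_trans ba).
have [e|ne] := eqVneq (rho b) (rho a); first by rewrite dZ dE e mulrC subrr.
by rewrite YE0 ?mul0r ?mulr0 ?subrr // ltn_neqAle ne.
Qed.

(** Intertwiners between a point of the segment and [E] solve a linear system that depends
    polynomially on [e]. At [e = 1] it is onto the strict matrices by [commutator_surj] and has the
    solution 1. Cramer's rule extends this solution to a polynomial one, invertible outside the
    roots of its determinant. *)
Lemma path_conj : exists2 p : {poly F}, p != 0 & forall e, ~~ root p e ->
  exists2 Y, Y \in unitmx & Y *m (X + e *: (E - X)) = E *m Y.
Proof.
have lb : linear btm by move=> k u v; apply/matrixP => a b; rewrite !mxE; case: ifP; rewrite ?mulr0 ?addr0.
have ls' : linear stm by move=> k u v; apply/matrixP => a b; rewrite !mxE; case: ifP; rewrite ?mulr0 ?addr0.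
have bb Y : bt rho (btm Y) by move=> a b; rewrite mxE; case: ifP => //; rewrite eqxx.
have ss Z : strict (stm Z) by move=> a b; rewrite mxE; case: ifP => //; rewrite eqxx.
have sid Z : strict Z -> stm Z = Z.
  by move=> sZ; apply/matrixP => a b; rewrite mxE; case: ltnP => // ab; apply/esym/eqP; apply: contraTT ab => /sZ; rewrite -ltnNge.
have bid Y : bt rho Y -> btm Y = Y.
  by move=> bY; apply/matrixP => a b; rewrite mxE; case: leqP => // ab; apply/esym/eqP; apply: contraTT ab => /bY; rewrite -leqNgt.
pose f0 Y := stm (btm Y *m X - E *m btm Y); pose f1 Y := stm (btm Y *m (E - X)).
have l0 : linear f0.
  move=> k u v; rewrite /f0 -ls' lb; congr stm.
  by rewrite mulmxDl mulmxDr -scalemxAl -scalemxAr scalerBr opprD addrACA.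
have l1 : linear f1 by move=> k u v; rewrite /f1 -ls' lb mulmxDl -scalemxAl.
pose M0 := lin_mx f0; pose M1 := lin_mx f1; pose P := lin_mx stm.
have PP : P *m P = P by apply: mxvec_mul_inj => Z; rewrite mulmxA !lin_mxE // sid.
have M0P : M0 *m P = M0 by apply: mxvec_mul_inj => Z; rewrite mulmxA !lin_mxE // sid //; exact: ss.
have M1P : M1 *m P = M1 by apply: mxvec_mul_inj => Z; rewrite mulmxA !lin_mxE // sid //; exact: ss.
pose MM : 'M[F]_(r * r) := M0 + M1.
have /submxP[C CP] : (P <= MM)%MS.
  apply/row_subP => k; rewrite rowE -[delta_mx 0 k]vec_mxK lin_mxE //; set Z := vec_mx _.
  have [Y bY YE] := commutator_surj (ss Z).
  have -> : mxvec (stm Z) = mxvec Y *m MM; last exact: submxMl.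
  rewrite /MM mulmxDr !lin_mxE // -linearD /f0 /f1; congr mxvec.
  have sD : stm (Y *m X - E *m Y) + stm (Y *m (E - X)) = stm (Y *m X - E *m Y + Y *m (E - X)).
    by have := ls' 1 (Y *m X - E *m Y) (Y *m (E - X)); rewrite !scale1r.
  have e1 : Y *m X - E *m Y + Y *m (E - X) = stm Z by rewrite mulmxBr [LHS]addrC addrA subrK YE.
  by rewrite (bid _ bY) sD e1 [RHS]sid.
pose pc m k (Z : 'M[F]_(m, k)) := map_mx polyC Z.
pose Mp := pc _ _ M0 + 'X *: pc _ _ M1.
pose Np := pc _ _ C *m Mp + pc _ _ (1%:M - P).
pose v0 := mxvec (1%:M : 'M[F]_r).
(* The start vector [v0] minus a preimage of its defect, with denominators cleared by [\det Np]; the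
   summand [1%:M - P] completes [Np] to the identity at [e = 1]. *)
pose vp := \det Np *: pc _ _ v0 - pc _ _ v0 *m Mp *m \adj Np *m pc _ _ C.
pose Yp : 'M[{poly F}]_r := \matrix_(a, b) (if (rho a <= rho b)%N then vp 0 (mxvec_index a b) else 0).
have evc m k (Z : 'M[F]_(m, k)) e : map_mx (horner_eval e) (pc _ _ Z) = Z.
  by apply/matrixP => a b; rewrite !mxE /horner_eval hornerC.
have evM e : map_mx (horner_eval e) Mp = M0 + e *: M1.
  by apply/matrixP => a b; rewrite !mxE /horner_eval !hornerE.
pose N e := C *m (M0 + e *: M1) + (1%:M - P).
have evN e : map_mx (horner_eval e) Np = N e by rewrite map_mxD map_mxM evM !evc.
pose v e := \det (N e) *: v0 - v0 *m (M0 + e *: M1) *m \adj (N e) *m C.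
have evv e : map_mx (horner_eval e) vp = v e.
  by rewrite map_mxB map_mxZ !map_mxM map_mx_adj evM evN !evc -det_map_mx evN.
have evY e : map_mx (horner_eval e) Yp = btm (vec_mx (v e)).
  apply/matrixP => a b; rewrite [LHS]mxE [Yp a b]mxE [RHS]mxE [vec_mx _ a b]mxE -evv [in RHS]mxE; case: ifP => // _.
  by rewrite /horner_eval horner0.
have pE e : (\det Yp).[e] = \det (btm (vec_mx (v e))) by rewrite -horner_evalE -det_map_mx evY.
exists (\det Yp).
  apply: contraTneq (oner_neq0 F) => p0; have := pE 1; rewrite p0 horner0.
  have -> : v 1 = v0.
    have N1 : N 1 = 1%:M by rewrite /N scale1r -CP addrC subrK.
    rewrite /v N1 det1 !scale1r; have -> : v0 *m (M0 + M1) = 0; last by rewrite !mul0mx subr0.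
    rewrite mulmxDr !lin_mxE // -linearD /f0 /f1 /= bid; last exact: bt_scalar.
    have := ls' 1 (1%:M *m X - E *m 1%:M) (1%:M *m (E - X)); rewrite !scale1r => <-.
    by rewrite !mul1mx mulmx1 addrC addrA subrK subrr (lin_fun0 ls') linear0.
  rewrite /v0 mxvecK bid ?det1 => [<-|]; last exact: bt_scalar.
  by rewrite eqxx.
move=> e; rewrite /root pE => dY; exists (btm (vec_mx (v e))); first by rewrite unitmxE unitfE.
set Y := btm _; have vM : v e *m (M0 + e *: M1) = 0.
  set M := M0 + e *: M1; have MP : M *m (1%:M - P) = 0.
    by rewrite mulmxBr mulmx1 /M mulmxDl -scalemxAl M0P M1P subrr.
  have NP : N e *m (1%:M - P) = 1%:M - P.
    by rewrite /N mulmxDl -mulmxA MP mulmx0 add0r mulmxBr mulmx1 mulmxBl mul1mx PP subrr subr0.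
  have aP : M *m \adj (N e) *m (1%:M - P) = 0.
    rewrite -mulmxA; have -> : \adj (N e) *m (1%:M - P) = \adj (N e) *m (N e *m (1%:M - P)) by rewrite NP.
    by rewrite [\adj _ *m (N e *m _)]mulmxA mul_adj_mx mul_scalar_mx -scalemxAr MP scaler0.
  rewrite /v mulmxBl -scalemxAl -[_ *m C *m M]mulmxA.
  have -> : C *m M = N e - (1%:M - P) by rewrite /N addrK.
  rewrite mulmxBr -!mulmxA [M *m (\adj _ *m (1%:M - P))]mulmxA aP mulmx0 subr0 mul_adj_mx.
  by rewrite !mul_mx_scalar -scalemxAr subrr.
have : f0 (vec_mx (v e)) + e *: f1 (vec_mx (v e)) = 0.
  have h0 := lin_mxE l0 (vec_mx (v e)); have h1 := lin_mxE l1 (vec_mx (v e)); rewrite vec_mxK in h0 h1.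
  apply: (can_inj mxvecK); rewrite linearD linearZ /= -h0 -h1 linear0.
  by rewrite -[RHS]vM mulmxDr scalemxAr.
rewrite addrC /f0 /f1 -/Y -ls' => st0.
have tXe : tri rho (X + e *: (E - X)).
  move=> a b; have [->|ab] := eqVneq a b; first by left.
  rewrite !mxE => h; right; have [Xz|/tX[e'|//]] := eqVneq (X a b) 0; last by rewrite e' eqxx in ab.
  move: h; rewrite Xz add0r subr0 mulf_eq0 negb_or => /andP[_ /tE[e'|//]]; by rewrite e' eqxx in ab.
have dXe a : (X + e *: (E - X)) a a = ls (rho a) by rewrite !mxE dX dE subrr mulr0 addr0.
have := sid _ (strict_comm (bb (vec_mx (v e))) tXe dXe); rewrite -/Y => hs.
apply/eqP; rewrite -subr_eq0 -hs -[X in _ == X]st0; apply/eqP; congr stm.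
by rewrite mulmxDr -scalemxAr addrA; congr (_ - _); exact: addrC.
Qed.
End Path.

(** * The attached partition as block sizes *)

Section Attached.
Variables (F : fieldType) (r' : nat).
Local Notation r := r'.+1.
Variables (A : 'M[F]_r) (lam : r.-tuple F).
Hypothesis cp : char_poly A = \prod_(x <- lam) ('X - x%:P).
Let ul := undup lam.
(** Each distinct eigenvalue is used [r] times in succession, enough to exhaust its Jordan blocks,
    and there are at most [r] of them, whence [r * r] steps. The default [0] past the list is
    harmless, since the product is already zero there. *)
Definition eigseq (j : nat) : F := nth 0 ul (j %/ r).
Local Notation fp := (fprod A eigseq).
Let pp j : {poly F} := \prod_(l < j) ('X - (eigseq l)%:P).

Lemma fprod_horner j : fp j = horner_mx A (pp j).
Proof.
elim: j => [|j IH] /=; first by rewrite /pp big_ord0 [RHS]rmorph1.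
rewrite /pp big_ord_recr rmorphM /= -/(pp j) -IH rmorphB /= horner_mx_X horner_mx_C //.
Qed.

Lemma rank_coprime (p q : {poly F}) : coprimep p q ->
  (\rank (horner_mx A (p * q)) + r = \rank (horner_mx A p) + \rank (horner_mx A q))%N.
Proof.
move=> cpq; have k p' : (\rank (kermxpoly A p') = r - \rank (horner_mx A p'))%N by rewrite mxrank_ker.
have l p' : (\rank (horner_mx A p') <= r)%N := rank_leq_row _.
have e : \rank (kermxpoly A (p * q)) = \rank (kermxpoly A p + kermxpoly A q)%MS by rewrite (kermxpolyM A cpq).
move: e; have d := mxdirect_kermxpoly A cpq.
rewrite (mxrank_disjoint_sum d) !k; have := l p; have := l q; have := l (p * q); lia.
Qed.

Lemma pp_split q t : (t <= r)%N -> pp (q * r + t) = pp (q * r) * ('X - (nth 0 ul q)%:P) ^+ t.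
Proof.
elim: t => [|t IH] tr; first by rewrite addn0 mulr1.
rewrite addnS /pp big_ord_recr /= -/(pp (q * r + t)) IH ?(ltnW tr) // exprSr mulrA.
by rewrite /eigseq divnMDl // divn_small // addn0.
Qed.

Lemma ul_size : (size ul <= r)%N.
Proof. by rewrite -[X in (_ <= X)%N](size_tuple lam) size_undup. Qed.

(** The factors of earlier eigenvalues are coprime to the powers of the current one. By
    [rank_coprime] they lower both ranks by the same amount and cancel in the difference. *)
Lemma eig_step q t : (q < size ul)%N -> (t < r)%N ->
  (\rank (fp (q * r + t)) - \rank (fp (q * r + t).+1))%N = nblocks_ge A (nth 0 ul q) t.+1.
Proof.
move=> qs tr; rewrite !fprod_horner -addnS !pp_split //; last exact: ltnW.
set x := nth 0 ul q.
have cop k : coprimep (pp (q * r)) (('X - x%:P) ^+ k).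
  rewrite coprimep_sym; apply: coprimep_expl; rewrite coprimep_sym coprimep_XsubC /pp /root horner_prod; apply/prodf_neq0 => l _.
  have lq : (l %/ r < q)%N by rewrite ltn_divLR.
  by rewrite hornerXsubC subr_eq0 /eigseq /x nth_uniq ?undup_uniq ?(ltn_trans lq) // gtn_eqF.
have := rank_coprime (cop t); have := rank_coprime (cop t.+1).
have hx k : horner_mx A (('X - x%:P) ^+ k) = (A - x%:M) ^+ k by rewrite rmorphXn rmorphB /= horner_mx_X horner_mx_C.
rewrite !hx /nblocks_ge /=; lia.
Qed.

Lemma fp_full : fp (size ul * r) = 0.
Proof.
have E q : (q <= size ul)%N -> pp (q * r) = (\prod_(x <- take q ul) ('X - x%:P)) ^+ r.
  elim: q => [|q IH] qs; first by rewrite take0 /pp big_ord0 big_nil expr1n.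
  rewrite mulSnr pp_split // IH ?(ltnW qs) // (take_nth 0) // -cats1 big_cat big_seq1 exprMn //.
rewrite fprod_horner E // take_size.
have dv (s : seq F) : {subset s <= ul} -> (\prod_(x <- s) ('X - x%:P)) %| (\prod_(x <- ul) ('X - x%:P)) ^+ size s.
  elim: s => [|y s IH] sub; first by rewrite big_nil expr0.
  rewrite big_cons exprS; apply: dvdp_mul.
    by rewrite dvdp_XsubCl root_prod_XsubC sub // mem_head.
  by apply: IH => z zs; apply: sub; rewrite inE zs orbT.
have sub : {subset lam <= ul} by move=> y; rewrite mem_undup.
have h := dv lam sub; rewrite size_tuple in h; have [q hq] := dvdpP _ _ h.
by rewrite hq rmorphM /= -cp Cayley_Hamilton mulr0.
Qed.

Lemma fp_end j : (size ul * r <= j)%N -> fp j = 0.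
Proof.
elim: j => [|j IH]; first by rewrite leqn0 => /eqP <-; rewrite fp_full.
by rewrite leq_eqVlt ltnS => /orP[/eqP <-|/IH /= ->]; rewrite ?fp_full ?mul0mx.
Qed.

Lemma fp_B : fp (r * r) = 0.
Proof. by apply: fp_end; rewrite leq_mul2r ul_size orbT. Qed.

Definition eigrow (j : 'I_(r * r)) := #|[pred a | rlab (r * r) A eigseq a == j]|.

Lemma eigrowE j : eigrow j = (\rank (fp j) - \rank (fp j.+1))%N.
Proof. by rewrite /eigrow card_rlab // fp_B. Qed.

Lemma attached_rows : perm_eq (attached_partition A lam) [seq x <- [seq eigrow j | j <- enum 'I_(r * r)] | (0 < x)%N].
Proof.
pose s j := (\rank (fp j) - \rank (fp j.+1))%N.
have -> : [seq eigrow j | j <- enum 'I_(r * r)] = [seq s j | j <- iota 0 (r * r)].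
  by rewrite -val_enum_ord -map_comp; apply: eq_map => j; rewrite /= eigrowE.
have sz : (size ul * r <= r * r)%N by rewrite leq_mul2r ul_size orbT.
rewrite -(subnKC sz) iotaD map_cat filter_cat add0n.
have -> : [seq x <- [seq s j | j <- iota (size ul * r) (r * r - size ul * r)] | (0 < x)%N] = [::].
  apply/eqP; rewrite -[_ == _]negbK -has_filter -all_predC; apply/allP => x /mapP[j]; rewrite mem_iota => /andP[h _] ->.
  by rewrite /s /= fp_end // mxrank0.
rewrite cats0 /attached_partition perm_sort -/ul.
have fl1 (t : seq nat) : flatten [:: t] = t by rewrite /= cats0.
have E q : (q <= size ul)%N -> [seq s j | j <- iota 0 (q * r)] = flatten [seq [seq nblocks_ge A x j | j <- iota 1 r] | x <- take q ul].
  elim: q => [|q IH] qs; first by rewrite take0.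
  rewrite mulSnr iotaD map_cat IH ?(ltnW qs) // (take_nth 0) // map_rcons -cats1 flatten_cat fl1; congr (_ ++ _).
  rewrite add0n; have -> : iota (q * r) r = [seq (q * r + t)%N | t <- iota 0 r] by rewrite -iotaDl addn0.
  have -> : iota 1 r = [seq (1 + t)%N | t <- iota 0 r] by exact: (iotaDl 1 0 r).
  rewrite -!map_comp; apply/eq_in_map => t.
  by rewrite mem_iota => /andP[_ tr] /=; rewrite /s eig_step.
rewrite E // take_size filter_flatten -map_comp; apply/seq.permP => a; congr (count a (flatten _)).
by apply/eq_in_map => x _ /=; rewrite /dual_jordan_partition -filter_map.
Qed.

Lemma eigrow_sum : (\sum_j eigrow j = r)%N.
Proof.
transitivity (\sum_(a < r) 1)%N; last by rewrite sum1_card card_ord.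
rewrite (partition_big (fun a => Ordinal (rlab_lt fp_B a)) xpredT) //=.
by apply: eq_bigr => j _; rewrite /eigrow -sum1_card; apply: eq_bigl => a; rewrite !inE.
Qed.

Lemma attached_level k : (0 < k <= r)%N -> level (attached_partition A lam) k = lev r eigrow k.
Proof.
move=> kr; apply: level_lev attached_rows _ _ _; rewrite ?eigrow_sum //.
by apply: sort_sorted => a b; rewrite /geq leq_total.
Qed.
End Attached.

Import numFieldNormedType.Exports.

(** * Linear differential equations over the complex numbers *)

Local Open Scope classical_set_scope.

Section MatrixNorm.
Variable R : realType.
Local Notation K := R[i].
Local Notation nc := (@Normc.normc R).

Lemma normc_ge0 (x : K) : 0 <= nc x.
Proof. by case: x => a b; exact: sqrtr_ge0. Qed.

Lemma normc_eq0 (x : K) : (nc x == 0) = (x == 0).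
Proof. by apply/eqP/eqP => [/Normc.eq0_normc //|->]; exact: Normc.normc0. Qed.

Lemma normcX (x : K) n : nc (x ^+ n) = nc x ^+ n.
Proof. by elim: n => [|n IH]; rewrite ?expr0 ?Normc.normc1 // !exprS Normc.normcM IH. Qed.

Lemma normc_nat n : nc n%:R = n%:R.
Proof.
have -> : (n%:R : K) = Complex n%:R 0 by rewrite complexr0 rmorph_nat.
by rewrite /= expr0n addr0 sqrtr_sqr ger0_norm.
Qed.

Lemma normc_real (x : R) : nc (x%:C)%C = `|x|.
Proof. by rewrite /= expr0n addr0 sqrtr_sqr. Qed.

Lemma lerB_normcD (x y : K) : nc x - nc y <= nc (x + y).
Proof.
rewrite lerBlDr; have := le_normcD (x + y) (- y).
by rewrite addrK normcN.
Qed.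

Lemma normc_Re (x : K) : `|complex.Re x| <= nc x.
Proof. by rewrite -lecR; have := normc_ge_Re x. Qed.

Lemma normc_Im (x : K) : `|complex.Im x| <= nc x.
Proof.
case: x => a b /=; rewrite -sqrtr_sqr ler_wsqrtr //.
by rewrite lerDr sqr_ge0.
Qed.

Lemma normc_sum (I : Type) (s : seq I) (P : pred I) (F : I -> K) :
  nc (\sum_(i <- s | P i) F i) <= \sum_(i <- s | P i) nc (F i).
Proof.
elim/big_rec2: _ => [|i y x _ le_xy]; first by rewrite Normc.normc0.
by apply: le_trans (le_normcD _ _) _; rewrite lerD2l.
Qed.

(** The entrywise l1 norm built on [Normc.normc]: it is submultiplicative and takes real values,
    whereas the norm of [R[i]] takes values in [R[i]]. *)
Definition mnorm m n (A : 'M[K]_(m, n)) : R := \sum_i \sum_j nc (A i j).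

Lemma mnorm_ge0 m n (A : 'M[K]_(m, n)) : 0 <= mnorm A.
Proof. by do 2!apply: sumr_ge0 => ? _; exact: normc_ge0. Qed.

Lemma le_normc_mnorm m n (A : 'M[K]_(m, n)) i j : nc (A i j) <= mnorm A.
Proof.
rewrite /mnorm (bigD1 i) //= (bigD1 j) //= -addrA lerDl.
by rewrite addr_ge0 //; repeat (apply: sumr_ge0 => ? _); exact: normc_ge0.
Qed.

Lemma mnorm0 m n : mnorm (0 : 'M[K]_(m, n)) = 0.
Proof. by rewrite /mnorm big1 // => i _; rewrite big1 // => j _; rewrite mxE Normc.normc0. Qed.

Lemma mnorm_eq0 m n (A : 'M[K]_(m, n)) : mnorm A = 0 -> A = 0.
Proof.
move=> A0; apply/matrixP => i j; rewrite mxE; apply/eqP; rewrite -normc_eq0.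
by rewrite eq_le normc_ge0 -A0 le_normc_mnorm.
Qed.

Lemma mnormD m n (A B : 'M[K]_(m, n)) : mnorm (A + B) <= mnorm A + mnorm B.
Proof.
rewrite /mnorm -big_split; apply: ler_sum => i _; rewrite -big_split.
by apply: ler_sum => j _; rewrite mxE le_normcD.
Qed.

Lemma mnormN m n (A : 'M[K]_(m, n)) : mnorm (- A) = mnorm A.
Proof. by apply: eq_bigr => i _; apply: eq_bigr => j _; rewrite mxE normcN. Qed.

Lemma mnormB m n (A B : 'M[K]_(m, n)) : mnorm (A - B) <= mnorm A + mnorm B.
Proof. by rewrite -(mnormN B) mnormD. Qed.

Lemma mnormBC m n (A B : 'M[K]_(m, n)) : mnorm (A - B) = mnorm (B - A).
Proof. by rewrite -opprB mnormN. Qed.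

Lemma mnormZ m n (x : K) (A : 'M[K]_(m, n)) : mnorm (x *: A) = nc x * mnorm A.
Proof.
rewrite mulr_sumr; apply: eq_bigr => i _; rewrite mulr_sumr; apply: eq_bigr => j _.
by rewrite mxE Normc.normcM.
Qed.

Lemma mnormM m n p (A : 'M[K]_(m, n)) (B : 'M[K]_(n, p)) :
  mnorm (A *m B) <= mnorm A * mnorm B.
Proof.
rewrite /mnorm mulr_suml; apply: ler_sum => i _.
apply: (@le_trans _ _ (\sum_j \sum_k nc (A i k) * nc (B k j))).
  apply: ler_sum => j _; rewrite mxE; apply: le_trans (normc_sum _ _ _) _.
  by apply: ler_sum => k _; rewrite Normc.normcM.
rewrite exchange_big mulr_suml; apply: ler_sum => k _.
rewrite -mulr_sumr ler_wpM2l ?normc_ge0 // [leRHS](bigD1 k) //= lerDl.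
by do 2!apply: sumr_ge0 => ? _; exact: normc_ge0.
Qed.

Lemma mnorm_sum (I : Type) (s : seq I) (P : pred I) m n (F : I -> 'M[K]_(m, n)) :
  mnorm (\sum_(i <- s | P i) F i) <= \sum_(i <- s | P i) mnorm (F i).
Proof.
elim/big_rec2: _ => [|i y x _ le_xy]; first by rewrite mnorm0.
by apply: le_trans (mnormD _ _) _; rewrite lerD2l.
Qed.

Lemma mnormD3 m n (A B C : 'M[K]_(m, n)) : mnorm (A - C) <= mnorm (A - B) + mnorm (B - C).
Proof. by apply: le_trans (mnormD _ _); rewrite addrA subrK. Qed.

Definition cvm m n (u : nat -> 'M[K]_(m, n)) (l : 'M[K]_(m, n)) :=
  forall e, 0 < e -> exists N, forall k, (N <= k)%N -> mnorm (u k - l) <= e.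

Lemma cvm_unique m n (u : nat -> 'M[K]_(m, n)) l l' : cvm u l -> cvm u l' -> l = l'.
Proof.
move=> ul ul'; apply/eqP; rewrite -subr_eq0; apply/eqP/mnorm_eq0/eqP.
rewrite eq_le mnorm_ge0 andbT; apply/ler_addgt0Pl => e e0; rewrite addr0.
have e2 : 0 < e / 2 by rewrite divr_gt0.
have [N1 h1] := ul _ e2; have [N2 h2] := ul' _ e2.
have k1 := h1 (maxn N1 N2) (leq_maxl _ _); have k2 := h2 (maxn N1 N2) (leq_maxr _ _).
apply: le_trans (mnormD3 _ (u (maxn N1 N2)) _) _; rewrite (mnormBC l).
by rewrite [e]splitr lerD.
Qed.

Lemma cvm_cst m n (l : 'M[K]_(m, n)) : cvm (fun=> l) l.
Proof. by move=> e e0; exists 0%N => k _; rewrite subrr mnorm0 ltW. Qed.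

Lemma cvm_ext m n (u v : nat -> 'M[K]_(m, n)) l : u =1 v -> cvm u l -> cvm v l.
Proof. by move=> uv ul e /ul [N h]; exists N => k /h; rewrite uv. Qed.

Lemma cvmD m n (u v : nat -> 'M[K]_(m, n)) l l' :
  cvm u l -> cvm v l' -> cvm (fun k => u k + v k) (l + l').
Proof.
move=> ul vl e e0; have e2 : 0 < e / 2 by rewrite divr_gt0.
have [N1 h1] := ul _ e2; have [N2 h2] := vl _ e2.
exists (maxn N1 N2) => k; rewrite geq_max => /andP[/h1 k1 /h2 k2].
rewrite opprD addrACA; apply: le_trans (mnormD _ _) _.
by rewrite [e]splitr lerD.
Qed.

Lemma cvm_lip m n p q (f : 'M[K]_(m, n) -> 'M[K]_(p, q)) (C : R) u l :
  (forall x, mnorm (f x - f l) <= C * mnorm (x - l)) -> cvm u l -> cvm (f \o u) (f l).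
Proof.
move=> fC ul e e0; have C0 : 0 < `|C| + 1 by rewrite ltr_wpDl.
have [N h] := ul (e / (`|C| + 1)) (divr_gt0 e0 C0); exists N => k /h k1.
apply: le_trans (fC _) _; apply: (@le_trans _ _ ((`|C| + 1) * mnorm (u k - l))).
  rewrite ler_wpM2r ?mnorm_ge0 //; apply: le_trans (ler_norm C) _.
  by rewrite lerDl.
by rewrite -ler_pdivlMl // mulrC.
Qed.

Lemma cvmMl m n p (A : 'M[K]_(p, m)) (u : nat -> 'M[K]_(m, n)) l :
  cvm u l -> cvm (fun k => A *m u k) (A *m l).
Proof.
by apply: (@cvm_lip _ _ _ _ (mulmx A) (mnorm A)) => x; rewrite -mulmxBr mnormM.
Qed.

Lemma cvmMr m n p (A : 'M[K]_(n, p)) (u : nat -> 'M[K]_(m, n)) l :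
  cvm u l -> cvm (fun k => u k *m A) (l *m A).
Proof.
apply: (@cvm_lip _ _ _ _ (fun x => x *m A) (mnorm A)) => x.
by rewrite -mulmxBl mulrC mnormM.
Qed.

Lemma cvmZ m n (a : K) (u : nat -> 'M[K]_(m, n)) l :
  cvm u l -> cvm (fun k => a *: u k) (a *: l).
Proof.
by apply: (@cvm_lip _ _ _ _ ( *:%R a) (nc a)) => x; rewrite -scalerBr mnormZ.
Qed.

Lemma cvmN m n (u : nat -> 'M[K]_(m, n)) l : cvm u l -> cvm (fun k => - u k) (- l).
Proof.
move=> ul; have := cvmZ (-1) ul; rewrite scaleN1r; apply: cvm_ext => k.
by rewrite scaleN1r.
Qed.

Lemma cvm_sum m n (I : Type) (s : seq I) (u : I -> nat -> 'M[K]_(m, n)) l :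
  (forall i, cvm (u i) (l i)) -> cvm (fun k => \sum_(i <- s) u i k) (\sum_(i <- s) l i).
Proof.
move=> ul; elim: s => [|i s IH].
  by rewrite big_nil; apply: cvm_ext (cvm_cst _) => k; rewrite big_nil.
rewrite big_cons; apply: cvm_ext (cvmD (ul i) IH) => k.
by rewrite big_cons.
Qed.

Lemma cvm_shift m n (u : nat -> 'M[K]_(m, n)) l : cvm u l -> cvm (fun k => u k.+1) l.
Proof. by move=> ul e /ul [N h]; exists N => k Nk; apply: h; exact: leqW. Qed.

Lemma cvm_le m n (u : nat -> 'M[K]_(m, n)) l (C : R) :
  cvm u l -> (forall k, mnorm (u k) <= C) -> mnorm l <= C.
Proof.
move=> ul uC; apply/ler_addgt0Pl => e /ul [N h].
have := h N (leqnn _); rewrite mnormBC => h1.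
rewrite -[l](subrK (u N)); apply: le_trans (mnormD _ _) _.
by rewrite lerD.
Qed.

Lemma exp_small (q e : R) : 0 <= q < 1 -> 0 < e -> exists N, forall k, (N <= k)%N -> q ^+ k <= e.
Proof.
move=> /andP[q0 q1] e0; have : (fun n => q ^+ n) @ \oo --> (0 : R) by apply: cvg_expr; rewrite ger0_norm.
move=> /cvgrPdist_le /(_ _ e0) [N _ h]; exists N => k /h /=.
by rewrite sub0r normrN ger0_norm ?exprn_ge0.
Qed.

Lemma cvm_geom m n (u : nat -> 'M[K]_(m, n)) l (C q : R) : 0 <= q < 1 ->
  (forall k, mnorm (u k - l) <= C * q ^+ k) -> cvm u l.
Proof.
move=> q01 h e e0; have C0 : 0 < `|C| + 1 by rewrite ltr_wpDl.
have [N hN] := exp_small q01 (divr_gt0 e0 C0); exists N => k /hN hk.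
apply: le_trans (h k) _; apply: (@le_trans _ _ ((`|C| + 1) * q ^+ k)).
  case/andP: q01 => q0 _.
  rewrite ler_wpM2r ?exprn_ge0 //; apply: le_trans (ler_norm C) _.
  by rewrite lerDl.
by rewrite -ler_pdivlMl // mulrC.
Qed.

End MatrixNorm.

Local Open Scope classical_set_scope.

(** * Matrix power series convergent in the unit disc *)

Section PowerSeries.
Variable R : realType.
Local Notation K := R[i].
Local Notation nc := (@Normc.normc R).

Lemma sum_geom_le (q : R) N M : 0 <= q < 1 -> (N <= M)%N ->
  \sum_(N <= k < M) q ^+ k <= q ^+ N / (1 - q).
Proof.
move=> /andP[q0 q1] NM; rewrite ler_pdivlMr ?subr_gt0 // mulrC.
have -> : (1 - q) * \sum_(N <= k < M) q ^+ k = q ^+ N - q ^+ M.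
  rewrite -(subnKC NM); elim: (M - N)%N => [|n IH].
    by rewrite addn0 big_geq // mulr0 subrr.
  rewrite addnS big_nat_recr ?leq_addr //= mulrDr IH exprS; ring.
by rewrite lerBlDr lerDl exprn_ge0.
Qed.

Lemma real_series_geom (v : nat -> R) (C q : R) : 0 <= q < 1 ->
  (forall k, `|v k| <= C * q ^+ k) ->
  forall N, `|\sum_(0 <= k < N) v k - limn (series v)| <= C * (q ^+ N / (1 - q)).
Proof.
move=> q01 vC N; have /andP[q0 q1] := q01.
have cv : cvgn (series v).
  apply: normed_cvg; apply: (@series_le_cvg _ _ (geometric C q)) => [n|n|n|].
  - exact: normr_ge0.
  - by rewrite /geometric /=; exact: le_trans (normr_ge0 _) (vC n).
  - exact: vC.
  - by apply: is_cvg_geometric_series; rewrite ger0_norm.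
apply/ler_addgt0Pl => e e0.
move/cvgrPdist_le: cv => /(_ _ e0) [M _ hM].
have := hM (maxn M N) (leq_maxl _ _); rewrite /series /= => h1.
set L := lim _ in h1 *; set P := maxn M N in h1.
have NP : (N <= P)%N by exact: leq_maxr.
have -> : \sum_(0 <= k < N) v k - L = - (\sum_(N <= k < P) v k) - (L - \sum_(0 <= k < P) v k).
  rewrite (@big_cat_nat _ _ _ N 0 P) //=; ring.
apply: le_trans (ler_normB _ _) _; rewrite addrC normrN lerD //.
apply: le_trans (ler_norm_sum _ _ _) _; apply: (@le_trans _ _ (\sum_(N <= k < P) C * q ^+ k)).
  by apply: ler_sum => k _.
rewrite -mulr_sumr ler_wpM2l ?sum_geom_le //.
by have := le_trans (normr_ge0 _) (vC 0%N); rewrite expr0 mulr1.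
Qed.

Definition csum (u : nat -> K) : K :=
  Complex (limn (series (fun k => complex.Re (u k)))) (limn (series (fun k => complex.Im (u k)))).

Lemma Re_sum (u : nat -> K) N : complex.Re (\sum_(k < N) u k) = \sum_(0 <= k < N) complex.Re (u k).
Proof. by rewrite big_mkord (raddf_sum (@complex.Re R : Rcomplex R -> R)). Qed.

Lemma Im_sum (u : nat -> K) N : complex.Im (\sum_(k < N) u k) = \sum_(0 <= k < N) complex.Im (u k).
Proof. by rewrite big_mkord (raddf_sum (@complex.Im R : Rcomplex R -> R)). Qed.

Lemma normc_le (x : K) : nc x <= `|complex.Re x| + `|complex.Im x|.
Proof.
have -> : x = (complex.Re x)%:C%C + ('i%C * (complex.Im x)%:C%C) by exact: complexE.
apply: le_trans (le_normcD _ _) _; rewrite Normc.normcM !normc_real.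
have -> : nc 'i%C = 1 by rewrite /= expr0n expr1n add0r sqrtr1.
by rewrite mul1r; case: x => a b /=; simpc.
Qed.

Lemma csum_tail (u : nat -> K) (C q : R) : 0 <= q < 1 ->
  (forall k, nc (u k) <= C * q ^+ k) ->
  forall N, nc (\sum_(k < N) u k - csum u) <= 2 * C / (1 - q) * q ^+ N.
Proof.
move=> q01 uC N; apply: le_trans (normc_le _) _.
have E (z w : K) : complex.Re (z - w) = complex.Re z - complex.Re w /\ complex.Im (z - w) = complex.Im z - complex.Im w.
  by case: z w => [? ?] [? ?].
have [-> ->] := E (\sum_(k < N) u k) (csum u); rewrite Re_sum Im_sum /=.
have h1 := real_series_geom q01 (fun k => le_trans (normc_Re (u k)) (uC k)) N.
have h2 := real_series_geom q01 (fun k => le_trans (normc_Im (u k)) (uC k)) N.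
apply: le_trans (lerD h1 h2) _; rewrite le_eqVlt; apply/orP; left; apply/eqP; ring.
Qed.

Lemma csum0 u : (forall k, u k = 0) -> csum u = 0.
Proof.
move=> u0; have := @csum_tail u 0 0 _ _ 0%N; rewrite big_ord0 sub0r normcN lexx ltr01 => /(_ isT).
move=> h; apply/eqP; rewrite -normc_eq0 eq_le normc_ge0 andbT.
apply: le_trans (h _) _ => [k|]; first by rewrite u0 Normc.normc0 mul0r.
by rewrite mulr0 !mul0r.
Qed.

Definition mxser m n (c : nat -> 'M[K]_(m, n)) (x : K) : 'M[K]_(m, n) :=
  \matrix_(i, j) csum (fun k => x ^+ k * c k i j).
Definition psum m n (c : nat -> 'M[K]_(m, n)) (x : K) N := \sum_(k < N) x ^+ k *: c k.

Lemma psumS m n (c : nat -> 'M[K]_(m, n)) x N : psum c x N.+1 = psum c x N + x ^+ N *: c N.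
Proof. by rewrite /psum big_ord_recr. Qed.

Lemma psum0 m n (c : nat -> 'M[K]_(m, n)) x : psum c x 0 = 0.
Proof. by rewrite /psum big_ord0. Qed.

Lemma mxser_tail m n (c : nat -> 'M[K]_(m, n)) x (C q : R) : 0 <= q < 1 ->
  (forall k, nc x ^+ k * mnorm (c k) <= C * q ^+ k) ->
  forall N, mnorm (psum c x N - mxser c x) <= (m%:R * n%:R * (2 * C / (1 - q))) * q ^+ N.
Proof.
move=> q01 cC N; rewrite /mnorm.
have H i j : nc ((psum c x N - mxser c x) i j) <= 2 * C / (1 - q) * q ^+ N.
  rewrite !mxE /psum summxE.
  under eq_bigr do rewrite mxE.
  apply: csum_tail => // k; rewrite Normc.normcM normcX; apply: le_trans (cC k).
  by rewrite ler_wpM2l ?exprn_ge0 ?normc_ge0 // le_normc_mnorm.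
apply: (@le_trans _ _ (\sum_(i < m) \sum_(j < n) 2 * C / (1 - q) * q ^+ N)).
  by do 2!(apply: ler_sum => ? _).
rewrite !sumr_const !card_ord -(mulr_natl _ m) -(mulr_natl _ n) le_eqVlt; apply/orP; left; apply/eqP; ring.
Qed.

(** Growth slower than every geometric sequence of ratio above 1, which gives convergence in the
    open unit disc. Unlike a bound by one constant, it survives factors polynomial in the index,
    hence differentiation. *)
Definition tempered m n (c : nat -> 'M[K]_(m, n)) :=
  forall q : R, 1 < q -> exists C, forall k, mnorm (c k) <= C * q ^+ k.

Lemma tempered_bound m n (c : nat -> 'M[K]_(m, n)) (rho : R) : tempered c -> 0 <= rho < 1 ->
  exists C q, [/\ 0 <= C, 0 <= q < 1 & forall k, rho ^+ k * mnorm (c k) <= C * q ^+ k].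
Proof.
move=> tc /andP[r0 r1].
have q1 : 1 < 2 / (1 + rho) by rewrite ltr_pdivlMr; lra.
have [C h] := tc _ q1; exists C, (rho * (2 / (1 + rho))); split.
- by have := le_trans (mnorm_ge0 _) (h 0%N); rewrite expr0 mulr1.
- apply/andP; split; first by rewrite mulr_ge0 // divr_ge0; lra.
  by rewrite mulrA ltr_pdivrMr; lra.
- move=> k; rewrite exprMn mulrCA ler_wpM2l ?exprn_ge0 //.
Qed.

Lemma mxser_unif m n (c : nat -> 'M[K]_(m, n)) (rho : R) : tempered c -> 0 <= rho < 1 ->
  exists C q, 0 <= q < 1 /\
    forall x, nc x <= rho -> forall N, mnorm (psum c x N - mxser c x) <= C * q ^+ N.
Proof.
move=> tc r01; have [C [q [C0 q01 h]]] := tempered_bound tc r01.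
exists (m%:R * n%:R * (2 * C / (1 - q))), q; split => // x xr N.
apply: mxser_tail => // k; apply: le_trans (h k).
by rewrite ler_wpM2r ?mnorm_ge0 // lerXn2r // ?nnegrE ?normc_ge0 //; case/andP: r01.
Qed.

Lemma mxser_cvm m n (c : nat -> 'M[K]_(m, n)) x : tempered c -> nc x < 1 ->
  cvm (psum c x) (mxser c x).
Proof.
move=> tc x1; have [|C [q [q01 h]]] := @mxser_unif _ _ c (nc x) tc; first by rewrite normc_ge0.
by apply: (@cvm_geom _ _ _ _ _ C q) => // k; exact: h.
Qed.

Lemma bernoulli_nat (t : R) k : 1 < t -> k.+1%:R <= (1 + (t - 1)^-1) * t ^+ k.
Proof.
move=> t1; have h : 1 + k%:R * (t - 1) <= t ^+ k.
  elim: k => [|k IH]; first by rewrite mul0r addr0 expr0.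
  rewrite exprS; apply: (@le_trans _ _ (t * (1 + k%:R * (t - 1)))); last by rewrite ler_wpM2l //; lra.
  rewrite -natr1 -subr_ge0; have k0 : 0 <= k%:R :> R by [].
  have -> : t * (1 + k%:R * (t - 1)) - (1 + (k%:R + 1) * (t - 1)) = k%:R * (t - 1) ^+ 2 by ring.
  by rewrite mulr_ge0 ?sqr_ge0.
have t0 : 0 < t - 1 by rewrite subr_gt0.
apply: (@le_trans _ _ ((1 + (t - 1)^-1) * (1 + k%:R * (t - 1)))).
  have -> : (1 + (t - 1)^-1) * (1 + k%:R * (t - 1)) = 1 + k%:R * (t - 1) + (t - 1)^-1 + k%:R.
    by field; rewrite gt_eqF.
  rewrite -natr1.
  have : 0 <= k%:R * (t - 1) :> R by rewrite mulr_ge0 // ltW.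
  have : 0 <= (t - 1)^-1 by rewrite invr_ge0 ltW.
  lra.
by rewrite ler_wpM2l // addr_ge0 // invr_ge0 ltW.
Qed.

(** The margin in [q] is shared: [q] is the product of [t] and [q / t] with [t = (1 + q) / 2], and
    the powers of [q / t] absorb the factor [k.+1]. *)
Lemma tempered_natM m n (c d : nat -> 'M[K]_(m, n)) :
  (forall q, 1 < q -> exists C, forall k, mnorm (d k) <= k.+1%:R * (C * q ^+ k)) -> tempered d.
Proof.
move=> h q q1; have t1 : 1 < (1 + q) / 2 by lra.
have s1 : 1 < q / ((1 + q) / 2) by rewrite ltr_pdivlMr; lra.
have [C hC] := h _ t1; exists ((1 + (q / ((1 + q) / 2) - 1)^-1) * C) => k.
apply: le_trans (hC k) _.
have C0 : 0 <= C.
  by have := le_trans (mnorm_ge0 _) (hC 0%N); rewrite expr0 mulr1 mul1r.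
apply: (@le_trans _ _ ((1 + (q / ((1 + q) / 2) - 1)^-1) * (q / ((1 + q) / 2)) ^+ k * (C * ((1 + q) / 2) ^+ k))).
  rewrite ler_wpM2r ?bernoulli_nat // mulr_ge0 // exprn_ge0 //; lra.
rewrite expr_div_n le_eqVlt; apply/orP; left; apply/eqP.
have : ((1 + q) / 2) ^+ k != 0 by rewrite expf_neq0 //; lra.
move=> nz; field; rewrite ?nz //.
all: by rewrite ?gt_eqF //; lra.
Qed.

Definition dcoef m n (c : nat -> 'M[K]_(m, n)) k := k.+1%:R *: c k.+1.

Lemma tempered_dcoef m n (c : nat -> 'M[K]_(m, n)) : tempered c -> tempered (dcoef c).
Proof.
move=> tc; apply: (tempered_natM c) => q q1; have [C h] := tc _ q1.
exists (C * q) => k; rewrite mnormZ normc_nat ler_wpM2l //.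
by apply: le_trans (h _) _; rewrite exprS mulrA.
Qed.

Lemma expr_taylor (x y : K) (rho : R) k : nc x <= rho -> nc y <= rho ->
  nc (y ^+ k.+2 - x ^+ k.+2 - k.+2%:R * x ^+ k.+1 * (y - x))
    <= 2 * (k.+2%:R * k.+1%:R * rho ^+ k) * nc (y - x) ^+ 2.
Proof.
move=> xr yr; have r0 : 0 <= rho := le_trans (normc_ge0 _) xr.
apply: (@le_trans _ _ (k.+2%:R * k.+1%:R * rho ^+ k * nc (y - x) ^+ 2)); last first.
  have : 0 <= k.+2%:R * k.+1%:R * rho ^+ k * nc (y - x) ^+ 2.
    by rewrite !mulr_ge0 ?exprn_ge0 ?normc_ge0.
  lra.
elim: k => [|k IH].
  have -> : y ^+ 2 - x ^+ 2 - 2%:R * x ^+ 1 * (y - x) = (y - x) ^+ 2 by ring.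
  rewrite normcX expr0 mulr1; have : 0 <= nc (y - x) ^+ 2 by rewrite exprn_ge0 ?normc_ge0.
  lra.
have -> : y ^+ k.+3 - x ^+ k.+3 - k.+3%:R * x ^+ k.+2 * (y - x) =
   y * (y ^+ k.+2 - x ^+ k.+2 - k.+2%:R * x ^+ k.+1 * (y - x)) + k.+2%:R * x ^+ k.+1 * (y - x) ^+ 2.
  rewrite -[k.+3%:R]natr1 !(exprS _ k.+2) !(exprS _ k.+1); ring.
apply: le_trans (le_normcD _ _) _; rewrite !Normc.normcM !normcX normc_nat.
apply: (@le_trans _ _ (rho * (k.+2%:R * k.+1%:R * rho ^+ k * nc (y - x) ^+ 2) + k.+2%:R * rho ^+ k.+1 * nc (y - x) ^+ 2)).
  apply: lerD; first by apply: ler_pM => //; rewrite normc_ge0.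
  rewrite -expr2 ler_wpM2r ?exprn_ge0 ?normc_ge0 // ler_wpM2l //.
  by rewrite lerXn2r // ?nnegrE ?normc_ge0.
have : 0 <= rho ^+ k.+1 * nc (y - x) ^+ 2 by rewrite mulr_ge0 ?exprn_ge0 ?normc_ge0.
set d := nc _ ^+ 2 => h.
have -> : rho * (k.+2%:R * k.+1%:R * rho ^+ k * d) + k.+2%:R * rho ^+ k.+1 * d =
   (k.+2%:R * k.+1%:R + k.+2%:R) * (rho ^+ k.+1 * d) by rewrite exprS; ring.
rewrite -[leRHS]mulrA ler_wpM2r // -!natrM -natrD ler_nat -[X in (_ + X <= _)%N]muln1 -mulnDr mulnC leq_mul2r; lia.
Qed.

(** Differentiability as a quadratic estimate uniform on a smaller disc, proved for partial sums and
    passed to the limit. *)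
Lemma mxser_quad m n (c : nat -> 'M[K]_(m, n)) (rho : R) : tempered c -> 0 <= rho < 1 ->
  exists C, forall x y, nc x <= rho -> nc y <= rho ->
   mnorm (mxser c y - mxser c x - (y - x) *: mxser (dcoef c) x) <= C * nc (y - x) ^+ 2.
Proof.
move=> tc r01; have td := tempered_dcoef tc; have tdd := tempered_dcoef td.
have [C [q [C0 q01 h]]] := tempered_bound tdd r01.
exists (2 * (C / (1 - q))) => x y xr yr.
have x1 : nc x < 1 by case/andP: r01 => _; exact: le_lt_trans.
have y1 : nc y < 1 by case/andP: r01 => _; exact: le_lt_trans.
have cx := cvm_shift (cvm_shift (mxser_cvm tc x1)); have cy := cvm_shift (cvm_shift (mxser_cvm tc y1)).
have cd := cvm_shift (mxser_cvm td x1).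
apply: (cvm_le (cvmD (cvmD cy (cvmN cx)) (cvmN (cvmZ (y - x) cd)))) => k.
have -> : psum c y k.+2 - psum c x k.+2 - (y - x) *: psum (dcoef c) x k.+1 =
   \sum_(i < k) (y ^+ i.+2 - x ^+ i.+2 - i.+2%:R * x ^+ i.+1 * (y - x)) *: c i.+2.
  elim: k => [|k IH].
    rewrite big_ord0 !psumS !psum0 /dcoef !expr0 !expr1 !scale1r !add0r opprD addrACA subrr add0r.
    by rewrite -scalerBl subrr.
  rewrite big_ord_recr /= -IH (psumS c y) (psumS c x) (psumS (dcoef c)) /dcoef.
  rewrite (scalerBl (_ ^+ _ - _)) (scalerBl (_ ^+ _)) scalerDr !scalerA.
  have -> : (y - x) * (x ^+ k.+1 * k.+2%:R) = k.+2%:R * x ^+ k.+1 * (y - x) by ring.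
  by rewrite !opprD [X in X + _ = _]addrACA [LHS]addrACA.
apply: le_trans (mnorm_sum _ _ _) _.
apply: (@le_trans _ _ (\sum_(i < k) 2 * (C * q ^+ i) * nc (y - x) ^+ 2)).
  apply: ler_sum => i _; rewrite mnormZ.
  apply: (@le_trans _ _ (2 * (i.+2%:R * i.+1%:R * rho ^+ i) * nc (y - x) ^+ 2 * mnorm (c i.+2))).
    by rewrite ler_wpM2r ?mnorm_ge0 // expr_taylor.
  have := h i; rewrite /dcoef !mnormZ !normc_nat => hi.
  have -> : 2 * (i.+2%:R * i.+1%:R * rho ^+ i) * nc (y - x) ^+ 2 * mnorm (c i.+2) =
     2 * (rho ^+ i * (i.+1%:R * (i.+2%:R * mnorm (c i.+2)))) * nc (y - x) ^+ 2 by ring.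
  by rewrite ler_wpM2r ?exprn_ge0 ?normc_ge0 // ler_wpM2l.
rewrite -mulr_suml ler_wpM2r ?exprn_ge0 ?normc_ge0 // -mulr_sumr ler_wpM2l //.
rewrite -mulr_sumr ler_wpM2l //; have := sum_geom_le q01 (leq0n k).
by rewrite big_mkord expr0 mul1r.
Qed.

(** Coefficients of the product of the series with [a / (a - x)], so that a simple pole enters by a
    one-term recursion instead of a convolution. *)
Fixpoint polecoef m n (a : K) (c : nat -> 'M[K]_(m, n)) k :=
  if k is k'.+1 then a^-1 *: polecoef a c k' + c k else c 0%N.

Lemma polecoef_bound m n a (c : nat -> 'M[K]_(m, n)) k : 1 <= nc a ->
  mnorm (polecoef a c k) <= \sum_(i < k.+1) mnorm (c i).
Proof.
move=> a1; elim: k => [|k IH] /=; first by rewrite big_ord1.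
rewrite big_ord_recr /=; apply: le_trans (mnormD _ _) _; rewrite lerD2r.
rewrite mnormZ Normc.normcV; apply: le_trans IH.
rewrite ler_piMl ?mnorm_ge0 // invf_le1 //; exact: lt_le_trans ltr01 a1.
Qed.

Lemma tempered_polecoef m n a (c : nat -> 'M[K]_(m, n)) : 1 <= nc a ->
  tempered c -> tempered (polecoef a c).
Proof.
move=> a1 tc; apply: (tempered_natM c) => q q1; have [C h] := tc _ q1.
exists C => k; apply: le_trans (polecoef_bound _ _ a1) _.
have C0 : 0 <= C by have := le_trans (mnorm_ge0 _) (h 0%N); rewrite expr0 mulr1.
apply: (@le_trans _ _ (\sum_(i < k.+1) C * q ^+ k)).
  apply: ler_sum => i _; apply: le_trans (h i) _; rewrite ler_wpM2l //.
  by rewrite ler_eXn2l // -ltnS.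
by rewrite sumr_const card_ord mulr_natl.
Qed.

Lemma mxser_pole m n a (c : nat -> 'M[K]_(m, n)) x : 1 <= nc a -> tempered c -> nc x < 1 ->
  (a - x) *: mxser (polecoef a c) x = a *: mxser c x.
Proof.
move=> a1 tc x1; have a0 : a != 0 by rewrite -normc_eq0 gt_eqF // (lt_le_trans ltr01).
have tp := tempered_polecoef a1 tc.
have h1 := cvmD (cvmZ a (cvm_shift (mxser_cvm tp x1))) (cvmN (cvmZ x (mxser_cvm tp x1))).
rewrite scalerBl; apply: cvm_unique h1 _; apply: cvm_ext (cvmZ a (cvm_shift (mxser_cvm tc x1))).
move=> k /=; elim: k => [|k IH]; first by rewrite !psumS !psum0 scaler0 subr0.
rewrite (psumS c) (psumS (polecoef a c) x k.+1) [psum (polecoef a c) x k.+1 in X in _ = _ - X]psumS.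
rewrite [polecoef _ _ k.+1]/= !scalerDr opprD addrACA IH !scalerA.
rewrite (_ : a * x ^+ k.+1 * a^-1 = x * x ^+ k); last by rewrite exprS; field.
by rewrite [_ *: polecoef _ _ _ + _]addrC addrK.
Qed.

End PowerSeries.

Local Close Scope classical_set_scope.
Local Open Scope ring_scope.

(** * Power series solutions of systems with simple poles *)

Section FormalODE.
Variable R : realType.
Local Notation K := R[i].
Local Notation nc := (@Normc.normc R).

Lemma mxser0 m n (c : nat -> 'M[K]_(m, n)) : mxser c 0 = c 0%N.
Proof.
have := @mxser_tail R m n c 0 (mnorm (c 0%N)) 0 _ _ 1%N.
rewrite lexx ltr01 expr1 mulr0 => /(_ isT) h.
have {}h : mnorm (psum c 0 1 - mxser c 0) <= 0.
  apply: h => k; rewrite Normc.normc0; case: k => [|k]; first by rewrite !expr0 mul1r mulr1.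
  by rewrite !exprS !mul0r mulr0.
apply/eqP; rewrite eq_sym -subr_eq0; apply/eqP/mnorm_eq0/eqP; rewrite eq_le mnorm_ge0 andbT.
by move: h; rewrite psumS psum0 add0r expr0 scale1r.
Qed.

Lemma mxser_sumM m n p (I : finType) (B : I -> 'M[K]_(p, m)) (c : I -> nat -> 'M[K]_(m, n)) x :
  (forall l, tempered (c l)) -> nc x < 1 ->
  cvm (psum (fun k => \sum_l B l *m c l k) x) (\sum_l B l *m mxser (c l) x).
Proof.
move=> tc x1; apply: cvm_ext (cvm_sum _ (fun l => cvmMl (B l) (mxser_cvm (tc l) x1))) => k.
rewrite /psum; under eq_bigr do rewrite mulmx_sumr.
rewrite exchange_big; apply: eq_bigr => i _; rewrite scaler_sumr.
by apply: eq_bigr => l _; rewrite scalemxAr.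
Qed.

Section Recursion.
Variables (r : nat) (I : finType) (a : I -> K) (B : I -> 'M[K]_r) (L : nat -> 'M[K]_r -> 'M[K]_r).

(** The next coefficient depends on all earlier ones through [polecoef]; carrying these values in
    the state makes the recursion structural. In the applications [L k] inverts the operator that
    acts on the coefficient of index [k]. *)
Fixpoint ode_state k : 'M[K]_r * (I -> 'M[K]_r) :=
  if k is k'.+1 then
    let h := L k (\sum_l B l *m (ode_state k').2 l) in
    (h, fun l => (a l)^-1 *: (ode_state k').2 l + h)
  else (1%:M, fun=> 1%:M).

Definition ode_coef k := (ode_state k).1.

Lemma ode_state2 k l : (ode_state k).2 l = polecoef (a l) ode_coef k.
Proof. by elim: k => [|k IH] //=; rewrite -IH. Qed.

Lemma ode_coefS k : ode_coef k.+1 = L k.+1 (\sum_l B l *m polecoef (a l) ode_coef k).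
Proof. by rewrite {1}/ode_coef /=; congr L; apply: eq_bigr => l _; rewrite ode_state2. Qed.

(** The partial sums of norms grow at step [k] by a factor [1 + O(1 / k)], hence eventually by a
    factor below any given [q > 1]. *)
Lemma tempered_ode (M : R) : 0 <= M -> (forall l, 1 <= nc (a l)) ->
  (forall k X, mnorm (L k.+1 X) <= M / k.+1%:R * mnorm X) -> tempered ode_coef.
Proof.
move=> M0 a1 LM q q1.
pose s k := \sum_(i < k.+1) mnorm (ode_coef i).
pose b := \sum_l mnorm (B l).
have s0 k : 0 <= s k by apply: sumr_ge0 => i _; exact: mnorm_ge0.
have b0 : 0 <= b by apply: sumr_ge0 => i _; exact: mnorm_ge0.
have sS k : s k.+1 <= (1 + M * b / k.+1%:R) * s k.
  rewrite /s big_ord_recr /= -/(s k) mulrDl mul1r lerD2l ode_coefS.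
  apply: le_trans (LM _ _) _; apply: (@le_trans _ _ (M / k.+1%:R * (b * s k))).
    rewrite ler_wpM2l ?divr_ge0 //; apply: le_trans (mnorm_sum _ _ _) _.
    rewrite mulr_suml; apply: ler_sum => l _.
    apply: le_trans (mnormM _ _) _; rewrite ler_wpM2l ?mnorm_ge0 //.
    exact: polecoef_bound.
  by rewrite le_eqVlt; apply/orP; left; apply/eqP; ring.
have smono i j : (i <= j)%N -> s i <= s j.
  move=> /subnKC <-; elim: (j - i)%N => [|d IH]; first by rewrite addn0.
  by apply: (le_trans IH); rewrite addnS /s [in leRHS]big_ord_recr /= lerDl mnorm_ge0.
pose k0 := Num.bound (M * b / (q - 1)).
have q10 : 0 < q - 1 by rewrite subr_gt0.
have hk k : (k0 <= k)%N -> M * b / k.+1%:R <= q - 1.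
  move=> kk; rewrite ler_pdivrMr ?ltr0n // -ler_pdivrMl // [X in X <= _]mulrC.
  have := archi_boundP (divr_ge0 (mulr_ge0 M0 b0) (ltW q10)); rewrite -/k0 => /ltW h.
  by apply: (le_trans h); rewrite ler_nat ltnW.
have q0 : 0 <= q by apply: ltW; apply: lt_trans q1.
have main k : s (k0 + k)%N <= s k0 * q ^+ k.
  elim: k => [|k IH]; first by rewrite addn0 mulr1.
  rewrite addnS; apply: le_trans (sS _) _.
  rewrite exprSr mulrA mulrC; apply: ler_pM => //.
    by rewrite addr_ge0 // divr_ge0 // mulr_ge0.
  by rewrite -lerBrDl; exact: hk (leq_addr k k0).
have hc k : mnorm (ode_coef k) <= s k.
  by rewrite /s big_ord_recr /= lerDr; apply: sumr_ge0 => i _; exact: mnorm_ge0.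
exists (s k0) => k; apply: le_trans (hc k) _.
case: (leqP k k0) => [kk|/ltnW kk].
  apply: le_trans (smono _ _ kk) _; rewrite ler_peMr //.
  by rewrite exprn_ege1 // ltW.
have := main (k - k0)%N; rewrite subnKC // => h; apply: le_trans h _.
by rewrite ler_wpM2l // ler_weXn2l ?leq_subr // ltW.
Qed.
End Recursion.

Lemma pole_neq (x a : K) : nc x < 1 -> 1 <= nc a -> x - a != 0.
Proof. by move=> x1 a1; rewrite subr_eq0; apply: contraTneq x1 => ->; rewrite -leNgt. Qed.

Lemma mxser_poleE m n a (c : nat -> 'M[K]_(m, n)) x : 1 <= nc a -> tempered c -> nc x < 1 ->
  mxser (polecoef a c) x = - (a / (x - a)) *: mxser c x.
Proof.
move=> a1 tc x1; have xa := pole_neq x1 a1.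
apply: (scalerI (a := a - x)); first by rewrite -opprB oppr_eq0.
rewrite mxser_pole // scalerA; congr (_ *: _); field.
by rewrite xa.
Qed.

Definition regL r (k : nat) (X : 'M[K]_r) := k%:R^-1 *: X.

(** The last clause propagates linear constraints, such as a pattern of zeros, from the residues to
    all coefficients. *)
Lemma ode_regular r (I : finType) (a : I -> K) (A : I -> 'M[K]_r) :
  (forall l, 1 <= nc (a l)) ->
  exists c : nat -> 'M[K]_r, [/\ tempered c, c 0%N = 1%:M,
    forall x, nc x < 1 -> mxser (dcoef c) x = (\sum_l (x - a l)^-1 *: A l) *m mxser c x &
    forall P : 'M[K]_r -> Prop, P 1%:M -> (forall X Y, P X -> P Y -> P (X + Y)) ->
      (forall z X, P X -> P (z *: X)) -> (forall l X, P X -> P (A l *m X)) ->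
      forall k, P (c k)].
Proof.
move=> a1; pose B l := - (a l)^-1 *: A l.
pose c := ode_coef a B (@regL r).
have tc : tempered c.
  apply: (@tempered_ode _ _ _ _ _ 1) => // k X; rewrite /regL mnormZ Normc.normcV normc_nat.
  by rewrite mul1r.
exists c; split => // [x x1|P P1 PD PZ PA k]; last first.
  suff [] : P (c k) /\ forall l, P ((ode_state a B (@regL r) k).2 l) by [].
  elim: k => [|k [IH1 IH2]]; first by split.
  have P' : P (c k.+1).
    rewrite /c /ode_coef /= /regL; apply: (PZ); elim/big_ind: _ => [||l _].
    - by rewrite -(scale0r 1%:M); exact: PZ.
    - exact: PD.
    - by rewrite /B -scalemxAl; apply: (PZ); exact: PA.
  by split=> // l; apply: (PD) => //; exact: PZ.
have tp l := tempered_polecoef (a1 l) tc.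
apply: cvm_unique (mxser_cvm (tempered_dcoef tc) x1) _.
have := mxser_sumM (fun l => B l) tp x1.
have -> : \sum_l B l *m mxser (polecoef (a l) c) x = (\sum_l (x - a l)^-1 *: A l) *m mxser c x.
  rewrite mulmx_suml; apply: eq_bigr => l _.
  rewrite (mxser_poleE (a1 l) tc x1) -scalemxAr -!scalemxAl scalerA; congr (_ *: _).
  have := pole_neq x1 (a1 l) => xa.
  have a0 : a l != 0 by rewrite -normc_eq0 gt_eqF // (lt_le_trans ltr01).
  by field; rewrite xa.
apply: cvm_ext => k; rewrite /psum; apply: eq_bigr => i _; congr (_ *: _).
rewrite /dcoef /c ode_coefS /regL scalerA mulfV ?scale1r // pnatr_eq0 //.
Qed.

(** The series is a gauge transformation to the Euler system with residue [A0] alone. Its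
    coefficient of index [k] solves an equation with operator [k - ad A0], invertible by the
    non-resonance hypothesis. *)
Lemma ode_singular r (I : finType) (a : I -> K) (A : I -> 'M[K]_r) (A0 : 'M[K]_r) :
  (forall l, 1 <= nc (a l)) ->
  (forall k X, (0 < k)%N -> k%:R *: X = A0 *m X - X *m A0 -> X = 0) ->
  exists c : nat -> 'M[K]_r, [/\ tempered c, c 0%N = 1%:M &
    forall x, nc x < 1 -> x *: mxser (dcoef c) x =
       (A0 + x *: \sum_l (x - a l)^-1 *: A l) *m mxser c x - mxser c x *m A0].
Proof.
move=> a1 nonres; pose B l := - (a l)^-1 *: A l.
pose T k : 'M[K]_(r * r) := k%:R%:M - (lin_mx (mulmx A0) - lin_mx (mulmxr A0)).
have TE k X : mxvec X *m T k = mxvec (k%:R *: X - (A0 *m X - X *m A0)).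
  by rewrite !mulmxBr mul_mx_scalar !mul_vec_lin /= !linearB /= linearZ.
have Tu k : (0 < k)%N -> T k \in unitmx.
  move=> k0; rewrite -row_free_unit -kermx_eq0; apply/rowV0P => v /sub_kermxP.
  rewrite -[v]vec_mxK TE => /eqP; rewrite (can2_eq mxvecK vec_mxK) linear0 subr_eq0 => /eqP.
  by move/(nonres _ _ k0) => ->; rewrite linear0.
pose L k : 'M[K]_r -> 'M[K]_r := vec_mx \o mulmxr (invmx (T k)) \o mxvec.
have TL k X : (0 < k)%N -> k%:R *: L k X - (A0 *m L k X - L k X *m A0) = X.
  move=> k0; apply: (can_inj mxvecK); rewrite -TE /L /= vec_mxK -mulmxA mulVmx ?mulmx1 //.
  exact: Tu.
pose N k := \sum_i \sum_j mnorm (L k (delta_mx i j)).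
have N0 k : 0 <= N k by do 2!apply: sumr_ge0 => ? _; exact: mnorm_ge0.
have LN k X : mnorm (L k X) <= N k * mnorm X.
  rewrite {1}[X]matrix_sum_delta /L !linear_sum /=.
  apply: le_trans (mnorm_sum _ _ _) _.
  rewrite /N mulr_suml; apply: ler_sum => i _; rewrite linear_sum /= mulmx_suml linear_sum /=.
  apply: le_trans (mnorm_sum _ _ _) _; rewrite mulr_suml; apply: ler_sum => j _.
  by rewrite !linearZ /= -scalemxAl linearZ mnormZ mulrC ler_wpM2l ?mnorm_ge0 // le_normc_mnorm.
(* For [k >= 4 * mnorm A0] the inverse of [k - ad A0] has norm at most [2 / k]; the finitely many
   smaller indices are absorbed by the sum in [M]. *)
pose K0 := Num.bound (4 * mnorm A0).
pose M := 2 + \sum_(k < K0.+1) k%:R * N k.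
have M0 : 0 <= \sum_(k < K0.+1) k%:R * N k by apply: sumr_ge0 => k _; rewrite mulr_ge0.
have LM k X : mnorm (L k.+1 X) <= M / k.+1%:R * mnorm X.
  rewrite -mulrA mulrCA ler_pdivlMl ?ltr0n //.
  case: (leqP k.+1 K0) => kK.
    apply: (@le_trans _ _ (k.+1%:R * N k.+1 * mnorm X)); first by rewrite -mulrA ler_wpM2l.
    rewrite ler_wpM2r ?mnorm_ge0 // /M.
    rewrite [X in _ + X](bigD1 (Ordinal (kK : k.+1 < K0.+1)%N)) //=.
    have : 0 <= \sum_(i < K0.+1 | i != Ordinal (kK : (k.+1 < K0.+1)%N)) i%:R * N i.
      by apply: sumr_ge0 => i _; rewrite mulr_ge0.
    lra.
  have h1 : 4 * mnorm A0 <= k.+1%:R.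
    have := archi_boundP (mulr_ge0 (ler0n R 4) (mnorm_ge0 A0)); rewrite -/K0 => /ltW h.
    by apply: le_trans h _; rewrite ler_nat ltnW.
  set Y := L k.+1 X; have XE : k.+1%:R *: Y = X + (A0 *m Y - Y *m A0) by rewrite -[X in X + _](TL k.+1 X) // subrK.
  have h2 : k.+1%:R * mnorm Y <= mnorm X + 2 * (mnorm A0 * mnorm Y).
    rewrite -{1}(normc_nat R) -mnormZ XE; apply: le_trans (mnormD _ _) _; rewrite lerD2l.
    apply: le_trans (mnormB _ _) _; rewrite mulr_natl mulr2n lerD ?mnormM //.
    by rewrite mulrC mnormM.
  have Y0 := mnorm_ge0 Y; have X0 := mnorm_ge0 X.
  have h3 : 4 * mnorm A0 * mnorm Y <= k.+1%:R * mnorm Y by rewrite ler_wpM2r.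
  have h4 : 0 <= (\sum_(k < K0.+1) k%:R * N k) * mnorm X by rewrite mulr_ge0.
  rewrite /M mulrDl; lra.
pose c := ode_coef a B L.
have tc : tempered c.
  by apply: (@tempered_ode _ _ _ _ _ M) => //; rewrite /M addr_ge0.
exists c; split => // x x1.
have tp l := tempered_polecoef (a1 l) tc.
have h1 := cvmZ x (mxser_sumM (fun l => B l) tp x1).
have E : \sum_l B l *m mxser (polecoef (a l) c) x = (\sum_l (x - a l)^-1 *: A l) *m mxser c x.
  rewrite mulmx_suml; apply: eq_bigr => l _.
  rewrite (mxser_poleE (a1 l) tc x1) -scalemxAr -!scalemxAl scalerA; congr (_ *: _).
  have := pole_neq x1 (a1 l) => xa.
  have a0 : a l != 0 by rewrite -normc_eq0 gt_eqF // (lt_le_trans ltr01).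
  by field; rewrite xa.
rewrite mulmxDl addrAC addrC; apply/eqP; rewrite -subr_eq; apply/eqP.
have cx := mxser_cvm tc x1.
have h2 := cvmD (cvmZ x (mxser_cvm (tempered_dcoef tc) x1))
   (cvmN (cvmD (cvmMl A0 (cvm_shift cx)) (cvmN (cvmMr A0 (cvm_shift cx))))).
rewrite E scalemxAl in h1; apply: cvm_unique h2 _.
apply: cvm_ext h1 => k /=; apply/esym; elim: k => [|k IH].
  rewrite !psumS !psum0 scaler0 !add0r expr0 scale1r.
  by rewrite [c 0%N]/(1%:M) mulmx1 mul1mx subrr oppr0.
rewrite (psumS (fun k0 : nat => \sum_l B l *m polecoef (a l) c k0)) (psumS (dcoef c)) (psumS c _ k.+1) !scalerDr -IH.
rewrite mulmxDr mulmxDl (opprD (_ *m A0)) addrACA opprD addrACA; congr (_ + _).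
rewrite -scalemxAr -scalemxAl -scalerBr [in RHS]scalerA scalerA -exprS -scalerBr; congr (_ *: _).
rewrite /dcoef /c ode_coefS -/c; set X := \sum_l _.
exact: TL.
Qed.
End FormalODE.

(** * Derivatives along segments and invertible solutions *)

Section SegmentDerivative.
Variable R : realType.
Local Notation K := R[i].
Local Notation nc := (@Normc.normc R).

Let u0 : 0 <= (0 : R) <= 1. Proof. by rewrite lexx ler01. Qed.
Let u1 : 0 <= (1 : R) <= 1. Proof. by rewrite lexx ler01. Qed.

Definition seg (a b : K) (t : R) : K := a + (t%:C)%C * (b - a).
Definition onseg (Om : K -> Prop) a b := forall t, 0 <= t <= 1 -> Om (seg a b t).

Lemma seg0 a b : seg a b 0 = a. Proof. by rewrite /seg rmorph0 mul0r addr0. Qed.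
Lemma seg1 a b : seg a b 1 = b. Proof. by rewrite /seg rmorph1 mul1r addrC subrK. Qed.

Lemma segB a b s t : seg a b t - seg a b s = ((t - s)%:C)%C * (b - a).
Proof. by rewrite /seg opprD addrACA subrr add0r -mulrBl rmorphB. Qed.

Lemma normc_segB a b s t : nc (seg a b t - seg a b s) = `|t - s| * nc (b - a).
Proof. by rewrite segB Normc.normcM normc_real. Qed.

Lemma onseg_l Om a b : onseg Om a b -> Om a.
Proof. by move=> /(_ 0 u0); rewrite seg0. Qed.
Lemma onseg_r Om a b : onseg Om a b -> Om b.
Proof. by move=> /(_ 1 u1); rewrite seg1. Qed.

Lemma onseg_sub (Om Om' : K -> Prop) a b : (forall z, Om z -> Om' z) -> onseg Om a b -> onseg Om' a b.
Proof. by move=> h ab t /ab /h. Qed.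

(* The quadratic error makes a function with zero derivative constant by mere subdivision. *)
Definition der (Om : K -> Prop) m n (f f' : K -> 'M[K]_(m, n)) :=
  forall a b, onseg Om a b -> exists C, forall s t, 0 <= s <= 1 -> 0 <= t <= 1 ->
    mnorm (f (seg a b t) - f (seg a b s) - (seg a b t - seg a b s) *: f' (seg a b s))
      <= C * (t - s) ^+ 2.

Lemma der_sub (Om Om' : K -> Prop) m n (f f' : K -> 'M[K]_(m, n)) :
  (forall z, Om' z -> Om z) -> der Om f f' -> der Om' f f'.
Proof. by move=> h d a b ab; apply: d; exact: onseg_sub ab. Qed.

Lemma der_ext (Om : K -> Prop) m n (f f' g g' : K -> 'M[K]_(m, n)) :
  (forall z, Om z -> f z = g z) -> (forall z, Om z -> f' z = g' z) -> der Om f f' -> der Om g g'.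
Proof.
move=> fg fg' d a b ab; have [C h] := d a b ab; exists C => s t s01 t01.
by rewrite -!fg -?fg' ?h //; exact: ab.
Qed.

Lemma der_cst (Om : K -> Prop) m n (A : 'M[K]_(m, n)) : der Om (fun=> A) (fun=> 0).
Proof. by move=> a b _; exists 0 => s t _ _; rewrite scaler0 !subrr mnorm0 mul0r. Qed.

(** All bounds, including the one on [f'], come from the quadratic estimate alone; no continuity is
    assumed. *)
Lemma der_lip (Om : K -> Prop) m n (f f' : K -> 'M[K]_(m, n)) a b : der Om f f' -> onseg Om a b ->
  exists L, [/\ 0 <= L, forall t, 0 <= t <= 1 -> mnorm (f (seg a b t)) <= L,
    forall t, 0 <= t <= 1 -> mnorm ((b - a) *: f' (seg a b t)) <= L &
    forall s t, 0 <= s <= 1 -> 0 <= t <= 1 -> mnorm (f (seg a b t) - f (seg a b s)) <= L * `|t - s|].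
Proof.
move=> d ab; have [C h] := d a b ab.
have C0 : 0 <= C.
  by have := h 0 1 u0 u1; rewrite subr0 expr1n mulr1; exact: le_trans (mnorm_ge0 _).
have ZE s t : mnorm ((seg a b t - seg a b s) *: f' (seg a b s)) = `|t - s| * mnorm ((b - a) *: f' (seg a b s)).
  by rewrite segB -scalerA mnormZ normc_real.
have sq s t : 0 <= s <= 1 -> 0 <= t <= 1 -> (t - s) ^+ 2 <= 1 :> R by move=> *; nra.
have n1 s t : 0 <= s <= 1 -> 0 <= t <= 1 -> `|t - s| <= 1 :> R by move=> *; rewrite ler_norml; lra.
pose M := mnorm (f a) + mnorm ((b - a) *: f' a) + C.
have bd t : 0 <= t <= 1 -> mnorm (f (seg a b t)) <= M.
  move=> t01; have h1 := h 0 t u0 t01.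
  have -> : f (seg a b t) = f (seg a b t) - f (seg a b 0) - (seg a b t - seg a b 0) *: f' (seg a b 0)
     + (f (seg a b 0) + (seg a b t - seg a b 0) *: f' (seg a b 0)).
    by rewrite -[_ - _ - _]addrA -opprD subrK.
  apply: le_trans (mnormD _ _) _; rewrite addrC /M; apply: lerD.
    apply: le_trans (mnormD _ _) _; rewrite ZE !seg0 lerD2l ler_piMl ?mnorm_ge0 //.
    exact: n1.
  apply: le_trans h1 _; rewrite ler_piMr //; exact: sq.
have M0 : 0 <= M by rewrite !addr_ge0 ?mnorm_ge0.
pose L := 4 * M + 2 * C.
have bd' t : 0 <= t <= 1 -> mnorm ((b - a) *: f' (seg a b t)) <= L.
  move=> t01; pose u : R := if t <= 1 / 2 then 1 else 0.
  have u01 : 0 <= u <= 1 by rewrite /u; case: ifP; rewrite ?lexx ?ler01.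
  have ut : 1 / 2 <= `|u - t|.
    rewrite /u; case: ifP => ht; first by rewrite ger0_norm; lra.
    by rewrite ler0_norm; lra.
  have h1 := h _ _ t01 u01; have h2 := ZE t u.
  have h3 : mnorm ((seg a b u - seg a b t) *: f' (seg a b t)) <= 2 * M + C.
    rewrite -[X in mnorm X](subKr (f (seg a b u) - f (seg a b t))) -opprB.
    rewrite mnormN; apply: le_trans (mnormB _ _) _.
    have := sq _ _ t01 u01 => h5; have := mnormB (f (seg a b u)) (f (seg a b t)).
    have := bd _ t01; have := bd _ u01; have : C * (u - t) ^+ 2 <= C by rewrite ler_piMr.
    lra.
  rewrite h2 in h3; have := mnorm_ge0 ((b - a) *: f' (seg a b t)); set X := mnorm _ in h3 * => X0.
  have : 1 / 2 * X <= `|u - t| * X by rewrite ler_wpM2r.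
  rewrite /L; lra.
exists (L + C); split=> [|t t01|t t01|s t s01 t01].
- by rewrite /L !addr_ge0 ?mulr_ge0.
- by apply: le_trans (bd t t01) _; rewrite /L; lra.
- by apply: le_trans (bd' t t01) _; rewrite lerDl.
have h1 := h _ _ s01 t01; have h2 := bd' _ s01; have h3 := ZE s t.
rewrite -[X in mnorm X](subrK ((seg a b t - seg a b s) *: f' (seg a b s))).
apply: le_trans (mnormD _ _) _; rewrite h3 mulrDl addrC; apply: lerD.
  by rewrite mulrC ler_wpM2r.
apply: le_trans h1 _; rewrite ler_wpM2l // -real_normK ?num_real // expr2 ler_piMr //.
exact: n1.
Qed.

Lemma zmod_leibniz (V : zmodType) (A B C x y z : V) :
  (A - B - x) + (B - C - z) + (x - y) = A - C - (y + z).
Proof.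
rewrite [X in X + (x - y)]addrACA subrKA -addrA; congr (_ + _).
by rewrite addrACA addNr add0r opprD addrC.
Qed.

Lemma derM (Om : K -> Prop) m n p (f f' : K -> 'M[K]_(m, n)) (g g' : K -> 'M[K]_(n, p)) :
  der Om f f' -> der Om g g' ->
  der Om (fun z => f z *m g z) (fun z => f' z *m g z + f z *m g' z).
Proof.
move=> df dg a b ab; have [Cf hf] := df a b ab; have [Cg hg] := dg a b ab.
have [Lf [Lf0 f1 f2 f3]] := der_lip df ab; have [Lg [Lg0 g1 g2 g3]] := der_lip dg ab.
exists (Cf * Lg + Lf * Cg + Lf * Lg) => s t s01 t01.
have := hf s t s01 t01; have := hg s t s01 t01.
have := f1 s s01; have := g1 t t01; have := f2 s s01; have := g3 s t s01 t01.
rewrite segB -!scalerA; set D := (t - s).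
set ft := f (seg a b t); set fs := f (seg a b s); set gt := g (seg a b t); set gs := g (seg a b s).
set fd := f' _; set gd := g' _ => e1 e2 e3 e4 e5 e6.
have -> : ft *m gt - fs *m gs - (D%:C)%C *: ((b - a) *: (fd *m gs + fs *m gd)) =
   (ft - fs - (D%:C)%C *: ((b - a) *: fd)) *m gt + fs *m (gt - gs - (D%:C)%C *: ((b - a) *: gd))
   + (D%:C)%C *: (((b - a) *: fd) *m (gt - gs)).
  rewrite !mulmxBl !mulmxBr -!scalemxAl -!scalemxAr !scalerDr !scalerN.
  by rewrite zmod_leibniz opprD.
apply: le_trans (mnormD _ _) _; rewrite [leRHS]mulrDl; apply: lerD.
  apply: le_trans (mnormD _ _) _; rewrite [leRHS]mulrDl; apply: lerD.
    apply: le_trans (mnormM _ _) _; rewrite mulrAC.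
    by apply: ler_pM; rewrite ?mnorm_ge0.
  apply: le_trans (mnormM _ _) _; rewrite -mulrA.
  by apply: ler_pM; rewrite ?mnorm_ge0.
rewrite mnormZ normc_real; apply: (@le_trans _ _ (`|D| * (Lf * (Lg * `|D|)))).
  rewrite ler_wpM2l //; apply: le_trans (mnormM _ _) _.
  by apply: ler_pM; rewrite ?mnorm_ge0.
rewrite -[D ^+ 2]real_normK ?num_real // le_eqVlt; apply/orP; left; apply/eqP; ring.
Qed.

Lemma der0_const (Om : K -> Prop) m n (f : K -> 'M[K]_(m, n)) a b :
  der Om f (fun=> 0) -> onseg Om a b -> f a = f b.
Proof.
move=> d ab; have [C h] := d a b ab.
apply/eqP; rewrite eq_sym -subr_eq0; apply/eqP/mnorm_eq0/eqP; rewrite eq_le mnorm_ge0 andbT.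
have C0 : 0 <= C.
  by have := h 0 1 u0 u1; rewrite subr0 expr1n mulr1; exact: le_trans (mnorm_ge0 _).
apply/ler_addgt0Pl => e e0; rewrite addr0.
pose N := (Num.bound (C / e)).+1.
have N0 : 0 < N%:R :> R by rewrite ltr0n.
have : mnorm (f (seg a b 1) - f (seg a b 0)) <= C / N%:R.
  have -> : 1 = N%:R / N%:R :> R by rewrite divff ?gt_eqF.
  have -> : f (seg a b (N%:R / N%:R)) - f (seg a b 0) =
     \sum_(i < N) (f (seg a b (i.+1%:R / N%:R)) - f (seg a b (i%:R / N%:R))).
    rewrite -(big_mkord xpredT (fun i => f (seg a b (i.+1%:R / N%:R)) - f (seg a b (i%:R / N%:R)))).
    by rewrite telescope_sumr // mul0r.
  apply: le_trans (mnorm_sum _ _ _) _.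
  apply: (@le_trans _ _ (\sum_(i < N) C * N%:R ^- 2)).
    apply: ler_sum => i _; have ok j : (j <= N)%N -> 0 <= (j%:R / N%:R : R) <= 1.
      by move=> jN; rewrite divr_ge0 //= ler_pdivrMr // mul1r ler_nat.
    have := h _ _ (ok _ (ltnW (ltn_ord i))) (ok _ (ltn_ord i)).
    by rewrite scaler0 subr0 -mulrBl -[i.+1%:R]natr1 [_ + 1]addrC addrK mul1r exprVn.
  rewrite sumr_const card_ord -mulr_natl le_eqVlt; apply/orP; left; apply/eqP.
  by field; rewrite gt_eqF.
rewrite seg0 seg1 => h1; apply: (le_trans h1); rewrite ler_pdivrMr // mulrC -ler_pdivrMr //.
have := archi_boundP (divr_ge0 C0 (ltW e0)) => /ltW h2; apply: (le_trans h2).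
by rewrite ler_nat.
Qed.

Definition sol Om m n (f : K -> 'M[K]_(m, n)) (B : K -> 'M[K]_m) := der Om f (fun z => B z *m f z).
(** The inverse is carried along with its own adjoint equation, so that comparing two solutions
    takes only the product rule. *)
Definition isol (Om : K -> Prop) r (f : K -> 'M[K]_r) (B : K -> 'M[K]_r) :=
  sol Om f B /\ exists g, der Om g (fun z => - (g z *m B z)) /\ forall z, Om z -> g z *m f z = 1%:M.

Lemma isol_unit Om r (f B : K -> 'M[K]_r) z : isol Om f B -> Om z -> f z \in unitmx.
Proof. by move=> [_ [g [_ h]]] /h /mulmx1_unit []. Qed.

Lemma sol_isol (Om Om' : K -> Prop) r p (f B : K -> 'M[K]_r) (h : K -> 'M[K]_(r, p)) a b :
  isol Om f B -> sol Om' h B -> onseg Om a b -> onseg Om' a b ->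
  invmx (f a) *m h a = invmx (f b) *m h b.
Proof.
move=> fB hB ab ab'; have [_ [g [dg gf]]] := fB.
have invE z : Om z -> invmx (f z) = g z.
  move=> Oz; have u := isol_unit fB Oz.
  by rewrite -[LHS]mul1mx -(gf z Oz) -mulmxA mulmxV // mulmx1.
rewrite !invE; [|exact: onseg_r ab|exact: onseg_l ab].
pose Om2 z := Om z /\ Om' z.
apply: (@der0_const Om2 _ _ (fun z => g z *m h z)); last by move=> t t01; split; [exact: ab|exact: ab'].
have d1 : der Om2 g (fun z => - (g z *m B z)) by apply: der_sub dg => z [].
have d2 : der Om2 h (fun z => B z *m h z) by apply: der_sub hB => z [].
by apply: der_ext (derM d1 d2) => // z _; rewrite mulNmx mulmxA addNr.
Qed.

Lemma mxser_bound m n (c : nat -> 'M[K]_(m, n)) (rho : R) : tempered c -> 0 <= rho < 1 ->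
  exists C, forall x, nc x <= rho -> mnorm (mxser c x) <= C.
Proof.
move=> tc r01; have [C [q [_ h]]] := mxser_unif tc r01; exists C => x /h /(_ 0%N).
by rewrite psum0 sub0r mnormN expr0 mulr1.
Qed.

Lemma der_mxser_comp (Om : K -> Prop) m n (c : nat -> 'M[K]_(m, n)) (w w' : K -> K) : tempered c ->
  (forall a b, onseg Om a b -> exists rho C, 0 <= rho < 1 /\ forall s t, 0 <= s <= 1 -> 0 <= t <= 1 ->
     [/\ nc (w (seg a b t)) <= rho, nc (w (seg a b t) - w (seg a b s)) <= C * `|t - s| &
      nc (w (seg a b t) - w (seg a b s) - (seg a b t - seg a b s) * w' (seg a b s)) <= C * (t - s) ^+ 2]) ->
  der Om (fun z => mxser c (w z)) (fun z => w' z *: mxser (dcoef c) (w z)).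
Proof.
move=> tc hw a b /hw [rho [C [r01 h]]].
have [C1 h1] := mxser_quad tc r01; have [C2 h2] := mxser_bound (tempered_dcoef tc) r01.
exists (`|C1| * C ^+ 2 + C * C2) => s t s01 t01.
have [t1 t2 t3] := h s t s01 t01; have [s1 _ _] := h t s t01 s01.
have C0 : 0 <= C.
  by have [_ /(le_trans (normc_ge0 _)) + _] := h 0 1 u0 u1; rewrite subr0 normr1 mulr1.
set dw := w (seg a b t) - w (seg a b s) in t2 t3 *; set D := seg a b t - _ in t3 *.
set F' := mxser (dcoef c) _.
have -> : mxser c (w (seg a b t)) - mxser c (w (seg a b s)) - D *: (w' (seg a b s) *: F') =
  (mxser c (w (seg a b t)) - mxser c (w (seg a b s)) - dw *: F') + (dw - D * w' (seg a b s)) *: F'.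
  by rewrite (scalerBl dw) scalerA addrA subrK.
apply: le_trans (mnormD _ _) _; rewrite [leRHS]mulrDl; apply: lerD.
  apply: le_trans (h1 _ _ s1 t1) _; rewrite -/dw -mulrA -[(t - s) ^+ 2]real_normK ?num_real // -exprMn.
  apply: (@le_trans _ _ (`|C1| * nc dw ^+ 2)); first by rewrite ler_wpM2r ?exprn_ge0 ?normc_ge0 ?ler_norm.
  by rewrite ler_wpM2l // lerXn2r // ?nnegrE ?normc_ge0 ?mulr_ge0.
rewrite mnormZ mulrAC; apply: ler_pM; rewrite ?normc_ge0 ?mnorm_ge0 //.
exact: h2.
Qed.

Lemma normc_seg a b t (rho : R) : nc a <= rho -> nc b <= rho -> 0 <= t <= 1 -> nc (seg a b t) <= rho.
Proof.
move=> ar br /andP[t0 t1]; have -> : seg a b t = ((1 - t)%:C)%C * a + (t%:C)%C * b.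
  by rewrite /seg rmorphB rmorph1; ring.
apply: le_trans (le_normcD _ _) _; rewrite !Normc.normcM !normc_real !ger0_norm ?subr_ge0 //.
have : (1 - t) * nc a <= (1 - t) * rho by rewrite ler_wpM2l // subr_ge0.
have : t * nc b <= t * rho by rewrite ler_wpM2l.
lra.
Qed.

Definition disc (c : K) (rho : R) (z : K) := nc (z - c) < rho.

Lemma segBr a b c t : seg a b t - c = seg (a - c) (b - c) t.
Proof. by rewrite /seg; ring. Qed.

Lemma onseg_disc c rho a b : disc c rho a -> disc c rho b -> onseg (disc c rho) a b.
Proof.
move=> ac bc t t01; rewrite /disc segBr.
apply: (@le_lt_trans _ _ (Num.max (nc (a - c)) (nc (b - c)))).
  by apply: normc_seg => //; rewrite le_max lexx ?orbT.
by rewrite gt_max; apply/andP.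
Qed.

Lemma der_mxser_affine m n (co : nat -> 'M[K]_(m, n)) (c : K) (rho : R) : tempered co -> 0 < rho ->
  der (disc c rho) (fun z => mxser co ((z - c) / (rho%:C)%C))
     (fun z => (rho%:C)%C^-1 *: mxser (dcoef co) ((z - c) / (rho%:C)%C)).
Proof.
move=> tc rho0; have rK : (rho%:C)%C != 0 :> K by rewrite -normc_eq0 normc_real normr_eq0 gt_eqF.
have nV (x : K) : nc (x / (rho%:C)%C) = nc x / rho.
  by rewrite Normc.normcM Normc.normcV normc_real gtr0_norm.
apply: (der_mxser_comp (w := fun z => (z - c) / (rho%:C)%C) (w' := fun=> (rho%:C)%C^-1) tc) => a b ab.
have aD : nc (a - c) < rho := onseg_l ab; have bD : nc (b - c) < rho := onseg_r ab.
exists (Num.max (nc (a - c)) (nc (b - c)) / rho), (nc (b - a) / rho); split.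
  rewrite divr_ge0 ?le_max ?normc_ge0 // ?ltW //= ltr_pdivrMr // mul1r gt_max.
  exact/andP.
move=> s t s01 t01; split.
- by rewrite nV ler_pM2r ?invr_gt0 // segBr normc_seg // le_max lexx ?orbT.
- by rewrite -mulrBl opprB addrA subrK nV normc_segB -mulrA mulrC.
- rewrite -mulrBl opprB addrA subrK subrr Normc.normc0 mulr_ge0 ?sqr_ge0 //.
  by rewrite divr_ge0 ?normc_ge0 // ltW.
Qed.

(** A bounded inverse is enough: [g_t - g_s = - g_t (f_t - f_s) g_s] gives a Lipschitz bound, and
    used once more the quadratic estimate. *)
Lemma isol_bdd (Om : K -> Prop) r (f g B : K -> 'M[K]_r) : sol Om f B ->
  (forall z, Om z -> g z *m f z = 1%:M) ->
  (forall a b, onseg Om a b -> exists C, forall t, 0 <= t <= 1 -> mnorm (g (seg a b t)) <= C) ->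
  isol Om f B.
Proof.
move=> df gf gb; split; first exact: df.
exists g; split; last exact: gf.
move=> a b ab.
have [L [L0 _ L2 L3]] := der_lip df ab; have [C hC] := df a b ab; have [M hM] := gb a b ab.
have M0 : 0 <= M := le_trans (mnorm_ge0 _) (hM 0 u0).
exists (M * C * M + (M * L * M) * L * M) => s t s01 t01.
have := hC s t s01 t01; have := L3 s t s01 t01; have := L2 s s01; have := hM _ s01; have := hM _ t01.
have := mulmx1C (gf _ (ab s s01)); have := gf _ (ab t t01); rewrite !segB.
set D := (t - s); set gt := g (seg a b t); set gs := g (seg a b s); set ft := f (seg a b t).
set fs := f (seg a b s); set Bs := B _ => e1 e2 e3 e4 e5 e6 e7.
have gB : gt - gs = - (gt *m (ft - fs) *m gs).
  by rewrite mulmxBr mulmxBl e1 -mulmxA e2 mulmx1 mul1mx opprB.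
have gn : mnorm (gt - gs) <= M * L * M * `|D|.
  rewrite gB mnormN mulrAC -[M * L * _]mulrA; apply: le_trans (mnormM _ _) _.
  apply: ler_pM; rewrite ?mnorm_ge0 //; apply: le_trans (mnormM _ _) _.
  by apply: ler_pM; rewrite ?mnorm_ge0.
have -> : gt - gs - ((D%:C)%C * (b - a)) *: - (gs *m Bs) =
    - (gt *m (ft - fs - ((D%:C)%C * (b - a)) *: (Bs *m fs)) *m gs)
    - (gt - gs) *m ((D%:C)%C *: ((b - a) *: (Bs *m fs))) *m gs.
  rewrite scalerA scalerN opprK; set Y := _ *: (Bs *m fs).
  have -> : ((D%:C)%C * (b - a)) *: (gs *m Bs) = gs *m Y *m gs.
    by rewrite /Y -scalemxAr -scalemxAl -!mulmxA e2 mulmx1.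
  rewrite mulmxBr (mulmxBl _ _ gs) opprB -gB (mulmxBl gt gs) (mulmxBl _ _ gs) opprB.
  by rewrite [RHS]addrAC [X in _ = X + _]addrC subrK addrC.
apply: le_trans (mnormB _ _) _; rewrite mnormN [leRHS]mulrDl; apply: lerD.
  rewrite mulrAC; apply: le_trans (mnormM _ _) _; apply: ler_pM; rewrite ?mnorm_ge0 //.
  rewrite -mulrA; apply: le_trans (mnormM _ _) _; apply: ler_pM; rewrite ?mnorm_ge0 //.
apply: (@le_trans _ _ (M * L * M * `|D| * (`|D| * L) * M)).
  apply: le_trans (mnormM _ _) _; apply: ler_pM; rewrite ?mnorm_ge0 //.
  apply: le_trans (mnormM _ _) _; apply: ler_pM; rewrite ?mnorm_ge0 //.
  by rewrite mnormZ normc_real ler_wpM2l.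
by rewrite -[D ^+ 2]real_normK ?num_real // le_eqVlt; apply/orP; left; apply/eqP; ring.
Qed.

(** [v] solves the transposed negative system, so [v^T u] has zero derivative: the inverse of the
    solution is again given by a power series. The pattern [P] will be the set of entries that
    vanish for triangular matrices. *)
Lemma ode_series r (I : finType) (a : I -> K) (A : I -> 'M[K]_r) :
  (forall l, 1 <= nc (a l)) ->
  exists u v : nat -> 'M[K]_r, [/\ tempered u, tempered v, u 0%N = 1%:M,
    (forall x, nc x < 1 -> mxser (dcoef u) x = (\sum_l (x - a l)^-1 *: A l) *m mxser u x) /\
    (forall x, nc x < 1 -> (mxser v x)^T *m mxser u x = 1%:M) &
    forall (P : pred ('I_r * 'I_r)), (forall i, ~~ P (i, i)) ->
      (forall l i j k, P (i, k) -> A l i j != 0 -> P (j, k)) ->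
      forall x i k, P (i, k) -> mxser u x i k = 0].
Proof.
move=> a1.
have [u [tu u0' du hP]] := ode_regular A a1.
have [v [tv v0 dv _]] := ode_regular (fun l => - (A l)^T) a1.
have nD x : disc 0 1 x -> nc x < 1 by rewrite /disc subr0.
have scl (c : nat -> 'M[K]_r) : tempered c -> der (disc 0 1) (mxser c) (mxser (dcoef c)).
  move=> tc; have d := @der_mxser_affine _ _ _ 0 _ tc (@ltr01 R); apply: der_ext d => z _; rewrite subr0 rmorph1 divr1 //.
  by rewrite invr1 scale1r.
have df : der (disc 0 1) (mxser u) (fun x => (\sum_l (x - a l)^-1 *: A l) *m mxser u x).
  by apply: der_ext (scl _ tu) => // x /nD; exact: du.
have dg : der (disc 0 1) (fun x => (mxser v x)^T) (fun x => - ((mxser v x)^T *m (\sum_l (x - a l)^-1 *: A l))).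
  have trm (F : K -> 'M[K]_r) F' : der (disc 0 1) F F' -> der (disc 0 1) (fun x => (F x)^T) (fun x => (F' x)^T).
    move=> d p q pq; have [C h] := d p q pq; exists C => s t s01 t01; apply: le_trans (h s t s01 t01).
    rewrite -!linearZ /= -!linearB /= /mnorm exchange_big; under eq_bigr do under eq_bigr do rewrite mxE.
    exact: lexx.
  apply: der_ext (trm _ _ (scl _ tv)) => // x /nD xD.
  rewrite dv // trmx_mul -mulmxN; congr (_ *m _).
  rewrite linear_sum /= -sumrN; apply: eq_bigr => l _.
  by rewrite linearZ /= linearN /= trmxK scalerN.
exists u, v; split=> //.
  split=> // x x1.
  have -> : 1%:M = (mxser v 0)^T *m mxser u 0 by rewrite !mxser0 u0' v0 trmx1 mulmx1.
  apply/esym; apply: (@der0_const (disc 0 1) _ _ (fun x => (mxser v x)^T *m mxser u x)).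
    by apply: der_ext (derM dg df) => // y _; rewrite mulNmx mulmxA addNr.
  by apply: onseg_disc; rewrite /disc subr0 ?Normc.normc0.
move=> P Pii PA x i k Pik; rewrite mxE; apply: csum0 => m.
have := hP (fun X => forall i k, P (i, k) -> X i k = 0) _ _ _ _ m.
move=> -> //; first by rewrite mulr0.
- by move=> i' k' Pik'; rewrite mxE; case: eqP => // E; move: Pik'; rewrite E (negbTE (Pii _)).
- by move=> X Y hX hY i' k' Pik'; rewrite mxE hX // hY // addr0.
- by move=> w X hX i' k' Pik'; rewrite mxE hX // mulr0.
- move=> l X hX i' k' Pik'; rewrite mxE big1 // => j _.
  have [->|nz] := eqVneq (A l i' j) 0; first by rewrite mul0r.
  by rewrite (hX j k') ?mulr0 //; exact: PA Pik' nz.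
Qed.

Lemma ode_disc r (I : finType) (c : K) (rho : R) (z : I -> K) (A : I -> 'M[K]_r) : 0 < rho ->
  (forall l, rho <= nc (z l - c)) ->
  exists f : K -> 'M[K]_r, [/\ f c = 1%:M /\ exists C, forall x, nc (x - c) <= rho / 2 ->
      mnorm (f x - 1%:M - (x - c) *: \sum_l (c - z l)^-1 *: A l) <= C * nc (x - c) ^+ 2,
    isol (disc c rho) f (fun x => \sum_l (x - z l)^-1 *: A l) &
    forall (P : pred ('I_r * 'I_r)), (forall i, ~~ P (i, i)) ->
      (forall l i j k, P (i, k) -> A l i j != 0 -> P (j, k)) ->
      forall x i k, P (i, k) -> f x i k = 0].
Proof.
move=> rho0 zc; have rK : (rho%:C)%C != 0 :> K by rewrite -normc_eq0 normc_real normr_eq0 gt_eqF.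
have nV (x : K) : nc (x / (rho%:C)%C) = nc x / rho.
  by rewrite Normc.normcM Normc.normcV normc_real gtr0_norm.
pose a l := (z l - c) / (rho%:C)%C.
have a1 l : 1 <= nc (a l) by rewrite nV ler_pdivlMr // mul1r.
have x1 x : disc c rho x -> nc ((x - c) / (rho%:C)%C) < 1.
  by move=> xD; rewrite nV ltr_pdivrMr // mul1r.
have dE x l : (rho%:C)%C^-1 * ((x - c) / (rho%:C)%C - a l)^-1 = (x - z l)^-1.
  by rewrite /a -mulrBl opprB addrA subrK -invfM mulrCA mulfV // mulr1.
have [u [v [tu tv u0' [du vu] hP]]] := ode_series A a1.
exists (fun x => mxser u ((x - c) / (rho%:C)%C)); split.
- split; first by rewrite subrr mul0r mxser0.
  have h2 : 0 <= (2^-1 : R) < 1 by rewrite invr_ge0 ler0n /= invf_lt1 ?ltr1n.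
  have [C hC] := mxser_quad tu h2; exists (C / rho ^+ 2) => x xc.
  have := hC 0 ((x - c) / (rho%:C)%C); rewrite Normc.normc0 nV ler_pdivrMr // [2^-1 * _]mulrC.
  move=> /(_ _ xc); rewrite invr_ge0 ler0n => /(_ isT).
  rewrite subr0 mxser0 du ?Normc.normc0 // mxser0 u0' mulmx1 nV.
  have -> : C * (nc (x - c) / rho) ^+ 2 = C / rho ^+ 2 * nc (x - c) ^+ 2.
    by rewrite exprMn exprVn mulrA mulrAC.
  suff -> : (x - c) / (rho%:C)%C *: (\sum_l (0 - a l)^-1 *: A l) = (x - c) *: (\sum_l (c - z l)^-1 *: A l) by [].
  rewrite -scalerA scaler_sumr; congr (_ *: _); apply: eq_bigr => l _.
  by rewrite scalerA -(dE c) subrr mul0r.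
- apply: (@isol_bdd _ _ _ (fun x => (mxser v ((x - c) / (rho%:C)%C))^T)).
  + apply: der_ext (@der_mxser_affine _ _ _ c _ tu rho0) => // x xD.
    rewrite du ?x1 // scalemxAl scaler_sumr; congr (_ *m _).
    by apply: eq_bigr => l _; rewrite scalerA dE.
  + by move=> x /x1; exact: vu.
  + move=> p q pq; have pD := onseg_l pq; have qD := onseg_r pq.
    have [|C hC] := @mxser_bound _ _ v (Num.max (nc (p - c)) (nc (q - c)) / rho) tv.
      rewrite divr_ge0 ?le_max ?normc_ge0 // ?ltW //= ltr_pdivrMr // mul1r gt_max.
      exact/andP.
    exists C => t t01; have -> : mnorm (mxser v ((seg p q t - c) / (rho%:C)%C))^T = mnorm (mxser v ((seg p q t - c) / (rho%:C)%C)).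
      by rewrite /mnorm exchange_big; under eq_bigr do under eq_bigr do rewrite mxE.
    by apply: hC; rewrite nV ler_pM2r ?invr_gt0 // segBr normc_seg // le_max lexx ?orbT.
- by move=> P Pii PA x i k; exact: hP.
Qed.
End SegmentDerivative.

(** * A turn around one pole in four sectors *)

Section LocalMonodromy.
Variable R : realType.
Local Notation K := R[i].
Local Notation nc := (@Normc.normc R).
Local Notation "x %:K" := ((x%:C)%C : K) (at level 2, format "x %:K").
Local Notation iC := ('i%C : K).

Lemma der_affine (Om : K -> Prop) m n (f f' : K -> 'M[K]_(m, n)) c k : der Om f f' ->
  der (fun z => Om ((z - c) * k)) (fun z => f ((z - c) * k)) (fun z => k *: f' ((z - c) * k)).
Proof.
move=> d a b ab.
have E t : (seg a b t - c) * k = seg ((a - c) * k) ((b - c) * k) t by rewrite /seg; ring.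
have [|C h] := d ((a - c) * k) ((b - c) * k); first by move=> t /ab; rewrite E.
exists C => s t s01 t01; have := h s t s01 t01; rewrite -!E scalerA.
have -> : (seg a b t - seg a b s) * k = (seg a b t - c) * k - (seg a b s - c) * k by ring.
by [].
Qed.

Lemma isol_affine (Om : K -> Prop) r (f B : K -> 'M[K]_r) c k : isol Om f B ->
  isol (fun z => Om ((z - c) * k)) (fun z => f ((z - c) * k)) (fun z => k *: B ((z - c) * k)).
Proof.
move=> [df [g [dg gf]]]; split.
  have d := @der_affine _ _ _ _ _ c k df; rewrite /sol; apply: der_ext d => // z _.
  by rewrite scalemxAl.
exists (fun z => g ((z - c) * k)); split; last by move=> z; exact: gf.
have d := @der_affine _ _ _ _ _ c k dg; apply: der_ext d => // z _.
by rewrite scalerN scalemxAr.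
Qed.

Lemma isol_sub (Om Om' : K -> Prop) r (f B B' : K -> 'M[K]_r) :
  (forall z, Om' z -> Om z) -> (forall z, Om' z -> B z = B' z) -> isol Om f B -> isol Om' f B'.
Proof.
move=> sub BB [df [g [dg gf]]]; split.
  by have d := der_sub sub df; rewrite /sol; apply: der_ext d => // z /BB ->.
exists g; split; last by move=> z /sub; exact: gf.
by have d := der_sub sub dg; apply: der_ext d => // z /BB ->.
Qed.

Lemma mnorm_unit r (X : 'M[K]_r) : mnorm (X - 1%:M) < 1 -> X \in unitmx.
Proof.
move=> X1; rewrite -row_free_unit -kermx_eq0; apply/rowV0P => v /sub_kermxP vX.
apply: mnorm_eq0; apply/eqP; rewrite eq_le mnorm_ge0 andbT leNgt; apply/negP => v0.
have : mnorm v <= mnorm v * mnorm (X - 1%:M).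
  by apply: le_trans (mnormM _ _); rewrite mulmxBr vX mulmx1 sub0r mnormN.
by rewrite -{1}[mnorm v]mulr1 ler_pM2l // leNgt X1.
Qed.

Lemma singular_gauge r (I : finType) (z : I -> K) (A : I -> 'M[K]_r) (j : I) (rho : R) :
  0 < rho -> (forall l, l != j -> rho <= nc (z l - z j)) ->
  (forall k X, (0 < k)%N -> k%:R *: X = A j *m X - X *m A j -> X = 0) ->
  exists H H' : K -> 'M[K]_r, [/\ der (disc (z j) rho) H H', H (z j) = 1%:M &
    forall x, disc (z j) rho x -> x != z j ->
     H' x = (\sum_l (x - z l)^-1 *: A l) *m H x - (x - z j)^-1 *: (H x *m A j)].
Proof.
move=> rho0 zj nonres; have rK : rho%:K != 0 by rewrite -normc_eq0 normc_real normr_eq0 gt_eqF.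
have nV (x : K) : nc (x / rho%:K) = nc x / rho.
  by rewrite Normc.normcM Normc.normcV normc_real gtr0_norm.
pose a (l : {l | l != j}) := (z (val l) - z j) / rho%:K.
have a1 l : 1 <= nc (a l) by rewrite nV ler_pdivlMr // mul1r zj //; exact: (valP l).
have [c [tc c0 cE]] := ode_singular (fun l : {l | l != j} => A (val l)) a1 nonres.
exists (fun x => mxser c ((x - z j) / rho%:K)), (fun x => rho%:K^-1 *: mxser (dcoef c) ((x - z j) / rho%:K)).
split; first exact: der_mxser_affine.
  by rewrite subrr mul0r mxser0.
move=> x xD xj; have xj0 : x - z j != 0 by rewrite subr_eq0.
have x1 : nc ((x - z j) / rho%:K) < 1 by rewrite nV ltr_pdivrMr // mul1r.
apply: (scalerI xj0); rewrite scalerA cE //.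
rewrite scalerBr scalerA divff // scale1r; congr (_ - _); rewrite scalemxAl; congr (_ *m _).
rewrite (bigD1 j) //= scalerDr scalerA (divff xj0) scale1r; congr (_ + _).
rewrite !scaler_sumr [RHS](reindex_omap (val : {l | l != j} -> I) insub) /=; last first.
  by move=> l lj; rewrite insubT.
apply: eq_big => [l|l _]; first by rewrite (valP l) valK eqxx.
rewrite !scalerA /a -mulrBl opprB addrA subrK invf_div mulrA divfK //.
Qed.

Section Sectors.
Variables (r : nat) (M g f1 : 'M[K]_r) (f : K -> 'M[K]_r).
Hypothesis gu : g \in unitmx.
Hypothesis fM : isol (disc 1 1) f (fun x => x^-1 *: M).

(** [ptR] is [ptL] rotated by [i], and both lie in the disc of radius 1 around 1; hence the discs
    around 1 and around [i] share [ptR]. *)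
Definition ptR : K := (1 + iC) / 2%:R.
Definition ptL : K := (1 - iC) / 2%:R.
(** The quarter turn, [i^M] up to normalization: the constant relating a branch of [x^M] near 1 to
    its copy rotated by [i]. A full turn is the fourth power. *)
Definition Jmx := invmx (f ptL) *m f ptR.

Lemma ptD : disc 1 1 ptR /\ disc 1 1 ptL.
Proof.
have two : (2%:R : K) != 0 by rewrite pnatr_eq0.
have sq2 : Num.sqrt 2 / 2 < 1 :> R.
  by rewrite ltr_pdivrMr // mul1r -[X in _ < X]ger0_norm // -sqrtr_sqr ltr_sqrt //; lra.
split; rewrite /disc.
- have -> : ptR - 1 = (iC - 1) / 2%:R by rewrite /ptR; field.
  rewrite Normc.normcM Normc.normcV normc_nat; have -> : nc (iC - 1) = Num.sqrt 2; last by [].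
  by rewrite /=; congr Num.sqrt; ring.
- have -> : ptL - 1 = - (iC + 1) / 2%:R by rewrite /ptL; field.
  rewrite Normc.normcM Normc.normcV normc_nat; have -> : nc (- (iC + 1)) = Num.sqrt 2; last by [].
  by rewrite /=; congr Num.sqrt; ring.
Qed.

Lemma ptRL : ptR / iC = ptL.
Proof.
have two : (2%:R : K) != 0 by rewrite pnatr_eq0.
have i2 : iC * iC = -1 by rewrite -expr2 sqr_i.
have iV : iC^-1 = - iC.
  by apply: (mulfI (x := iC)); rewrite ?mulrN ?i2 ?opprK ?divff // eq_complex /= oner_eq0 andbF.
rewrite iV /ptR /ptL; rewrite mulrAC; congr (_ / _); rewrite mulrDl mul1r mulrN i2 opprK addrC //.
Qed.

Lemma Jmx_unit : Jmx \in unitmx.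
Proof.
have [hR hL] := ptD.
by rewrite unitmx_mul unitmx_inv (isol_unit fM hR) (isol_unit fM hL).
Qed.

Variables (p : K) (rho s : R) (H H' B : K -> 'M[K]_r).
Hypotheses (s0 : 0 < s) (s2 : 2 * s <= rho).
Hypothesis dH : der (disc p rho) H H'.
Hypothesis H1 : H p = 1%:M.
Hypothesis HE : forall x, disc p rho x -> x != p ->
  H' x = B x *m H x - (x - p)^-1 *: (H x *m (invmx g *m M *m g)).

(** A solution near [p] in direction [d]: the gauge followed by a branch of [x^M], on a disc of
    radius [s] that has [p] on its boundary. *)
Definition secY (d x : K) := H x *m (invmx g *m f ((x - p) * (s%:K * d)^-1)).
Definition secD (d : K) := disc (p + s%:K * d) s.

Lemma secD_p d x : nc d = 1 -> secD d x -> x != p /\ disc p rho x.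
Proof.
move=> d1 xD; have nd : nc (s%:K * d) = s by rewrite Normc.normcM normc_real gtr0_norm // d1 mulr1.
split; first by apply: contraTneq xD => ->; rewrite /secD /disc opprD addNKr normcN nd ltxx.
rewrite /disc; apply: lt_le_trans s2.
have -> : x - p = (x - (p + s%:K * d)) + s%:K * d by ring.
by apply: le_lt_trans (le_normcD _ _) _; rewrite nd mulr_natl mulr2n ltr_leD.
Qed.

Lemma secY_f d : nc d = 1 -> 
  isol (secD d) (fun x => f ((x - p) * (s%:K * d)^-1)) (fun x => (x - p)^-1 *: M).
Proof.
move=> d1; have nd : nc (s%:K * d) = s by rewrite Normc.normcM normc_real gtr0_norm // d1 mulr1.
have sd0 : s%:K * d != 0 by rewrite -normc_eq0 nd gt_eqF.
apply: isol_sub (@isol_affine _ _ _ _ p (s%:K * d)^-1 fM) => x xD.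
  rewrite /disc -[1](divff sd0) -mulrBl Normc.normcM Normc.normcV nd ltr_pdivrMr // mul1r.
  by rewrite -addrA -opprD.
by rewrite scalerA invf_div mulrA mulVf // mul1r.
Qed.

Lemma secY_sol d : nc d = 1 -> sol (secD d) (secY d) B.
Proof.
move=> d1; have [dF _] := secY_f d1.
have dH' : der (secD d) H H' by apply: der_sub dH => x /(secD_p d1) [].
have := derM dH' (derM (@der_cst _ (secD d) _ _ (invmx g)) dF).
apply: der_ext => // x xD; have [xp xD'] := secD_p d1 xD.
rewrite HE // mul0mx add0r mulmxBl -!mulmxA -addrA.
rewrite -[RHS]addr0; congr (_ + _).
by rewrite -!scalemxAl -!scalemxAr -!mulmxA mulKVmx // addNr.
Qed.

Lemma secY_J d : nc d = 1 -> secY d (p + s%:K * d * ptR) = secY (iC * d) (p + s%:K * d * ptR) *m Jmx.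
Proof.
move=> d1; have d0 : d != 0 by rewrite -normc_eq0 d1 oner_eq0.
have sK : s%:K != 0 by rewrite -normc_eq0 normc_real normr_eq0 gt_eqF.
have [hR hL] := ptD.
rewrite /secY addrAC subrr add0r -!mulmxA; congr (_ *m (_ *m _)).
have -> : s%:K * d * ptR / (s%:K * d) = ptR by field; rewrite d0 sK.
have -> : s%:K * d * ptR / (s%:K * (iC * d)) = ptR / iC.
  have i0 : iC != 0 by rewrite eq_complex /= oner_eq0 andbF.
  by field; rewrite ?d0 ?sK ?i0.
by rewrite ptRL /Jmx mulKVmx // (isol_unit fM hL).
Qed.

(** The gauge is known to be invertible only at [p], which lies outside the sector. A point of the
    sector near [p] is taken; [t = (L + 2)^-1] keeps the gauge at distance less than 1 from the
    identity. *)
Lemma secY_unit d : nc d = 1 -> exists x, secD d x /\ secY d x \in unitmx.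
Proof.
move=> d1; have nd : nc (s%:K * d) = s by rewrite Normc.normcM normc_real gtr0_norm // d1 mulr1.
have pp : disc p rho p by rewrite /disc subrr Normc.normc0; apply: lt_le_trans s2; rewrite mulr_gt0.
have cc : secD d (p + s%:K * d) by rewrite /secD /disc subrr Normc.normc0.
have [_ pc] := secD_p d1 cc.
have ab : onseg (disc p rho) p (p + s%:K * d) by exact: onseg_disc.
have [L [L0 _ _ hL]] := der_lip dH ab.
pose t : R := (L + 2)^-1.
have t0 : 0 < t by rewrite invr_gt0; lra.
have t1 : t <= 1 by rewrite invf_le1; lra.
have t01 : 0 <= t <= 1 by rewrite ltW.
have xE : seg p (p + s%:K * d) t - (p + s%:K * d) = - ((1 - t)%:K * (s%:K * d)).
  by rewrite /seg rmorphB rmorph1; ring.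
have xD : secD d (seg p (p + s%:K * d) t).
  rewrite /secD /disc xE normcN Normc.normcM nd normc_real ger0_norm ?subr_ge0 //.
  by rewrite gtr_pMl // gtrBl.
exists (seg p (p + s%:K * d) t); split=> //.
rewrite /secY !unitmx_mul unitmx_inv gu (isol_unit (secY_f d1) xD) /= andbT.
apply: mnorm_unit; have := hL 0 t _ t01; rewrite seg0 H1 subr0 lexx ler01 => /(_ isT) h.
apply: le_lt_trans h _; rewrite gtr0_norm // /t -ltr_pdivlMr ?invr_gt0 ?invrK ?mul1r; lra.
Qed.

Variables (Oi Oo : K -> Prop) (Fi Fo : K -> 'M[K]_r) (d : K).
Hypothesis d1 : nc d = 1.
Hypothesis Fi_sol : isol Oi Fi B.
Hypothesis Fo_sol : isol Oo Fo B.
Hypothesis Oi_conv : forall a b, Oi a -> Oi b -> onseg Oi a b.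
Hypothesis Oo_conv : forall a b, Oo a -> Oo b -> onseg Oo a b.
Hypothesis Oi_d : forall x, secD (iC * d) x -> Oi x.
Hypothesis Oo_d : forall x, secD (- (iC * d)) x -> Oo x.

Lemma sec_const (O : K -> Prop) F e : nc e = 1 -> isol O F B ->
  (forall a b, O a -> O b -> onseg O a b) ->
  (exists x, O x /\ secD e x) ->
  exists al, forall x, O x -> secD e x -> secY e x = F x *m al.
Proof.
move=> e1 FO conv [x0 [Ox0 Dx0]]; exists (invmx (F x0) *m secY e x0) => x Ox Dx.
rewrite (sol_isol FO (secY_sol e1) (conv _ _ Ox0 Ox)) ?mulKVmx //; last exact: onseg_disc.
exact: isol_unit FO Ox.
Qed.

Lemma ptR_sec e : nc e = 1 -> secD e (p + s%:K * e * ptR) /\ secD (iC * e) (p + s%:K * e * ptR).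
Proof.
move=> e1; have nd : nc (s%:K * e) = s by rewrite Normc.normcM normc_real gtr0_norm // e1 mulr1.
have [] := ptD; rewrite /disc => hR hL; have ni : nc iC = 1 by rewrite /= expr0n expr1n add0r sqrtr1.
have i0 : iC != 0 by rewrite -normc_eq0 ni oner_eq0.
split; rewrite /secD /disc.
  have -> : p + s%:K * e * ptR - (p + s%:K * e) = s%:K * e * (ptR - 1) by ring.
  by rewrite Normc.normcM nd gtr_pMr.
have -> : p + s%:K * e * ptR - (p + s%:K * (iC * e)) = s%:K * e * iC * (ptL - 1).
  by rewrite -ptRL; field.
by rewrite Normc.normcM Normc.normcM nd ni mulr1 gtr_pMr.
Qed.

(** From [d] to [- d] the inner domain [Oi] and the outer domain [Oo] lead along half turns in
    opposite senses, whence the factors [(J J)^-1] and [J J]. Comparing the two will give the full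
    turn [J^4]. *)
Lemma local_monodromy : exists al be : 'M[K]_r, [/\ al \in unitmx, be \in unitmx,
   forall x, secD d x -> (Oi x -> secY d x = Fi x *m al) /\ (Oo x -> secY d x = Fo x *m be) &
   forall x, secD (- d) x -> (Oi x -> secY (- d) x = Fi x *m (al *m invmx (Jmx *m Jmx)))
      /\ (Oo x -> secY (- d) x = Fo x *m (be *m (Jmx *m Jmx)))].
Proof.
have ni : nc iC = 1 by rewrite /= expr0n expr1n add0r sqrtr1.
have Ju := Jmx_unit.
have e1 : nc (iC * d) = 1 by rewrite Normc.normcM ni d1 mulr1.
have e2 : nc (- d) = 1 by rewrite normcN.
have e3 : nc (- (iC * d)) = 1 by rewrite normcN.
have i2 : iC * iC = -1 by rewrite -expr2 sqr_i.
have i02 : iC * (iC * d) = - d by rewrite mulrA i2 mulN1r.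
have i23 : iC * - d = - (iC * d) by rewrite mulrN.
have i30 : iC * - (iC * d) = d by rewrite mulrN i02 opprK.
have [qa qb] := ptR_sec d1; have [qc qd] := ptR_sec e1; have [qe qf] := ptR_sec e2; have [qg qh] := ptR_sec e3.
rewrite i02 in qd; rewrite i23 in qf; rewrite i30 in qh.
have [a2 ha2] := sec_const d1 Fi_sol Oi_conv (ex_intro _ _ (conj (Oi_d qb) qa)).
have [a3 ha3] := sec_const e1 Fi_sol Oi_conv (ex_intro _ _ (conj (Oi_d qb) qb)).
have [a0 ha0] := sec_const e2 Fi_sol Oi_conv (ex_intro _ _ (conj (Oi_d qc) qd)).
have [b0 hb0] := sec_const e2 Fo_sol Oo_conv (ex_intro _ _ (conj (Oo_d qf) qe)).
have [b1 hb1] := sec_const e3 Fo_sol Oo_conv (ex_intro _ _ (conj (Oo_d qf) qf)).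
have [b2 hb2] := sec_const d1 Fo_sol Oo_conv (ex_intro _ _ (conj (Oo_d qg) qh)).
have cancel (O : K -> Prop) F e x al al' : isol O F B -> O x -> secY e x = F x *m al ->
    secY e x = F x *m al' -> al = al'.
  by move=> FO Ox h h'; apply: (can_inj (mulKmx (isol_unit FO Ox))); rewrite -h.
have E23 : a2 = a3 *m Jmx.
  apply: (cancel _ _ _ _ _ _ Fi_sol (Oi_d qb) (ha2 _ (Oi_d qb) qa)).
  by rewrite secY_J // ha3 ?mulmxA // ; exact: Oi_d.
have E30 : a3 = a0 *m Jmx.
  apply: (cancel _ _ _ _ _ _ Fi_sol (Oi_d qc) (ha3 _ (Oi_d qc) qc)).
  by rewrite secY_J // i02 ha0 ?mulmxA // ; exact: Oi_d.
have E01 : b0 = b1 *m Jmx.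
  apply: (cancel _ _ _ _ _ _ Fo_sol (Oo_d qf) (hb0 _ (Oo_d qf) qe)).
  by rewrite secY_J // i23 hb1 ?mulmxA // ; exact: Oo_d.
have E12 : b1 = b2 *m Jmx.
  apply: (cancel _ _ _ _ _ _ Fo_sol (Oo_d qg) (hb1 _ (Oo_d qg) qg)).
  by rewrite secY_J // i30 hb2 ?mulmxA // ; exact: Oo_d.
have a3u : a3 \in unitmx.
  have [x [xD]] := secY_unit e1; rewrite (ha3 _ (Oi_d xD) xD) unitmx_mul; by case/andP.
have b1u : b1 \in unitmx.
  have [x [xD]] := secY_unit e3; rewrite (hb1 _ (Oo_d xD) xD) unitmx_mul; by case/andP.
exists a2, b2; split.
- by rewrite E23 unitmx_mul a3u.
- by move: b1u; rewrite E12 unitmx_mul; case/andP.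
- by move=> x xD; split=> Ox; [exact: ha2|exact: hb2].
- move=> x xD; split=> Ox.
    rewrite (ha0 _ Ox xD) E23 E30 -[a0 *m _ *m _]mulmxA mulmxK //.
    by rewrite unitmx_mul Ju.
  by rewrite (hb0 _ Ox xD) E01 E12 -(mulmxA b2).
Qed.
End Sectors.
End LocalMonodromy.

(** * Roots of unity and overlapping discs *)

Section Circle.
Variable R : realType.
Local Notation K := R[i].
Local Notation nc := (@Normc.normc R).
Local Notation "x %:K" := ((x%:C)%C : K) (at level 2, format "x %:K").
Local Notation iC := ('i%C : K).

Definition cis (t : R) : K := Complex (cos t) (sin t).

Lemma cisD a b : cis (a + b) = cis a * cis b.
Proof. by rewrite /cis cosD sinD; simpc; congr Complex; ring. Qed.

Lemma cis0 : cis 0 = 1. Proof. by rewrite /cis cos0 sin0. Qed.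

Lemma normc_cis t : nc (cis t) = 1.
Proof. by rewrite /= cos2Dsin2 sqrtr1. Qed.

Lemma normc_sqr (z : K) : nc z ^+ 2 = (complex.Re z) ^+ 2 + (complex.Im z) ^+ 2.
Proof. by case: z => a b /=; rewrite sqr_sqrtr // addr_ge0 // sqr_ge0. Qed.

Lemma normc_lt (z : K) (s : R) : 0 < s -> (complex.Re z) ^+ 2 + (complex.Im z) ^+ 2 < s ^+ 2 -> nc z < s.
Proof.
move=> s0; rewrite -normc_sqr => h; rewrite ltNge; apply: contraTN h => h.
by rewrite -leNgt lerXn2r // nnegrE ?normc_ge0 // ltW.
Qed.

Lemma cis2pi t : cis (t + pi *+ 2) = cis t.
Proof. by rewrite /cis cosD2pi sinD2pi. Qed.

Section RootsOfUnity.
Variable N : nat.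
Hypothesis N8 : (8 <= N)%N.
(** Half the angle between neighbouring roots of unity, so that [2 * sin ang] is their distance. *)
Definition ang : R := pi / N%:R.
Local Notation co := (cos ang).
Local Notation si := (sin ang).

Lemma N_gt0 : 0 < N%:R :> R.
Proof. by rewrite ltr0n (leq_trans _ N8). Qed.

Lemma angN : ang *+ N = pi.
Proof. by rewrite /ang -[LHS]mulr_natr divfK // gt_eqF // N_gt0. Qed.

Lemma ang_bounds : 0 < ang <= 1 / 2.
Proof.
rewrite /ang divr_gt0 ?pi_gt0 ?N_gt0 //= ler_pdivrMr ?N_gt0 //.
have := @pihalf_lt2 R; have : 8 <= N%:R :> R by rewrite ler_nat.
lra.
Qed.

Lemma si_gt0 : 0 < si.
Proof. by apply: sin_gt0_pi; have := ang_bounds; have := @pi_ge2 R; lra. Qed.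

Lemma sin_le (x : R) : 0 <= x -> sin x <= x.
Proof.
rewrite le_eqVlt => /orP[/eqP <-|x0]; first by rewrite sin0.
have [y _] := @MVT R sin cos 0 x x0 (fun y _ => is_derive_sin y) (continuous_subspaceT (@continuous_sin R)).
by rewrite sin0 !subr0 => ->; rewrite ler_piMl ?cos_le1 // ltW.
Qed.

Lemma co_bounds : 4 / 5 < co < 1.
Proof.
have [x0 x1] := andP ang_bounds; have s0 := si_gt0.
have s1 : si <= 1 / 2 by apply: le_trans x1; apply: sin_le; rewrite ltW.
have := cos2Dsin2 ang => cs.
have c0 : 0 < co by apply: cos_gt0_pihalf; have := @pihalf_ge1 R; lra.
by apply/andP; split; nra.
Qed.

(** Two points on the bisector between neighbouring poles. Modulus [co] gives the midpoint of the
    chord, inside the unit disc; modulus [co ^- 2] projects to [co^-1 > 1] on either pole, hence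
    lies beyond both tangents. Both belong to the disc of radius [si] with the pole on its boundary;
    the estimates rest on [co > 4 / 5], which [8 <= N] provides. *)
Lemma inner_pt t : t = co \/ t = co ^- 2 -> nc (t%:K * cis ang - 1 - iC * si%:K) < si.
Proof.
move=> tE; apply: normc_lt; first exact: si_gt0.
have -> : t%:K * cis ang - 1 - iC * si%:K = Complex (t * co - 1) (si * (t - 1)).
  by rewrite /cis; simpc; congr Complex; ring.
rewrite /=; have cs := cos2Dsin2 ang; have s0 := si_gt0; have /andP[c0 c1] := co_bounds.
rewrite exprMn; have s2 : si ^+ 2 = 1 - co ^+ 2 by rewrite -cs; ring.
rewrite s2; case: tE => ->.
  rewrite -subr_gt0; have -> : 1 - co ^+ 2 - ((co * co - 1) ^+ 2 + (1 - co ^+ 2) * (co - 1) ^+ 2) = (1 - co) * (1 + co) * (2 * co - 1).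
    ring.
  by rewrite !mulr_gt0; lra.
pose w := co^-1; have cw : co * w = 1 by rewrite divff // gt_eqF; lra.
have w0 : 0 < w by rewrite invr_gt0; lra.
have w1 : w <= 5 / 4 by nra.
rewrite -exprVn -/w (_ : w ^+ 2 * co - 1 = w * (1 - co)); last by ring: cw.
rewrite (_ : w ^+ 2 - 1 = w ^+ 2 * (1 - co ^+ 2)); last by ring: cw.
have w2 : w ^+ 2 <= 25 / 16 by nra.
have w4 : w ^+ 2 ^+ 2 <= 625 / 256 by have := sqr_ge0 w; nra.
rewrite !exprMn.
have d0 : 0 < 1 - co ^+ 2 by nra.
have d1 : 1 - co ^+ 2 <= 9 / 25 by nra.
have h1 : (1 - co) ^+ 2 <= (1 - co ^+ 2) / 9 by nra.
have h2 : (1 - co ^+ 2) ^+ 2 <= (9 / 25) ^+ 2 by nra.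
have h3 : w ^+ 2 * (1 - co) ^+ 2 <= 25 / 16 * ((1 - co ^+ 2) / 9) by apply: ler_pM; rewrite ?sqr_ge0.
have h4 : w ^+ 2 ^+ 2 * (1 - co ^+ 2) ^+ 2 <= 625 / 256 * (9 / 25) ^+ 2 by apply: ler_pM; rewrite ?sqr_ge0.
have h5 : (1 - co ^+ 2) * (w ^+ 2 ^+ 2 * (1 - co ^+ 2) ^+ 2) <= (1 - co ^+ 2) * (625 / 256 * (9 / 25) ^+ 2).
  by rewrite ler_wpM2l // ltW.
lra.
Qed.

Lemma inner_pt_conj t : t = co \/ t = co ^- 2 -> nc (t%:K * cis (- ang) - 1 + iC * si%:K) < si.
Proof.
move=> /inner_pt; congr (_ < _); rewrite /cis cosN sinN; simpc; rewrite /=.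
by congr (Num.sqrt _); ring.
Qed.

Definition zpt (j : nat) : K := cis (ang *+ (2 * j)).

Lemma zpt_norm j : nc (zpt j) = 1. Proof. exact: normc_cis. Qed.

Lemma zpt_dist1 m : (0 < m < N)%N -> 2 * si <= nc (zpt m - 1).
Proof.
move=> /andP[m0 mN]; have [x0 x1] := andP ang_bounds; have s0 := si_gt0.
rewrite -(@ler_pXn2r _ 2) ?nnegrE ?normc_ge0 //; last by rewrite mulr_ge0 // ltW.
rewrite normc_sqr /zpt /cis /=; set ph := ang *+ (2 * m).
have := cos2Dsin2 ph => cs.
have -> : (cos ph - 1) ^+ 2 + (sin ph - 0) ^+ 2 = 2 - 2 * cos ph by rewrite subr0 sin2cos2; ring.
have cs2 := cos2Dsin2 ang.
suff : cos ph <= cos (ang *+ 2).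
  by rewrite cos_mulr2n exprMn (sin2cos2 ang); lra.
have a2 := angN.
have mono a b : (1 <= a)%N -> (2 * a <= N)%N -> (a <= b)%N -> (2 * b <= N)%N -> cos (ang *+ (2 * b)) <= cos (ang *+ (2 * a)).
  move=> a1 aN ab bN; have rng k : (2 * k <= N)%N -> ang *+ (2 * k) \in `[0, pi].
    move=> kN; rewrite in_itv /=; apply/andP; split; first by apply: mulrn_wge0; exact: ltW.
    by rewrite -a2; apply: ler_wpMn2l => //; exact: ltW.
  rewrite leNgt ltr_cos ?rng // -leNgt; apply: ler_wpMn2l; first exact: ltW.
  by rewrite leq_mul2l ab.
case: (leqP (2 * m) N) => mN2; first by apply: (mono 1%N m) => //; lia.
have -> : cos ph = cos (ang *+ (2 * (N - m))).
  rewrite -[RHS]cosN -(cosD2pi (- _)); congr cos.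
  rewrite mulnBr mulrnBr ?leq_mul2l ?(ltnW mN) ?orbT // opprB.
  by rewrite (mulnC 2 N) [ang *+ (N * 2)]mulrnA a2 subrK.
apply: (mono 1%N (N - m)%N); lia.
Qed.
Lemma zpt_dist (j l : nat) : (j < N)%N -> (l < N)%N -> l != j -> 2 * si <= nc (zpt l - zpt j).
Proof.
move=> jN lN lj; have E a b : (b <= a)%N -> zpt a - zpt b = zpt b * (zpt (a - b) - 1).
  by move=> ba; rewrite mulrBr mulr1 /zpt -cisD -mulrnDr -mulnDr subnKC.
case: (ltngtP l j) lj => // h _.
  by rewrite -normcN opprB E ?(ltnW h) // Normc.normcM zpt_norm mul1r zpt_dist1 //; lia.
by rewrite E ?(ltnW h) // Normc.normcM zpt_norm mul1r zpt_dist1 //; lia.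
Qed.
End RootsOfUnity.
End Circle.

(** * The solution near infinity *)

Section OuterSolution.
Variable R : realType.
Local Notation K := R[i].
Local Notation nc := (@Normc.normc R).
Local Notation "x %:K" := ((x%:C)%C : K) (at level 2, format "x %:K").
Local Notation iC := ('i%C : K).

(** For [p] on the unit circle, the half-plane beyond the tangent at [p]: a convex piece of the
    exterior of the disc, so that segments suffice. *)
Definition half (p x : K) := 1 < complex.Re (x * conjc p).

Lemma normc_conj (p : K) : nc (conjc p) = nc p.
Proof. by case: p => a b /=; rewrite sqrrN. Qed.

Lemma half_norm p x : nc p = 1 -> complex.Re (x * conjc p) <= nc x.
Proof.
move=> p1; apply: le_trans (ler_norm _) _; apply: le_trans (normc_Re _) _.
by rewrite Normc.normcM normc_conj p1 mulr1.
Qed.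

Lemma Re_seg (a b q : K) t : complex.Re (seg a b t * q) = (1 - t) * complex.Re (a * q) + t * complex.Re (b * q).
Proof. by rewrite /seg; case: a b q => [a1 a2] [b1 b2] [q1 q2] /=; simpc => /=; ring. Qed.

Lemma half_seg p a b t : half p a -> half p b -> 0 <= t <= 1 ->
  Num.min (complex.Re (a * conjc p)) (complex.Re (b * conjc p)) <= complex.Re (seg a b t * conjc p).
Proof.
move=> ap bp /andP[t0 t1]; rewrite Re_seg; set u := complex.Re (a * _); set v := complex.Re (b * _).
have h1 : Num.min u v <= u by rewrite ge_min lexx.
have h2 : Num.min u v <= v by rewrite ge_min lexx orbT.
set m := Num.min u v in h1 h2 *.
have : t * m <= t * v by rewrite ler_wpM2l.
have : (1 - t) * m <= (1 - t) * u by rewrite ler_wpM2l // subr_ge0.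
lra.
Qed.

Lemma half_conv p a b : half p a -> half p b -> onseg (half p) a b.
Proof.
move=> ap bp t t01; rewrite /half; apply: lt_le_trans (half_seg ap bp t01).
by rewrite lt_min; apply/andP.
Qed.

(** In the variable [x^-1] the exterior becomes the unit disc, and the poles move to [(z l)^-1],
    still of modulus one. In the frame [D x] of the bundle the entry conditions make the system
    regular at infinity, where [ode_series] applies. *)
Lemma outer_solution r N (A : 'I_N -> 'M[K]_r) (z : 'I_N -> K) (c : pred 'I_r) :
  (forall l, nc (z l) = 1) ->
  (forall a b, c a = c b -> \sum_l A l a b = ((a == b) && c a)%:R) ->
  (forall a b, ~~ c a -> c b -> \sum_l A l a b = 0 /\ \sum_l z l * A l a b = 0) ->
  exists F : K -> 'M[K]_r, forall p, nc p = 1 ->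
    isol (half p) F (fun x => \sum_l (x - z l)^-1 *: A l).
Proof.
move=> z1 H1 H2.
have z0 l : z l != 0 by rewrite -normc_eq0 z1 oner_eq0.
pose k (x : K) a : K := if c a then x else 1.
pose D x : 'M[K]_r := diag_mx (\row_a k x a).
pose E0 : 'M[K]_r := diag_mx (\row_a (~~ c a)%:R); pose E1 : 'M[K]_r := diag_mx (\row_a (c a)%:R).
have DE x : D x = E0 + x *: E1.
  apply/matrixP => a b; rewrite !mxE /k; case: (c a); case: eqP => _; rewrite ?mulr1n ?mulr0n ?mulr0 ?addr0 ?add0r ?mulr1 //.
pose Ah l : 'M[K]_r := \matrix_(a, b) (A l a b * k (z l) b / k (z l) a).
have [u [v [tu tv _ [du vu] _]]] : exists u v : nat -> 'M[K]_r, [/\ tempered u, tempered v, u 0%N = 1%:M,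
    (forall x, nc x < 1 -> mxser (dcoef u) x = (\sum_l (x - (z l)^-1)^-1 *: Ah l) *m mxser u x) /\
    (forall x, nc x < 1 -> (mxser v x)^T *m mxser u x = 1%:M) & True].
  have [|u [v [h1 h2 h3 h4 _]]] := @ode_series R r 'I_N (fun l => (z l)^-1) Ah.
    by move=> l; rewrite Normc.normcV z1 invr1.
  by exists u, v.
exists (fun x => D x *m mxser u x^-1) => p p1.
have x1 x : half p x -> 1 < nc x by move=> /lt_le_trans; apply; exact: half_norm.
have xV x : half p x -> nc x^-1 < 1.
  by move=> /x1 h; rewrite Normc.normcV invf_lt1 // (lt_trans ltr01).
have x0 x : half p x -> x != 0 by move=> /x1 h; rewrite -normc_eq0 gt_eqF // (lt_trans ltr01).
have hm a b : onseg (half p) a b -> exists m, 1 < m /\ forall t, 0 <= t <= 1 -> m <= nc (seg a b t).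
  move=> ab; have ap := onseg_l ab; have bp := onseg_r ab.
  exists (Num.min (complex.Re (a * conjc p)) (complex.Re (b * conjc p))); split; first by rewrite lt_min; apply/andP.
  by move=> t t01; apply: le_trans (half_seg ap bp t01) (half_norm _ p1).
have dD : der (half p) D (fun=> E1).
  by move=> a b ab; exists 0 => s t _ _; rewrite !DE opprD addrACA subrr add0r -scalerBl subrr mnorm0 mul0r.
have dU : der (half p) (fun x => mxser u x^-1) (fun x => - x^-2 *: mxser (dcoef u) x^-1).
  apply: (der_mxser_comp (w := fun x => x^-1) (w' := fun x => - x^-2) tu) => a b ab.
  have [m [m1 hmt]] := hm _ _ ab; have m0 : 0 < m by apply: lt_trans m1.
  exists m^-1, (nc (b - a) + nc (b - a) ^+ 2); split; first by rewrite invr_ge0 ltW //= invf_lt1.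
  move=> s t s01 t01; have hs := hmt _ s01; have ht := hmt _ t01.
  have s0 := x0 _ (ab _ s01); have t0 := x0 _ (ab _ t01).
  have ns : nc (seg a b s)^-1 <= 1 by rewrite ltW // xV //; exact: ab.
  have nt : nc (seg a b t)^-1 <= 1 by rewrite ltW // xV //; exact: ab.
  have d0 : 0 <= nc (b - a) by exact: normc_ge0.
  split.
  - by rewrite Normc.normcV lef_pV2 // posrE // (lt_le_trans m0).
  - have -> : (seg a b t)^-1 - (seg a b s)^-1 = - ((seg a b t - seg a b s) * (seg a b t)^-1 * (seg a b s)^-1).
      by field; rewrite s0 t0.
    rewrite normcN !Normc.normcM normc_segB; apply: (@le_trans _ _ (`|t - s| * nc (b - a) * 1 * 1)).
      by rewrite !(ler_pM, mulr_ge0, normc_ge0).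
    by rewrite !mulr1 mulrC ler_wpM2r // lerDl exprn_ge0.
  - have -> : (seg a b t)^-1 - (seg a b s)^-1 - (seg a b t - seg a b s) * - (seg a b s) ^- 2 =
       (seg a b t - seg a b s) ^+ 2 * (seg a b t)^-1 * (seg a b s)^-1 * (seg a b s)^-1.
      by field; rewrite s0 t0.
    rewrite 3!Normc.normcM normcX normc_segB exprMn real_normK ?num_real //.
    apply: (@le_trans _ _ ((t - s) ^+ 2 * nc (b - a) ^+ 2 * 1 * 1 * 1)).
      have P (x y : R) : 0 <= x -> 0 <= y <= 1 -> 0 <= x * y <= x.
        by move=> ? /andP[? ?]; rewrite mulr_ge0 // ler_piMr.
      have Ps : 0 <= nc (seg a b s)^-1 <= 1 by rewrite normc_ge0.
      have Pt : 0 <= nc (seg a b t)^-1 <= 1 by rewrite normc_ge0.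
      have h0 : 0 <= (t - s) ^+ 2 * nc (b - a) ^+ 2 by rewrite mulr_ge0 ?sqr_ge0.
      have /andP[h1 h1'] := P _ _ h0 Pt; have /andP[h2 h2'] := P _ _ h1 Ps; have /andP[_ h3] := P _ _ h2 Ps.
      by rewrite !mulr1; apply: le_trans h3 (le_trans h2' h1').
    by rewrite !mulr1 mulrC ler_wpM2r ?sqr_ge0 // lerDr.
(* The gauge equation entry by entry. For [c a] and [c b] the residues sum to the identity; for
   [c a] alone both sides agree identically; for [c b] alone the sum and the first moment both
   vanish; for neither the sum vanishes. *)
have key x : half p x -> E1 - x^-2 *: (D x *m \sum_l (x^-1 - (z l)^-1)^-1 *: Ah l) = (\sum_l (x - z l)^-1 *: A l) *m D x.
  move=> xp; have xz l : x - z l != 0.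
    by rewrite subr_eq0; apply: contraTneq (x1 _ xp) => ->; rewrite z1 ltxx.
  have zx l : z l - x != 0 by rewrite -opprB oppr_eq0.
  have xx := x0 _ xp.
  have E1E a b : E1 a b = \sum_l (x^-2 * (k x a * ((x^-1 - (z l)^-1)^-1 * (A l a b * k (z l) b / k (z l) a)))
      + (x - z l)^-1 * A l a b * k x b).
    have sep l : x^-1 - (z l)^-1 = (z l - x) / (x * z l) by field; rewrite z0 xx.
    rewrite /k mxE mxE; case Ea: (c a); case Eb: (c b).
    - rewrite (eq_bigr (fun l => A l a b)) => [|l _]; last by rewrite sep; field; rewrite xz zx z0 xx.
      by rewrite H1 ?Ea ?Eb // andbT; case: eqP.
    - rewrite (eq_bigr (fun=> 0)) => [|l _]; last by rewrite sep; field; rewrite xz zx z0 xx.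
      by rewrite big1 //; case: eqP Eb => // <-; rewrite Ea.
    - rewrite (eq_bigr (fun l => A l a b + x^-1 * (z l * A l a b))) => [|l _]; last first.
        by rewrite sep; field; rewrite xz zx z0 xx.
      have [h1 h2] := H2 a b (negbT Ea) Eb.
      by rewrite big_split /= h1 -mulr_sumr h2 mulr0 addr0; case: eqP Eb => // <-; rewrite Ea.
    - rewrite (eq_bigr (fun l => x^-1 * A l a b)) => [|l _]; last by rewrite sep; field; rewrite xz zx z0 xx.
      by rewrite -mulr_sumr H1 ?Ea ?Eb // andbF mulr0; case: eqP.
  apply/eqP; rewrite subr_eq addrC; apply/eqP/matrixP => a b; rewrite E1E big_split /=.
  rewrite [RHS]mxE; congr (_ + _).
    rewrite mxE /D mul_diag_mx mxE summxE mxE !mulr_sumr; apply: eq_bigr => l _.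
    by rewrite !mxE.
  rewrite /D mul_mx_diag mxE summxE mxE mulr_suml; apply: eq_bigr => l _.
  by rewrite !mxE.
apply: (@isol_bdd _ _ _ _ (fun x => (mxser v x^-1)^T *m D x^-1)).
- apply: der_ext (derM dD dU) => // x xp.
  rewrite du ?xV // [RHS]mulmxA -key // mulmxBl; congr (_ + _).
  by rewrite -scalemxAr scaleNr mulmxA -scalemxAl.
- move=> x xp; rewrite mulmxA -[(_ *m D x^-1) *m D x]mulmxA.
  have -> : D x^-1 *m D x = 1%:M.
    rewrite mulmx_diag; apply/matrixP => a b; rewrite !mxE /k; case: (c a); rewrite ?mulVf ?mul1r //.
    exact: x0.
  by rewrite mulmx1 vu // xV.
- move=> a b ab; have [m [m1 hmt]] := hm _ _ ab; have m0 : 0 < m by apply: lt_trans m1.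
  have [|C hC] := @mxser_bound _ _ _ v m^-1 tv; first by rewrite invr_ge0 ltW //= invf_lt1.
  exists (C * (mnorm E0 + mnorm E1)) => t t01; apply: le_trans (mnormM _ _) _.
  have nt : nc (seg a b t)^-1 <= m^-1.
    by rewrite Normc.normcV lef_pV2 ?hmt // posrE // (lt_le_trans m0) // hmt.
  apply: ler_pM; rewrite ?mnorm_ge0 //.
    by apply: le_trans (hC _ nt); rewrite /mnorm exchange_big; under eq_bigr do under eq_bigr do rewrite mxE.
  rewrite DE; apply: le_trans (mnormD _ _) _; rewrite lerD2l mnormZ ler_piMl ?mnorm_ge0 //.
  by apply: le_trans nt _; rewrite invf_le1 // ltW.
Qed.
End OuterSolution.

Lemma mxbig_recr (F : fieldType) r k (E : 'I_k.+1 -> 'M[F]_r) :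
  \big[mulmx/1%:M]_(i < k.+1) E i = (\big[mulmx/1%:M]_(i < k) E (widen_ord (leqnSn k) i)) *m E ord_max.
Proof.
have H m (G : nat -> 'M[F]_r) : \big[mulmx/1%:M]_(0 <= i < m.+1) G i = (\big[mulmx/1%:M]_(0 <= i < m) G i) *m G m.
  rewrite /index_iota !subn0 -addn1 iotaD add0n cats1; elim: (iota 0 m) => [|x s IH] /=.
    by rewrite !unlock /= mul1mx mulmx1.
  by rewrite !big_cons IH mulmxA.
pose G i := if insub i is Some j then E j else 1%:M.
have := H k G; rewrite !big_mkord.
have -> : G k = E ord_max.
  by rewrite /G insubT //= => kk; congr E; apply: val_inj.
have -> : \big[mulmx/1%:M]_(i < k.+1) G i = \big[mulmx/1%:M]_(i < k.+1) E i.
  by apply: eq_bigr => i _; rewrite /G valK.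
move=> ->; congr (_ *m _); apply: eq_bigr => i _; rewrite /G insubT ?(leq_trans (ltn_ord i)) // => h.
by congr E; apply: val_inj.
Qed.

Lemma mx_telescope (F : fieldType) r N (E : nat -> 'M[F]_r) k : (forall k, (k <= N)%N -> E k \in unitmx) ->
  (k <= N)%N ->
  \big[mulmx/1%:M]_(i < k) (invmx (E (N - i)%N) *m E (N - i).-1) = invmx (E N) *m E (N - k)%N.
Proof.
move=> Eu; elim: k => [|k IH] kN; first by rewrite big_ord0 subn0 mulVmx // Eu.
rewrite mxbig_recr /=.
rewrite IH ?(ltnW kN) // -mulmxA mulKVmx ?Eu ?leq_subr //.
by congr (_ *m E _); lia.
Qed.

Lemma mx_cycle (F : fieldType) r N (G : 'I_N -> 'M[F]_r) (pj : 'I_N -> 'I_N) :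
  (forall l, G l \in unitmx) -> (forall l, (pj l : nat) = if (l : nat) is k.+1 then k else N.-1) ->
  \big[mulmx/1%:M]_(i < N) (invmx (G (rev_ord i)) *m G (pj (rev_ord i))) = 1%:M.
Proof.
case: N => [|N] in G pj *; first by rewrite big_ord0.
move=> Gu pjE; pose E k := if k is k'.+1 then G (inord k') else G ord_max.
have Eu k : E k \in unitmx by case: k => [|k]; exact: Gu.
have EE (l : 'I_N.+1) : invmx (G l) *m G (pj l) = invmx (E l.+1) *m E l.
  rewrite /E inord_val; congr (_ *m _); case: l (pjE l) => [[|k] kN] /= h.
    by congr G; apply: val_inj.
  by congr G; apply: val_inj; rewrite /= h inordK // ltnW.
rewrite (eq_bigr (fun i : 'I_N.+1 => invmx (E (N.+1 - i)%N) *m E (N.+1 - i).-1)); last first.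
  move=> i _; rewrite EE; have := ltn_ord i => ii.
  have -> : (rev_ord i).+1 = (N.+1 - i)%N by rewrite /=; lia.
  by have -> : (rev_ord i : nat) = (N.+1 - i).-1 by rewrite /=; lia.
rewrite (@mx_telescope _ _ N.+1) // subnn.
have -> : E N.+1 = E 0%N; last by rewrite mulVmx.
by rewrite /E; congr G; apply: val_inj; rewrite /= inordK.
Qed.

Lemma mx_shuffle (F : fieldType) r (al be X : 'M[F]_r) : be \in unitmx ->
  al *m invmx be *m (be *m X *m invmx al) = al *m X *m invmx al.
Proof. by move=> bu; rewrite -!mulmxA mulKmx. Qed.

(** * Monodromy of the system on the sphere *)

Section RiemannHilbert.
Variable R : realType.
Local Notation K := R[i].
Local Notation nc := (@Normc.normc R).
Local Notation "x %:K" := ((x%:C)%C : K) (at level 2, format "x %:K").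
Local Notation iC := ('i%C : K).

Lemma corner_transport r (B Fi Fo FL Y : K -> 'M[K]_r) (Oi Oo DL DY : K -> Prop) q q' al be :
  isol Oi Fi B -> isol Oo Fo B -> isol DL FL B -> sol DY Y B ->
  onseg DL q q' -> onseg DY q q' -> Oi q -> Oo q' ->
  Y q = Fi q *m al -> Y q' = Fo q' *m be -> al \in unitmx ->
  invmx (Fo q') *m FL q' *m invmx (FL q) *m Fi q = be *m invmx al.
Proof.
move=> hi ho hL hY cL cY Oq Oq' Yq Yq' alu.
have h := sol_isol hL hY cL cY.
apply: (can_inj (mulmxK alu)); rewrite mulmxKV // -!mulmxA -Yq h mulKVmx.
  by rewrite Yq' mulKmx // (isol_unit ho Oq').
exact: isol_unit hL (onseg_r cL).
Qed.

Lemma inv_shift r (be al J : 'M[K]_r) : al \in unitmx -> J \in unitmx ->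
  be *m (J *m J) *m invmx al = be *m J *m invmx (al *m invmx J).
Proof.
move=> alu Ju; have u : al *m invmx J \in unitmx by rewrite unitmx_mul alu unitmx_inv.
apply: (can_inj (mulmxK u)); rewrite [RHS](mulmxKV u).
by rewrite -!mulmxA (mulKmx alu) (mulmxV Ju) mulmx1.
Qed.

Lemma conj_cis p : nc p = 1 -> p * conjc p = 1.
Proof.
move=> p1; have := normc_sqr p; rewrite p1 expr1n; case: p {p1} => a b /= h.
by rewrite /conjc; simpc; apply/eqP; rewrite eq_complex /= -!expr2 -h eqxx /= [b * a]mulrC addrC subrr.
Qed.

(** Between neighbouring poles the inner solution continues to the outer one through a small disc,
    with a transition matrix [G l]. The monodromy at a pole is the quotient of the transitions on
    its two sides, so the product around the circle telescopes; [local_monodromy] shows each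
    quotient to be a fourth power up to conjugation. *)
Theorem riemann_hilbert r N (A g M : 'I_N -> 'M[K]_r) (f : 'I_N -> K -> 'M[K]_r) (c : pred 'I_r) :
  (8 <= N)%N -> (forall l, g l \in unitmx) -> (forall l, A l = invmx (g l) *m M l *m g l) ->
  (forall l k X, (0 < k)%N -> k%:R *: X = A l *m X - X *m A l -> X = 0) ->
  (forall l, isol (disc 1 1) (f l) (fun x => x^-1 *: M l)) ->
  (forall a b, c a = c b -> \sum_l A l a b = ((a == b) && c a)%:R) ->
  (forall a b, ~~ c a -> c b -> \sum_l A l a b = 0 /\ \sum_(l < N) zpt R N l * A l a b = 0) ->
  exists T : 'I_N -> 'M[K]_r,
    (forall l, exists2 al, al \in unitmx &
       T l = al *m ((Jmx (f l) *m Jmx (f l)) *m (Jmx (f l) *m Jmx (f l))) *m invmx al) /\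
    \big[mulmx/1%:M]_(i < N) T (rev_ord i) = 1%:M.
Proof.
move=> N8 gu AE nonres fM H1 H2.
pose z (l : 'I_N) := zpt R N l; pose B x := \sum_l (x - z l)^-1 *: A l.
pose s := sin (ang R N); pose co := cos (ang R N); pose w := cis (ang R N).
have s0 : 0 < s := si_gt0 R N8.
have [co0 co1] : 0 < co /\ co < 1 by have := co_bounds R N8; rewrite -/co; lra.
have s1 : s < 1.
  have := cos2Dsin2 (ang R N); rewrite -/s -/co => h; have : 0 < co ^+ 2 by rewrite exprn_gt0.
  move=> h2; rewrite ltNge; apply/negP => h3; have : 1 <= s ^+ 2 by rewrite exprn_ege1.
  lra.
have ni : nc iC = 1 by rewrite /= expr0n expr1n add0r sqrtr1.
have i2 : iC * iC = -1 by rewrite -expr2 sqr_i.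
have z1 l : nc (z l) = 1 by exact: zpt_norm.
have zd (l j : 'I_N) : l != j -> 2 * s <= nc (z l - z j) by move=> lj; apply: zpt_dist.
have [Fi [_ FiS _]] : exists f : K -> 'M[K]_r, [/\ f 0 = 1%:M, isol (disc 0 1) f B & True].
  have [|f0 [[h1 _] h2 _]] := @ode_disc R r 'I_N 0 1 z A ltr01; first by move=> l; rewrite subr0 z1.
  by exists f0.
have [Fo FoS] := @outer_solution R r N A z c z1 H1 H2.
have exL (l : 'I_N) : exists FL, isol (secD (z l) s (iC * z l)) FL B.
  have [|f0 [_ h2 _]] := @ode_disc R r 'I_N (z l + s%:K * (iC * z l)) s z A s0; last by exists f0.
  move=> j; have nd : nc (s%:K * (iC * z l)) = s by rewrite !Normc.normcM ni z1 normc_real gtr0_norm // !mulr1.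
  have [->|jl] := eqVneq j l; first by rewrite opprD addNKr normcN nd.
  have := zd _ _ jl; have := lerB_normcD (z j - z l) (- (s%:K * (iC * z l))).
  by rewrite normcN nd -addrA -opprD; lra.
have [FL FLS] := choice exL.
(* Crossing points between pole [l] and the next one, inside and outside the unit circle. *)
pose q (l : 'I_N) := co%:K * w * z l; pose q' (l : 'I_N) := (co ^- 2)%:K * w * z l.
pose G l := invmx (Fo (q' l)) *m FL l (q' l) *m invmx (FL l (q l)) *m Fi (q l).
have qi l : disc 0 1 (q l).
  by rewrite /disc subr0 !Normc.normcM z1 normc_cis normc_real ger0_norm ?mulr1 // ltW.
have coV : co ^- 2 * co = co^-1 by rewrite -exprVn expr2 -mulrA mulVf ?mulr1 // gt_eqF.
have hq' (t : R) p : nc p = 1 -> t = ang R N \/ t = - ang R N -> half p ((co ^- 2)%:K * cis t * p).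
  move=> p1 tE; rewrite /half -mulrA conj_cis // mulr1.
  have -> : complex.Re ((co ^- 2)%:K * cis t) = co ^- 2 * cos t by rewrite /cis /=; simpc.
  have -> : cos t = co by case: tE => ->; rewrite ?cosN.
  by rewrite coV invf_gt1.
have qL l t : t = co \/ t = co ^- 2 -> secD (z l) s (iC * z l) (t%:K * w * z l).
  move=> tE; rewrite /secD /disc.
  have -> : t%:K * w * z l - (z l + s%:K * (iC * z l)) = (t%:K * w - 1 - iC * s%:K) * z l by ring.
  by rewrite Normc.normcM z1 mulr1; exact: (inner_pt N8 tE).
pose jp (l : 'I_N) : nat := if (l : nat) is k.+1 then k else N.-1.
have jpN l : (jp l < N)%N by rewrite /jp; have := ltn_ord l; case: (l : nat) => [|k]; lia.
pose pj l := Ordinal (jpN l).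
have zpj l : z l = w * w * z (pj l).
  rewrite /z /zpt /w -!cisD /= /jp; have lN := ltn_ord l.
  case: (l : nat) lN => [|k] lN.
    rewrite -mulr2n -mulrnDr -{1}(cis2pi (ang R N *+ (2 * 0))) -{1}(angN R N8).
    by rewrite -mulrnA -mulrnDr; congr (cis (_ *+ _)); lia.
  by rewrite -mulr2n -mulrnDr; congr (cis (_ *+ _)); lia.
have qprev l t : t%:K * w * z (pj l) = t%:K * cis (- ang R N) * z l.
  by rewrite (zpj l) /w -!mulrA; congr (_ * _); rewrite [RHS]mulrA -cisD addNr cis0 mul1r.
have qL' l t : t = co \/ t = co ^- 2 -> secD (z l) s (- (iC * z l)) (t%:K * w * z (pj l)).
  move=> tE; rewrite /secD /disc qprev.
  have -> : t%:K * cis (- ang R N) * z l - (z l + s%:K * - (iC * z l)) = (t%:K * cis (- ang R N) - 1 + iC * s%:K) * z l by ring.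
  by rewrite Normc.normcM z1 mulr1; exact: (inner_pt_conj N8 tE).
have main l : exists al be, [/\ al \in unitmx, be \in unitmx, G l = be *m invmx al &
   G (pj l) = be *m ((Jmx (f l) *m Jmx (f l)) *m (Jmx (f l) *m Jmx (f l))) *m invmx al].
  have [H [H' [dH Hz HE]]] := @singular_gauge R r 'I_N z A l (2 * s) (mulr_gt0 (ltr0n _ 2) s0)
     (fun j jl => zd j l jl) (nonres l).
  have HE' x : disc (z l) (2 * s) x -> x != z l ->
     H' x = B x *m H x - (x - z l)^-1 *: (H x *m (invmx (g l) *m M l *m g l)).
    by move=> h1 h2; rewrite (HE _ h1 h2) (AE l).
  have d1 : nc (iC * z l) = 1 by rewrite Normc.normcM ni z1 mulr1.
  have nsz : nc (s%:K * z l) = s by rewrite Normc.normcM normc_real gtr0_norm // z1 mulr1.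
  have idd : iC * (iC * z l) = - z l by rewrite mulrA i2 mulN1r.
  have [] := @local_monodromy R r (M l) (g l) (f l) (gu l) (fM l) (z l) (2 * s) s H H' B s0 (lexx _) dH Hz HE'
     (disc 0 1) (half (z l)) Fi Fo (iC * z l) d1 FiS (FoS _ (z1 l)) (@onseg_disc R 0 1) (@half_conv R (z l)).
  - move=> x; rewrite idd /secD /disc subr0 => h.
    have -> : x = (x - (z l + s%:K * - z l)) + (1 - s)%:K * z l by rewrite rmorphB rmorph1; ring.
    apply: le_lt_trans (le_normcD _ _) _; rewrite Normc.normcM normc_real z1 mulr1 ger0_norm; lra.
  - move=> x; rewrite idd opprK /secD /disc /half => h.
    have -> : x * conjc (z l) = (x - (z l + s%:K * z l)) * conjc (z l) + (1 + s)%:K.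
      have E := conj_cis (z1 l); rewrite -[(1 + s)%:K]mulr1 -E rmorphD rmorph1; ring.
    have : nc ((x - (z l + s%:K * z l)) * conjc (z l)) < s by rewrite Normc.normcM normc_conj z1 mulr1.
    set e := _ * _ => he; have : - complex.Re e <= nc e.
      by apply: le_trans (normc_Re _); rewrite -normrN ler_norm.
    by rewrite (raddfD (@complex.Re R : Rcomplex R -> R)) /=; lra.
  move=> al [be [alu beu h1 h2]].
  have Ju := Jmx_unit (fM l); have JJu : Jmx (f l) *m Jmx (f l) \in unitmx by rewrite unitmx_mul Ju.
  have Ysol := @secY_sol R r (M l) (g l) (f l) (gu l) (fM l) (z l) (2 * s) s H H' B s0 (lexx _) dH HE'.
  exists al, be; split=> //.
  - apply: (corner_transport FiS (FoS _ (z1 l)) (FLS l) (Ysol _ d1)) => //.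
    + by apply: onseg_disc; apply: qL; [left|right].
    + by apply: onseg_disc; apply: qL; [left|right].
    + by apply: hq' => //; left.
    + by apply: (h1 _ _).1 => //; apply: qL; left.
    + by apply: (h1 _ _).2; [apply: qL; right|apply: hq' => //; left].
  - have e2 : nc (- (iC * z l)) = 1 by rewrite normcN.
    have E : be *m ((Jmx (f l) *m Jmx (f l)) *m (Jmx (f l) *m Jmx (f l))) *m invmx al =
       (be *m (Jmx (f l) *m Jmx (f l))) *m invmx (al *m invmx (Jmx (f l) *m Jmx (f l))).
      exact: inv_shift.
    rewrite E; apply: (corner_transport FiS (FoS _ (z1 l)) (FLS (pj l)) (Ysol _ e2)) => //.
    + by apply: onseg_disc; apply: qL; [left|right].
    + by apply: onseg_disc; apply: qL'; [left|right].
    + by rewrite /q' qprev; apply: hq' => //; right.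
    + by apply: (h2 _ _).1 => //; apply: qL'; left.
    + by apply: (h2 _ _).2; [apply: qL'; right|rewrite /q' qprev; apply: hq' => //; right].
    + by rewrite unitmx_mul alu unitmx_inv.
have Gu l : G l \in unitmx.
  by have [al [be [au bu -> _]]] := main l; rewrite unitmx_mul bu unitmx_inv.
exists (fun l => invmx (G l) *m G (pj l)); split.
  move=> l; have [al [be [au bu GE GpE]]] := main l; exists al => //.
  rewrite GpE GE; have -> : invmx (be *m invmx al) = al *m invmx be.
    apply: (can_inj (mulmxK (_ : be *m invmx al \in unitmx))); first by rewrite unitmx_mul bu unitmx_inv.
    by rewrite mulVmx ?unitmx_mul ?bu ?unitmx_inv // !mulmxA mulmxKV // mulmxV.
  exact: mx_shuffle.
by apply: mx_cycle => // l.
Qed.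
End RiemannHilbert.

(** * Monodromy of parabolic connections *)

Section CExp.
Variable R : realType.
Local Notation K := R[i].
Local Notation nc := (@Normc.normc R).
Local Notation "x %:K" := ((x%:C)%C : K) (at level 2, format "x %:K").
Local Notation iC := ('i%C : K).

Definition cexp (z : K) : K := (expR (complex.Re z))%:K * cis (complex.Im z).

Lemma cexpD z w : cexp (z + w) = cexp z * cexp w.
Proof. by case: z w => [a b] [c d]; rewrite /cexp /= expRD cisD rmorphM; ring. Qed.

Lemma cexp0 : cexp 0 = 1.
Proof. by rewrite /cexp /= expR0 cis0 rmorph1 mulr1. Qed.

Lemma cexpMn z n : cexp (z *+ n) = cexp z ^+ n.
Proof. by elim: n => [|n IH]; rewrite ?cexp0 // mulrSr cexpD IH exprSr. Qed.

Lemma cexp_neq0 z : cexp z != 0.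
Proof.
apply/eqP => h; have : cexp z * cexp (- z) = 1 by rewrite -cexpD subrr cexp0.
by rewrite h mul0r => /esym/eqP; rewrite oner_eq0.
Qed.

Lemma cexpN z : cexp (- z) = (cexp z)^-1.
Proof. by apply: (mulfI (cexp_neq0 z)); rewrite -cexpD subrr cexp0 divff // cexp_neq0. Qed.

Lemma abs_sin_le (t : R) : `|sin t| <= `|t|.
Proof.
wlog t0 : t / 0 <= t.
  move=> h; case: (leP 0 t) => [/h //|t0]; rewrite -normrN -[`|t|]normrN -sinN; apply: h; lra.
rewrite [`|t|]ger0_norm // ler_norml sin_le // andbT.
case: (leP t 1) => t1; last by apply: le_trans (sin_geN1 _); lra.
have p := @pi_ge2 R; have : 0 <= sin t; last by lra.
by apply: sin_ge0_pi; rewrite ?in_itv /=; apply/andP; split; lra.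
Qed.

Lemma cos_quad (t : R) : 0 <= 1 - cos t <= t ^+ 2 / 2.
Proof.
have := abs_sin_le (t / 2); rewrite -ler_sqr ?nnegrE // !real_normK ?num_real // => h.
have E : cos t = cos (t / 2) ^+ 2 *+ 2 - 1 by rewrite -cos_mulr2n; congr cos; rewrite -mulr_natr; field.
rewrite E cos2sin2; have s0 := sqr_ge0 (sin (t / 2)); rewrite exprMn in h.
by move: h; rewrite -[(2^-1 : R) ^+ 2]/(2^-1 * 2^-1); move: (t ^+ 2) (sin _ ^+ 2) s0 => a b; lra.
Qed.

Lemma sin_quad (t : R) : `|t| <= 1 -> `|sin t - t| <= t ^+ 2.
Proof.
wlog t0 : t / 0 <= t.
  move=> h; case: (leP 0 t) => [/h //|t0]; rewrite -normrN -[`|sin _ - _|]normrN opprB.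
  by move=> t1; have := h (- t); rewrite sinN sqrrN opprK addrC => ->//; lra.
rewrite ger0_norm // => t1; move: t0; rewrite le_eqVlt => /orP[/eqP <-|t0].
  by rewrite sin0 subrr normr0 sqr_ge0.
have [y] := @MVT R sin cos 0 t t0 (fun y _ => is_derive_sin y) (continuous_subspaceT (@continuous_sin R)).
rewrite in_itv /= sin0 !subr0 => /andP[y0 yt] ->.
have /andP[c0 c1] := cos_quad y; have yy : y ^+ 2 <= 1 by rewrite expr_le1 //; lra.
have yt2 : y ^+ 2 / 2 <= t by rewrite expr2; nra.
by rewrite ler_norml; apply/andP; split; nra.
Qed.

Lemma expR_quad (t : R) : `|t| <= 2^-1 -> 0 <= expR t - 1 - t <= t ^+ 2 *+ 2.
Proof.
rewrite ler_norml => /andP[t0 t1]; have h1 := @expR_ge1Dx R t; have h2 := @expR_ge1Dx R (- t).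
have e0 := @expR_gt0 R t; have e1 : expR t * expR (- t) = 1 by rewrite -expRD subrr expR0.
have h3 : expR t * (1 - t) <= 1 by rewrite -[X in _ <= X]e1 ler_pM2l.
have h4 : expR t * (1 - t) <= (1 + t + t ^+ 2 *+ 2) * (1 - t).
  apply: le_trans h3 _; rewrite -mulr_natr expr2; have := mulr_ge0 (sqr_ge0 t) (_ : 0 <= 1 - t *+ 2).
  rewrite -mulr_natr expr2; lra.
by rewrite ler_pM2r ?subr_gt0 in h4; lra.
Qed.

Lemma cexp_quad z : nc z <= 2^-1 -> nc (cexp z - 1 - z) <= 5 * nc z ^+ 2.
Proof.
case: z => x y h; have N2 := normc_sqr (Complex x y); rewrite /= in N2.
have x1 : `|x| <= 2^-1 by apply: le_trans h; exact: (normc_Re (Complex x y)).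
have y1 : `|y| <= 2^-1.
  apply: le_trans h; rewrite /= -sqrtr_sqr ler_sqrt ?addr_ge0 ?sqr_ge0 // lerDr sqr_ge0 //.
have /andP[E0 E1] := expR_quad x1; have /andP[c0 c1] := cos_quad y.
have /andP[s2 s3] : - y ^+ 2 <= sin y - y <= y ^+ 2.
  by rewrite -ler_norml; apply: sin_quad; lra.
rewrite [nc (Complex x y)]/= N2.
have -> : cexp (Complex x y) - 1 - Complex x y = Complex (expR x * cos y - 1 - x) (expR x * sin y - y).
  by rewrite /cexp /cis /=; simpc.
have e2 : expR x <= 2.
  by move: E1 x1; rewrite ler_norml -mulr_natr expr2 => E1 /andP[]; nra.
set e := expR x in E0 E1 e2 *; have e0 : 0 < e := expR_gt0 x.
have B1 : `|e * cos y - 1 - x| <= 2 * x ^+ 2 + y ^+ 2.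
  have -> : e * cos y - 1 - x = (e - 1 - x) - e * (1 - cos y) by ring.
  rewrite ler_norml; move: (x ^+ 2) (y ^+ 2) (sqr_ge0 x) (sqr_ge0 y) c0 c1 E0 E1 => X Y X0 Y0 c0 c1 E0 E1.
  have := mulr_ge0 (ltW e0) c0; have : e * (1 - cos y) <= 2 * (Y / 2) by apply: ler_pM => //; exact: ltW.
  by rewrite -mulr_natr in E1; move=> ? ?; apply/andP; split; lra.
have B2 : `|e * sin y - y| <= 2 * y ^+ 2 + `|x| * `|y| * 2.
  have -> : e * sin y - y = e * (sin y - y) + (x + (e - 1 - x)) * y by ring.
  apply: le_trans (ler_normD _ _) _; apply: lerD; rewrite normrM.
    by apply: ler_pM => //; [rewrite gtr0_norm|rewrite ler_norml s2].
  rewrite [X in _ <= X]mulrAC; apply: ler_wpM2r => //; apply: le_trans (ler_normD _ _) _.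
  rewrite [`|_ - 1 - x|]ger0_norm //; move: E1; rewrite -mulr_natr -[x ^+ 2]real_normK ?num_real // expr2.
  by have := normr_ge0 x; nra.
have xy : 0 <= (`|x| - `|y|) ^+ 2 := sqr_ge0 _.
have X2 : x ^+ 2 = `|x| ^+ 2 by rewrite real_normK ?num_real.
have Y2 : y ^+ 2 = `|y| ^+ 2 by rewrite real_normK ?num_real.
apply: (@le_trans _ _ (`|e * cos y - 1 - x| + `|e * sin y - y|)).
  have -> : Complex (e * cos y - 1 - x) (e * sin y - y) = (e * cos y - 1 - x)%:K + iC * (e * sin y - y)%:K by simpc.
  apply: le_trans (le_normcD _ _) _; rewrite Normc.normcM !normc_real.
  by rewrite /= expr0n expr1n add0r sqrtr1 mul1r.
rewrite X2 Y2 in B1 B2 *; move: xy B1 B2 (sqr_ge0 `|x|) (sqr_ge0 `|y|); rewrite !expr2; nra.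
Qed.

Lemma pow_near1 (w : K) (d : R) n : 0 <= d -> nc (w - 1) <= d -> n%:R * d <= 1 ->
  nc (w ^+ n - 1) <= n%:R * d * expR 1.
Proof.
move=> d0 wd nd.
have pw k : (k <= n)%N -> nc (w ^+ k) <= expR 1.
  move=> kn; rewrite normcX; apply: (@le_trans _ _ (expR d ^+ k)).
    apply: lerXn2r; rewrite ?nnegrE ?normc_ge0 ?expR_ge0 //; apply: le_trans (@expR_ge1Dx R d).
    by rewrite -(addrNK 1 w) addrC; apply: le_trans (le_normcD _ _) _; rewrite Normc.normc1 lerD2l.
  rewrite -expRM_natl ler_expR; apply: le_trans nd; rewrite ler_wpM2r // ler_nat //.
have : forall k, (k <= n)%N -> nc (w ^+ k - 1) <= k%:R * d * expR 1; last by apply.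
elim=> [|k IH] kn; first by rewrite subrr Normc.normc0 !mul0r.
have -> : w ^+ k.+1 - 1 = w ^+ k * (w - 1) + (w ^+ k - 1) by rewrite exprSr; ring.
apply: le_trans (le_normcD _ _) _; rewrite Normc.normcM -natr1 mulrDl mul1r mulrDl addrC.
by apply: lerD; [exact: IH (ltnW kn)|rewrite mulrC; apply: ler_pM; rewrite ?normc_ge0 // pw // ltnW].
Qed.

(** An [n]-th root within [C / n^2] of 1 puts [x] within [O(1 / n)] of 1. Small steps can thus be
    compared with an exponential without integration along an arc. *)
Lemma pow_limit (x : K) (C : R) n0 : 0 <= C ->
  (forall n, (n0 < n)%N -> exists2 w, w ^+ n = x & nc (w - 1) <= C / n%:R ^+ 2) -> x = 1.
Proof.
move=> C0 h; apply/eqP; rewrite -subr_eq0 -normc_eq0 eq_le normc_ge0 andbT leNgt; apply/negP => e0.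
have e1 := @expR_gt0 R 1.
pose m := (Num.bound (C * expR 1 / nc (x - 1)) + Num.bound C + n0).+1.
have m0 : 0 < m%:R :> R by rewrite ltr0n.
have [|w wx w1] := h m; first by rewrite ltnS leq_addl.
have mE : m%:R * (C / m%:R ^+ 2) = C / m%:R by rewrite expr2; field; rewrite gt_eqF.
have b1 := archi_boundP C0; have b2 : C * expR 1 / nc (x - 1) < m%:R.
  apply: lt_le_trans (archi_boundP _) _; first by rewrite divr_ge0 ?mulr_ge0 // ltW.
  by rewrite ler_nat ltnW // ltnS -addnA leq_addr.
have := @pow_near1 w (C / m%:R ^+ 2) m; rewrite wx mE => /(_ _ w1).
have -> : 0 <= C / m%:R ^+ 2 by rewrite divr_ge0 ?exprn_ge0 // ltW.
have -> : C / m%:R <= 1.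
  rewrite ler_pdivrMr // mul1r; apply: le_trans (ltW b1) _; rewrite ler_nat ltnW // ltnS -addnAC.
  by rewrite leq_addl.
move=> /(_ isT isT); rewrite leNgt => /negP; apply.
by rewrite mulrAC ltr_pdivrMr // -ltr_pdivrMl // mulrC.
Qed.

Definition expi (t : K) : K := cexp (iC * (pi *+ 2)%:K * t).

Lemma expiD a b : expi (a + b) = expi a * expi b.
Proof. by rewrite /expi mulrDr cexpD. Qed.

Lemma expiE a b : expi (Complex a b) = (expR (- (pi *+ 2 * b)))%:K * cis (pi *+ 2 * a).
Proof.
have E : iC * (pi *+ 2)%:K * Complex a b = Complex (- (pi *+ 2 * b)) (pi *+ 2 * a).
  by apply/eqP; rewrite eq_complex /=; apply/andP; split; apply/eqP; ring.
by rewrite /expi E.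
Qed.

Lemma expi1 : expi 1 = 1.
Proof. by rewrite -[1]/(Complex 1 0) expiE mulr0 oppr0 expR0 mulr1 -[pi *+ 2]add0r cis2pi cis0 mulr1. Qed.

Lemma expi_int (m : int) : expi m%:~R = 1.
Proof.
have e0 : expi 0 = 1 by rewrite /expi mulr0 cexp0.
have en k : expi k%:R = 1 by elim: k => [|k IH] //; rewrite -natr1 expiD IH expi1 mulr1.
case: m => k; first exact: en.
by rewrite NegzE mulrNz /expi mulrN cexpN -/(expi _) en invr1.
Qed.

Lemma expi_surj (x : K) : x != 0 -> exists t, expi t = x.
Proof.
move=> x0; have n0 : 0 < nc x by rewrite lt_neqAle normc_ge0 eq_sym normc_eq0 x0.
pose w := x / (nc x)%:K; have w1 : nc w = 1.
  by rewrite Normc.normcM Normc.normcV normc_real gtr0_norm // divff // gt_eqF.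
have [y hy] : exists y, cis y = w.
  have := normc_sqr w; rewrite w1 expr1n; case: (w) => a b /= h.
  have ab : -1 <= a <= 1 by have := sqr_ge0 b; move: h; rewrite !expr2 => h b2; apply/andP; split; nra.
  have cE : cos (acos a) = a by apply: acosK; rewrite in_itv.
  have s2 : sin (acos a) ^+ 2 = b ^+ 2 by rewrite sin2cos2 cE; lra.
  move/eqP: s2; rewrite eqf_sqr => /orP[/eqP sE|/eqP sE].
    by exists (acos a); rewrite /cis cE sE.
  by exists (- acos a); rewrite /cis cosN sinN cE sE opprK.
pose z := Complex (ln (nc x)) y.
have p0 : iC * (pi *+ 2)%:K != 0.
  by rewrite mulf_neq0 ?eq_complex /= ?oner_eq0 ?andbF // negb_and mulrn_eq0 /= gt_eqF // pi_gt0.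
exists (z / (iC * (pi *+ 2)%:K)); rewrite /expi mulrC divfK // /cexp /= lnK ?posrE // hy /w mulrC divfK //.
by rewrite -normc_eq0 normc_real normr_eq0 gt_eqF.
Qed.

Lemma expi_ker (t : K) : expi t = 1 -> exists m : int, t = m%:~R.
Proof.
case: t => a b h; have e1 : expR (- (pi *+ 2 * b)) = 1.
  by have := congr1 nc h; rewrite expiE Normc.normcM normc_cis normc_real Normc.normc1 mulr1 ger0_norm ?expR_ge0.
have p0 := pi_gt0 R; have pn : pi *+ 2 != 0 :> R by rewrite mulrn_eq0 /= gt_eqF.
have b0 : b = 0.
  have : - (pi *+ 2 * b) = 0 by apply: expR_inj; rewrite e1 expR0.
  by move/eqP; rewrite oppr_eq0 mulf_eq0 (negbTE pn) /= => /eqP.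
exists (Num.floor a); rewrite b0.
have [fl fu] := andP (floor_itv a).
pose d := a - (Num.floor a)%:~R; have d01 : 0 <= d < 1 by rewrite /d subr_ge0 fl ltrBlDr addrC -[1]/(1%:~R) -intrD.
have Ea : Complex a 0 = d%:K + (Num.floor a)%:~R.
  have -> : (Num.floor a)%:~R = ((Num.floor a)%:~R : R)%:K by rewrite rmorph_int.
  by rewrite -rmorphD /d subrK.
have : expi d%:K = 1 by move: h; rewrite b0 Ea expiD expi_int mulr1.
rewrite -[d%:K]/(Complex d 0) expiE mulr0 oppr0 expR0 mul1r => /(congr1 (@complex.Re R)) /= cE.
have [dd0 dd1] := andP d01.
have d0 : d = 0.
  have dh : cos (pi *+ 2 * d) = 1 by [].
  case: (lerP d 2^-1) => hd.
    have : pi *+ 2 * d = 0.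
      have i1 : 0 <= pi *+ 2 * d <= pi.
        rewrite -mulr_natr; have := p0; move: (pi) => p pp; apply/andP; split; nra.
      by apply: cos_inj; rewrite ?in_itv /= ?cos0 ?dh // lexx ltW.
    by move/eqP; rewrite mulf_eq0 (negbTE pn) => /eqP.
  have : pi *+ 2 * (1 - d) = 0.
    have i1 : 0 <= pi *+ 2 * (1 - d) <= pi.
      by rewrite -mulr_natr; have := p0; move: (pi) => p pp; apply/andP; split; nra.
    apply: cos_inj; rewrite ?in_itv /= ?cos0 ?i1 ?lexx ?(ltW p0) //.
    have -> : pi *+ 2 * (1 - d) = - (pi *+ 2 * d) + pi *+ 2 by ring.
    by rewrite cosD2pi cosN dh.
  by move/eqP; rewrite mulf_eq0 (negbTE pn) /= subr_eq0 => /eqP; lra.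
by rewrite Ea d0 rmorph0 add0r.
Qed.

End CExp.

(** * The quarter turn in rank one *)

Section Jump.
Variable R : realType.
Local Notation K := R[i].
Local Notation nc := (@Normc.normc R).
Local Notation "x %:K" := ((x%:C)%C : K) (at level 2, format "x %:K").
Local Notation iC := ('i%C : K).

Lemma disc11 : disc (1 : K) 1 1. Proof. by rewrite /disc subrr Normc.normc0. Qed.

Lemma disc_neq0 (x : K) : disc 1 1 x -> x != 0.
Proof. by apply: contraTneq => ->; rewrite /disc sub0r normcN Normc.normc1 ltxx. Qed.

Lemma scalar_solution (t : K) : exists a : K -> K, [/\ a 1 = 1,
   exists2 C, 0 <= C & (forall x, nc (x - 1) <= 2^-1 -> nc (a x - 1 - (x - 1) * t) <= C * nc (x - 1) ^+ 2) &
   isol (disc 1 1) (fun x => (a x)%:M : 'M_1) (fun x => x^-1 *: t%:M)].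
Proof.
have [|f [[f1 [C fC]] fS _]] := @ode_disc R 1 'I_1 1 1 (fun=> 0) (fun=> t%:M) ltr01.
  by move=> _; rewrite sub0r normcN Normc.normc1.
have fE x : f x = (f x 0 0)%:M by rewrite [LHS]mx11_scalar.
exists (fun x => f x 0 0); split.
- by rewrite f1 mxE eqxx.
- exists (`|C|) => // x x1; have := fC x; rewrite mul1r => /(_ x1) h.
  apply: le_trans (le_trans _ h) _; last by rewrite ler_wpM2r ?exprn_ge0 ?normc_ge0 ?ler_norm.
  rewrite big_ord1 subr0 invr1 scale1r /mnorm !big_ord1 !mxE /= !mulr1n; exact: lexx.
- case: fS => d [g [dg gf]]; have E x : disc 1 1 x -> \sum_(l < 1) (x - 0)^-1 *: (t%:M : 'M[K]_1) = x^-1 *: t%:M.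
    by rewrite big_ord1 subr0.
  split; first by apply: der_ext d => x xD; rewrite -?fE ?E.
  exists g; split; first by apply: der_ext dg => x xD; rewrite -?fE ?E.
  by move=> z /gf; rewrite -fE.
Qed.

(** Rescaling the variable by [p] preserves the Euler equation, so [a (p * x)] is a constant
    multiple of [a x]. *)
Lemma scalar_hom (t : K) (a : K -> K) p w : a 1 = 1 ->
  isol (disc 1 1) (fun x => (a x)%:M : 'M_1) (fun x => x^-1 *: t%:M) ->
  disc 1 1 p -> disc 1 1 w -> disc 1 1 (p * w) -> a (p * w) = a p * a w.
Proof.
move=> a1 h pD wD pwD; have p0 := disc_neq0 pD.
have [h' _] : isol (fun z => disc 1 1 ((z - 0) * p)) (fun z => (a ((z - 0) * p))%:M : 'M_1) (fun x => x^-1 *: t%:M).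
  apply: isol_sub (isol_affine 0 p h) => // z /disc_neq0; rewrite mulf_eq0 negb_or subr0 => /andP[z0 _].
  by rewrite scalerA invfM mulrCA divff // mulr1.
have c1 : onseg (disc 1 1) 1 w by apply: onseg_disc => //; exact: disc11.
have c2 : onseg (fun z => disc 1 1 ((z - 0) * p)) 1 w.
  move=> s s01; have -> : (seg 1 w s - 0) * p = seg p (p * w) s by rewrite /seg; ring.
  exact: (onseg_disc pD pwD).
have := sol_isol h h' c1 c2; have u := isol_unit h wD.
rewrite !subr0 mul1r a1 invmx1 mul1mx [w * p]mulrC => /(congr1 (mulmx (a w)%:M)).
by rewrite mulKVmx // -scalar_mxM => /matrixP /(_ 0 0); rewrite !mxE eqxx !mulr1n => <-; rewrite mulrC.
Qed.

Lemma disc_cis (rho phi : R) : 0 < rho -> rho < 2 * cos phi -> disc 1 1 (rho%:K * cis phi).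
Proof.
move=> r0 rc; rewrite /disc; apply: normc_lt => //; rewrite expr1n.
have := cos2Dsin2 phi; rewrite /cis; simpc => /= h.
have -> : (rho * cos phi - 1) ^+ 2 + (rho * sin phi) ^+ 2 = rho ^+ 2 * (cos phi ^+ 2 + sin phi ^+ 2) - rho * (2 * cos phi) + 1 by ring.
by rewrite h mulr1 expr2; nra.
Qed.

(** An arc of angle [pi / 2] leads from [ptL] to [ptR]. It is cut into [n] rotations [w], each
    multiplying the solution by [a w], which agrees with the exponential of the step up to
    [O(1 / n^2)]; [pow_limit] removes the error. *)
Lemma scalar_jump (t : K) (a : K -> K) : a 1 = 1 ->
   (exists2 C, 0 <= C & (forall x, nc (x - 1) <= 2^-1 -> nc (a x - 1 - (x - 1) * t) <= C * nc (x - 1) ^+ 2)) ->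
   isol (disc 1 1) (fun x => (a x)%:M : 'M_1) (fun x => x^-1 *: t%:M) ->
   a (@ptR R) ^+ 4 = expi t * a (@ptL R) ^+ 4.
Proof.
move=> a1 [C C0 hC] aS; pose q : R := pi / 4; pose s : R := (Num.sqrt 2)^-1.
have s2 : 0 < Num.sqrt 2 :> R by rewrite sqrtr_gt0.
have ss : Num.sqrt 2 ^+ 2 = 2 :> R by rewrite sqr_sqrtr.
have s0 : 0 < s by rewrite invr_gt0.
have s12 : s * s = 2^-1 by rewrite -invfM -expr2 ss.
have cq0 : 0 < cos q.
  by apply: cos_gt0_pihalf; have := @pi_ge2 R; rewrite /q => ?; apply/andP; split; lra.
have sc : sin q = cos q.
  by have := @tan_piquarter R; rewrite /tan -/q => /(congr1 ( *%R^~ (cos q))); rewrite divfK ?gt_eqF // mul1r.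
have cq : cos q = s.
  have := cos2Dsin2 q; rewrite sc => h; have /eqP : cos q ^+ 2 = s ^+ 2 by rewrite [RHS]expr2 s12; lra.
  by rewrite eqf_sqr => /orP[/eqP //|/eqP]; lra.
have sq : sin q = s by rewrite sc.
have two : (2%:R : K) != 0 by rewrite pnatr_eq0.
have sK : s%:K * s%:K = 2%:R^-1 by rewrite -rmorphM s12 fmorphV rmorph_nat.
have pR : @ptR R = s%:K * cis q.
  have -> : cis q = s%:K * (1 + iC) by rewrite /cis cq sq; simpc.
  by rewrite mulrA sK /ptR mulrC.
have pL : @ptL R = s%:K * cis (- q).
  have -> : cis (- q) = s%:K * (1 - iC) by rewrite /cis cosN sinN cq sq; simpc.
  by rewrite mulrA sK /ptL mulrC.
have p2 := @pi_ge2 R; have p4 : (pi : R) <= 4 by have := @pihalf_lt2 R; lra.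
have q0 : 0 < q by rewrite /q; lra.
have cge x : - q <= x <= q -> s <= cos x.
  move=> xq; have -> : cos x = cos `|x| by case: ger0P => _; rewrite ?cosN.
  have xq' : `|x| <= q by rewrite ler_norml.
  have qp : q <= pi by rewrite /q; lra.
  have i1 : `|x| \in `[0, pi] by rewrite in_itv /= normr_ge0 (le_trans xq').
  have i2 : q \in `[0, pi] by rewrite in_itv /= (ltW q0).
  by rewrite -cq leNgt ltr_cos // -leNgt.
have dsk x : - q <= x <= q -> disc 1 1 (s%:K * cis x).
  by move=> /cge h; apply: disc_cis => //; lra.
have s1 : 2^-1 < s.
  rewrite -s12; have : s < 1 by case: (ltrP s 1) => // h; have := mulr_ege1 h h; rewrite s12; lra.
  nra.
have d1 x : - q <= x <= q -> disc 1 1 (cis x).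
  by move=> /cge h; have := @disc_cis 1 x ltr01; rewrite rmorph1 mul1r; apply; lra.
have [aR0 aL0] : a (@ptR R) != 0 /\ a (@ptL R) != 0.
  have u x : disc 1 1 x -> a x != 0.
    by move=> /(isol_unit aS); rewrite unitmxE det_scalar1 unitfE.
  by split; apply: u; rewrite ?pR ?pL; apply: dsk; lra.
pose T := nc t; have T0 : 0 <= T := normc_ge0 _.
pose M := 16 * C + 5 * T; have M0 : 0 <= M by rewrite /M; lra.
have ni : nc iC = 1 by rewrite /= expr0n expr1n add0r sqrtr1.
have main : a (@ptR R) / a (@ptL R) * cexp (- (iC * (pi / 2)%:K * t)) = 1.
  (* The term 16 keeps [w] where the expansion of [a] at 1 is valid, and the second term keeps
     [phi * T] at most [1 / 2]. *)
  pose n0 := (16 + Num.bound (4 * T))%N.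
  apply: (@pow_limit _ _ (4 * (T ^+ 2 + 5 * T ^+ 2 * (2 + M) + 2 * M)) n0).
    by have := sqr_ge0 T; nra.
  move=> n nn; have n8 : (16 : R) <= n%:R by rewrite (ler_nat _ 16); exact: leq_trans (leq_addr _ _) (ltnW nn).
  have n1 : 0 < n%:R :> R by lra.
  have nT : 4 * T <= n%:R.
    apply: le_trans (ltW (archi_boundP (_ : 0 <= 4 * T))) _; first lra.
    by rewrite ler_nat; exact: leq_trans (leq_addl _ _) (ltnW nn).
  pose phi : R := pi / 2 / n%:R; pose w := cis phi.
  have phn : phi * n%:R = pi / 2 by rewrite /phi divfK // gt_eqF.
  have ph0 : 0 < phi by rewrite !divr_gt0 //; lra.
  have ph2 : phi <= 2 / n%:R by rewrite ler_pM2r ?invr_gt0 //; lra.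
  have ph14 : phi <= 8^-1.
    by apply: le_trans ph2 _; rewrite ler_pdivrMr //; lra.
  have phT : phi * T <= 2^-1.
    by apply: (@le_trans _ _ (2 / n%:R * T)); [rewrite ler_wpM2r|rewrite mulrAC ler_pdivrMr //; lra].
  have wk k : w ^+ k = cis (phi * k%:R).
    elim: k => [|k IH]; first by rewrite mulr0 cis0.
    by rewrite exprSr IH -cisD -natr1 mulrDr mulr1.
  have phq : phi <= q by rewrite /q; lra.
  have aw k : (k <= n)%N -> a (@ptL R * w ^+ k) = a (@ptL R) * a w ^+ k.
    elim: k => [|k IH] kn; first by rewrite !mulr1.
    have inq j : (j <= n)%N -> - q <= - q + phi * j%:R <= q.
      move=> jn; have : phi * j%:R <= phi * n%:R by rewrite ler_pM2l // ler_nat.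
      by have : 0 <= phi * j%:R; [rewrite mulr_ge0 // ltW|rewrite phn /q; lra].
    have dj j : (j <= n)%N -> disc 1 1 (@ptL R * w ^+ j).
      by move=> jn; rewrite pL wk -mulrA -cisD; apply: dsk; exact: inq.
    rewrite !exprSr mulrA (scalar_hom a1 aS) ?dj ?(ltnW kn) //.
    - by rewrite IH ?(ltnW kn) // mulrA.
    - by apply: d1; lra.
    - by rewrite -mulrA -exprSr dj.
  exists (a w * cexp (- (iC * phi%:K * t))).
    rewrite exprMn -cexpMn; congr (_ * cexp _).
      apply: (mulfI aL0); rewrite -aw // [RHS]mulrC divfK //; congr a.
      by rewrite wk phn pL pR -mulrA -cisD; congr (_ * cis _); rewrite /q; field.
    have -> : (pi / 2)%:K = phi%:K * n%:R by rewrite -phn [LHS]rmorphM rmorph_nat.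
    by rewrite mulNrn -[_ *+ n]mulr_natr; congr (- _); ring.
  have wE : w = cexp (iC * phi%:K).
    have -> : iC * phi%:K = Complex 0 phi by simpc.
    by rewrite /cexp /= expR0 rmorph1 mul1r.
  have nx : nc (iC * phi%:K) = phi by rewrite Normc.normcM ni normc_real mul1r gtr0_norm.
  have w1 : nc (w - 1 - iC * phi%:K) <= 5 * phi ^+ 2.
    by rewrite wE; have := @cexp_quad R (iC * phi%:K); rewrite nx; apply; lra.
  have w2 : nc (w - 1) <= 4 * phi.
    rewrite -(subrK (iC * phi%:K) (w - 1)); apply: le_trans (le_normcD _ _) _; rewrite nx.
    by apply: (@le_trans _ _ (5 * phi ^+ 2 + phi)); [rewrite lerD2r|rewrite expr2; nra].
  pose x := iC * phi%:K * t; have xT : nc x = phi * T by rewrite Normc.normcM nx.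
  pose E2 := a w - 1 - x; pose E3 := cexp (- x) - 1 - (- x).
  have p1 : 0 < phi ^+ 2 by rewrite exprn_gt0.
  have p3 : phi ^+ 2 <= 1 by rewrite expr_le1 //; lra.
  have hE2 : nc E2 <= M * phi ^+ 2.
    have -> : E2 = (a w - 1 - (w - 1) * t) + (w - 1 - iC * phi%:K) * t by rewrite /E2 /x; ring.
    apply: le_trans (le_normcD _ _) _; rewrite /M [X in _ <= X]mulrDl [X in _ + X <= _]Normc.normcM; apply: lerD.
      apply: le_trans (hC _ _) _; first lra.
      rewrite [16 * C]mulrC -mulrA; apply: ler_wpM2l => //.
      have -> : 16 * phi ^+ 2 = (4 * phi) ^+ 2 by ring.
      by rewrite lerXn2r // nnegrE ?normc_ge0 //; lra.
    by rewrite mulrAC; apply: ler_wpM2r.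
  have hE3 : nc E3 <= 5 * (phi * T) ^+ 2.
    by have := @cexp_quad R (- x); rewrite normcN xT; apply.
  have -> : a w * cexp (- (iC * phi%:K * t)) - 1 = - (x * x) + E3 * (1 + x + E2) + E2 * (1 - x).
    by rewrite -/x /E2 /E3; ring.
  have n1x : nc (1 + x + E2) <= 2 + M.
    apply: le_trans (le_normcD _ _) _; apply: lerD.
      by apply: le_trans (le_normcD _ _) _; rewrite Normc.normc1 xT; lra.
    by apply: le_trans hE2 _; rewrite ler_piMr.
  have n2x : nc (1 - x) <= 2.
    by apply: le_trans (le_normcD _ _) _; rewrite Normc.normc1 normcN xT; lra.
  apply: (@le_trans _ _ (phi ^+ 2 * (T ^+ 2 + 5 * T ^+ 2 * (2 + M) + 2 * M))).
    apply: le_trans (le_normcD _ _) _; rewrite [X in _ <= X]mulrDr; apply: lerD; last first.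
      rewrite Normc.normcM; have -> : phi ^+ 2 * (2 * M) = M * phi ^+ 2 * 2 by ring.
      by apply: ler_pM; rewrite ?normc_ge0.
    apply: le_trans (le_normcD _ _) _; rewrite [X in _ <= X]mulrDr; apply: lerD.
      by rewrite normcN Normc.normcM xT -expr2 exprMn.
    rewrite Normc.normcM; have -> : phi ^+ 2 * (5 * T ^+ 2 * (2 + M)) = 5 * (phi * T) ^+ 2 * (2 + M) by ring.
    by apply: ler_pM; rewrite ?normc_ge0.
  rewrite [X in _ <= X]mulrAC; apply: ler_wpM2r.
    by have := sqr_ge0 T; nra.
  have -> : (4 : R) / n%:R ^+ 2 = (2 / n%:R) ^+ 2 by field; rewrite gt_eqF.
  by rewrite lerXn2r // nnegrE; [exact: ltW|rewrite divr_ge0 // ltW].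
have -> : a (@ptR R) = a (@ptL R) * cexp (iC * (pi / 2)%:K * t).
  move: main; rewrite cexpN => /(congr1 ( *%R^~ (cexp (iC * (pi / 2)%:K * t)))).
  by rewrite divfK ?cexp_neq0 // mul1r => <-; rewrite mulrC divfK.
rewrite exprMn -cexpMn mulrC; congr (cexp _ * _).
have -> : pi *+ 2 = (pi / 2) *+ 4 :> R by rewrite -[RHS]mulr_natr -[LHS]mulr_natr; field.
by rewrite raddfMn mulrnAr mulrnAl.
Qed.
End Jump.

Lemma mxbig_pad (F : fieldType) r n k (G : nat -> 'M[F]_r) : (forall j, (n <= j)%N -> G j = 1%:M) ->
  \big[mulmx/1%:M]_(i < n + k) G i = \big[mulmx/1%:M]_(i < n) G i.
Proof.
move=> G1; elim: k => [|k IH]; first by rewrite addn0.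
by rewrite addnS mxbig_recr /= G1 ?leq_addr // mulmx1.
Qed.

(** * Triangular local solutions and prescribed residues *)

Section LocalSolution.
Variable R : realType.
Local Notation K := R[i].
Local Notation nc := (@Normc.normc R).
Local Notation "x %:K" := ((x%:C)%C : K) (at level 2, format "x %:K").
Local Notation iC := ('i%C : K).

(** Diagonal entries of a triangular solution solve scalar equations, which gives the diagonal of
    the full turn. The entries above it stay undetermined, so the Jordan type is not controlled
    here. *)
Lemma local_solution r (rho : 'I_r -> nat) (M : 'M[K]_r) : tri rho M ->
  exists f, [/\ isol (disc 1 1) f (fun x => x^-1 *: M),
    tri rho ((Jmx f *m Jmx f) *m (Jmx f *m Jmx f)) &
    forall a, ((Jmx f *m Jmx f) *m (Jmx f *m Jmx f)) a a = expi (M a a)].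
Proof.
move=> tM.
have [|f [[f1 _] fS fP]] := @ode_disc R r 'I_1 1 1 (fun=> 0) (fun=> M) ltr01.
  by move=> _; rewrite sub0r normcN Normc.normc1.
have tf x : tri rho (f x).
  move=> a b; apply: contraNP => /not_orP[ab h].
  apply/eqP; apply: (fP (fun p => (p.1 != p.2) && ~~ (rho p.1 < rho p.2)%N)) => //=.
  - by move=> i; rewrite eqxx.
  - move=> _ i j k /andP[ik nik] /tM[<-|ij]; first by rewrite ik.
    by rewrite (contraNneq _ nik) => [|<- //]; apply: contra nik; exact: ltn_trans.
  - by apply/andP; split; [apply/eqP|apply/negP].
have fS' : isol (disc 1 1) f (fun x => x^-1 *: M).
  by apply: isol_sub fS => // z _; rewrite big_ord1 subr0.
have [DR DL] := ptD R.
have Jf : f (ptL R) *m Jmx f = f (ptR R) by rewrite mulKVmx // (isol_unit fS' DL).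
have diag a : exists2 s : K -> K, (forall x, disc 1 1 x -> f x a a = s x /\ s x != 0) &
    s (ptR R) ^+ 4 = expi (M a a) * s (ptL R) ^+ 4.
  have [s [s1 sC sS]] := scalar_solution (M a a).
  exists s; last exact: scalar_jump sS.
  have sol1 : sol (disc 1 1) (fun x => (f x a a)%:M : 'M_1) (fun x => x^-1 *: (M a a)%:M).
    case: fS' => d _ p q pq; have [C h] := d p q pq; exists C => u v u01 v01.
    apply: le_trans (h u v u01 v01); set z := seg p q u; set w := seg p q v.
    set X := f w - f z - _.
    have -> : (f w a a)%:M - (f z a a)%:M - (w - z) *: ((z^-1 *: (M a a)%:M) *m (f z a a)%:M) = (X a a)%:M :> 'M_1.
      rewrite -scalemxAl -scalar_mxM !scale_scalar_mx -!raddfB /=; congr (_%:M).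
      by rewrite -(triM_diag _ tM (tf z)) /X -scalemxAl; move: (M *m f z) => Y; rewrite !mxE.
    have -> : mnorm ((X a a)%:M : 'M_1) = nc (X a a) by rewrite /mnorm !big_ord1 mxE eqxx mulr1n.
    rewrite /mnorm (bigD1 a) //= (bigD1 a) //= -addrA lerDl addr_ge0 ?sumr_ge0 // => *; rewrite ?normc_ge0 //.
    by apply: sumr_ge0 => *; exact: normc_ge0.
  move=> x xD; have u := isol_unit sS xD; have s0 : s x != 0 by move: u; rewrite unitmxE det_scalar1 unitfE.
  split=> //; have c1 : onseg (disc 1 1) 1 x by apply: onseg_disc => //; exact: disc11.
  have := sol_isol sS sol1 c1 c1; rewrite s1 f1 mxE eqxx invmx1 mulmx1 => /(congr1 (mulmx (s x)%:M)).
  by rewrite mulKVmx // mulmx1 => /matrixP /(_ 0 0); rewrite !mxE eqxx !mulr1n.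
have tJ : tri rho (Jmx f).
  apply: (tri_solve (tf _) (tf (ptR R)) _ Jf) => a.
  by have [s h _] := diag a; have [-> ] := h _ DL.
have tJ2 := triM tJ tJ; have tJ4 := triM tJ2 tJ2.
exists f; split=> // a; rewrite (triM_diag _ tJ2 tJ2) (triM_diag _ tJ tJ).
have [s h js] := diag a; have [eL nL] := h _ DL; have [eR nR] := h _ DR.
have : (f (ptL R) *m Jmx f) a a = f (ptR R) a a by rewrite Jf.
rewrite (triM_diag _ (tf _) tJ) eL eR => E; rewrite -!expr2 -exprM.
by apply: (mulfI (expf_neq0 4 nL)); rewrite -exprMn E js mulrC.
Qed.

(** Take a nonzero entry [Y a b] with the highest row level and, within that row, the lowest column
    level. Only diagonal entries of [M] contribute to the equation there, so [M a a - M b b] would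
    equal [k]. *)
Lemma nonresonant r (rho : 'I_r -> nat) (M g X : 'M[K]_r) (k : nat) : g \in unitmx -> tri rho M ->
  (forall a b, M a a - M b b <> k%:R) ->
  k%:R *: X = (invmx g *m M *m g) *m X - X *m (invmx g *m M *m g) -> X = 0.
Proof.
move=> gu tM nr XE; pose Y := g *m X *m invmx g.
have YE : k%:R *: Y = M *m Y - Y *m M.
  have -> : k%:R *: Y = g *m (k%:R *: X) *m invmx g by rewrite /Y -scalemxAr -scalemxAl.
  rewrite XE mulmxBr mulmxBl /Y !mulmxA (mulmxV gu) mul1mx.
  by rewrite (mulmxK gu).
have YX : invmx g *m Y *m g = X by rewrite /Y !mulmxA mulVmx // mul1mx mulmxKV.
clearbody Y.
suff Y0 : Y = 0 by rewrite -YX Y0 mulmx0 mul0mx.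
apply/eqP; case: (boolP [exists a, exists b, Y a b != 0]) => [ex|]; last first.
  move=> /existsPn h; apply/eqP/matrixP => a b; rewrite mxE.
  by have /existsPn/(_ b) := h a; rewrite negbK => /eqP.
case/existsP: ex => a0 ex0; case: (@arg_maxnP _ a0 (fun a => [exists b, Y a b != 0]) rho ex0) => a /existsP[b0 hb0] amax.
case: (@arg_minnP _ b0 (fun b => Y a b != 0) rho hb0) => b hb bmin.
have Z c d : (rho a < rho c)%N -> Y c d = 0.
  move=> ac; apply/eqP/negPn/negP => cd; have : (rho c <= rho a)%N by apply: amax; apply/existsP; exists d.
  by rewrite leqNgt ac.
have Z' c : (rho c < rho b)%N -> Y a c = 0.
  by move=> cb; apply/eqP/negPn/negP => /bmin; rewrite leqNgt cb.
move/matrixP/(_ a b): YE; rewrite !mxE (bigD1 a) //= big1 ?addr0; last first.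
  move=> c ca; have [/eqP -> |/tM[e|h]] := boolP (M a c == 0); first by rewrite mul0r.
    by rewrite e eqxx in ca.
  by rewrite Z ?mulr0.
rewrite (bigD1 b) //= [X in _ - (_ + X)]big1 ?addr0; last first.
  move=> c cb; have [/eqP -> |/tM[e|h]] := boolP (M c b == 0); first by rewrite mulr0.
    by rewrite e eqxx in cb.
  by rewrite Z' ?mul0r.
move=> E; case: (nr a b); apply: (mulIf hb); rewrite mulrBl E; congr (_ - _); exact: mulrC.
Qed.

(** Eight points with zero residue are appended to satisfy the bound on the number of poles; their
    monodromy is trivial. The reversed indices match the order in which the turns multiply. *)
Theorem riemann_hilbert_parabolic r n (rho : 'I_n -> 'I_r -> nat) (M g : 'I_n -> 'M[K]_r) (c : pred 'I_r) :
  (forall i, g i \in unitmx) -> (forall i, tri (rho i) (M i)) ->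
  (forall i a b k, (0 < k)%N -> M i a a - M i b b <> k%:R) ->
  let A i := invmx (g i) *m M i *m g i in
  let z (i : 'I_n) := zpt R (n + 8) (rev_ord (lshift 8 i)) in
  (forall a b, c a = c b -> \sum_i A i a b = ((a == b) && c a)%:R) ->
  (forall a b, ~~ c a -> c b -> \sum_i A i a b = 0 /\ \sum_i z i * A i a b = 0) ->
  exists T : 'I_n -> 'M[K]_r,
    (forall i, exists h X, [/\ h \in unitmx, tri (rho i) X, forall a, X a a = expi (M i a a) &
       T i = h *m X *m invmx h]) /\
    \big[mulmx/1%:M]_(i < n) T i = 1%:M.
Proof.
move=> gu tM nr A z H1 H2; pose N := (n + 8)%N.
have [f0 f0P] := choice (fun i => local_solution (tM i)).
pose pt (l : 'I_N) := fintype.split (rev_ord l).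
pose M' l := if pt l is inl i then M i else 0.
pose g' l := if pt l is inl i then g i else 1%:M.
pose f' l := if pt l is inl i then f0 i else fun=> 1%:M.
pose A' l := invmx (g' l) *m M' l *m g' l.
have ptl i : pt (rev_ord (lshift 8 i)) = inl i.
  by rewrite /pt rev_ordK; exact: (unsplitK (inl i)).
have ptr j : pt (rev_ord (rshift n j)) = inr j.
  by rewrite /pt rev_ordK; exact: (unsplitK (inr j)).
have sumE (w : 'I_N -> K) a b : \sum_l w l * A' l a b = \sum_i w (rev_ord (lshift 8 i)) * A i a b.
  rewrite (reindex_inj rev_ord_inj) /= big_split_ord /= [X in _ + X]big1 ?addr0.
    by apply: eq_bigr => i _; rewrite /A' /M' /g' ptl.
  by move=> j _; rewrite /A' /M' /g' ptr mulmx0 mul0mx mxE mulr0.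
have sum1 a b : \sum_l A' l a b = \sum_i A i a b.
  have := sumE (fun=> 1) a b; under eq_bigr do rewrite mul1r.
  by move=> ->; apply: eq_bigr => i _; rewrite mul1r.
have [] := @riemann_hilbert R r N A' g' M' f' c.
- by rewrite leq_addl.
- by move=> l; rewrite /g'; case: (pt l) => // _; rewrite unitmx1.
- by [].
- move=> l k X k0; rewrite /A' /M' /g'; case: (pt l) => [i|j] h.
    by apply: nonresonant (gu i) (tM i) _ h => a b; exact: nr.
  move: h; rewrite mulmx0 mul0mx mul0mx mulmx0 subrr => /eqP; rewrite scaler_eq0 pnatr_eq0.
  by rewrite -leqn0 leqNgt k0 /= => /eqP.
- move=> l; rewrite /f' /M'; case: (pt l) => [i|j]; first by have [] := f0P i.
  split; first by apply: der_ext (@der_cst R (disc 1 1) r r 1%:M) => // x _; rewrite scaler0 mul0mx.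
  exists (fun=> 1%:M); split; last by move=> x _; rewrite mulmx1.
  by apply: der_ext (@der_cst R (disc 1 1) r r 1%:M) => // x _; rewrite scaler0 mulmx0 oppr0.
- by move=> a b ab; rewrite sum1 H1.
- by move=> a b ca cb; rewrite sum1 (sumE (fun l => zpt R N l)); exact: H2.
move=> T [TE Tprod]; exists (fun i => T (rev_ord (lshift 8 i))); split.
  move=> i; have [al alu ->] := TE (rev_ord (lshift 8 i)); rewrite /f' ptl.
  have [_ h1 h2] := f0P i; exists al, ((Jmx (f0 i) *m Jmx (f0 i)) *m (Jmx (f0 i) *m Jmx (f0 i))).
  by split.
pose G j := if insub j is Some l then T (rev_ord (l : 'I_N)) else 1%:M.
have GE (l : 'I_N) : G l = T (rev_ord l) by rewrite /G valK.
have G1 j : (n <= j)%N -> G j = 1%:M.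
  move=> nj; rewrite /G; case: insubP => // l _ lj.
  have [j' ->] : exists j', l = rshift n j'.
    have h : (j - n < 8)%N by have := ltn_ord l; rewrite lj; lia.
    by exists (Ordinal h); apply: val_inj; rewrite /= lj subnKC.
  have [al alu ->] := TE (rev_ord (rshift n j')); rewrite /f' ptr /Jmx invmx1 !mulmx1 mulmxV //.
have := mxbig_pad 8 G1; under eq_bigr do rewrite GE.
rewrite Tprod => GT; rewrite [RHS]GT; apply: eq_bigr => i _.
by rewrite -GE.
Qed.
End LocalSolution.

(** * Newton iteration *)

Section Newton.
Variable R : realType.
Local Notation K := R[i].
Local Notation nc := (@Normc.normc R).

Lemma contraction r (G : 'M[K]_r -> 'M[K]_r) (d : R) : 0 <= d ->
  (forall Y Y', mnorm Y <= d -> mnorm Y' <= d -> mnorm (G Y - G Y') <= 2^-1 * mnorm (Y - Y')) ->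
  mnorm (G 0) <= d / 2 -> exists2 Y, mnorm Y <= d & G Y = Y.
Proof.
move=> d0 lip G0; pose y k := iter k G 0.
have stable Y : mnorm Y <= d -> mnorm (G Y) <= d.
  move=> Yd; rewrite -[G Y](subrK (G 0)); apply: le_trans (mnormD _ _) _.
  have := lip Y 0 Yd; rewrite mnorm0 subr0 => /(_ d0); lra.
have yd k : mnorm (y k) <= d.
  by elim: k => [|k IH]; [rewrite mnorm0|rewrite /y iterS; exact: stable].
pose D k := y k.+1 - y k.
have DD k : mnorm (D k) <= d * 2^-1 ^+ k.
  elim: k => [|k IH]; first by rewrite mulr1 /D /y /= subr0; lra.
  have h : mnorm (D k.+1) <= 2^-1 * mnorm (D k) := lip _ _ (yd k.+1) (yd k).
  rewrite exprS mulrCA; apply: le_trans h _.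
  by rewrite ler_wpM2l // invr_ge0.
(* Completeness is taken from power series: the differences scaled by [2 ^+ k] are bounded, so the
   series converges at [1 / 2], and its partial sums there are the iterates. *)
pose c k := (2%:R : K) ^+ k *: D k.
have tc : tempered c.
  move=> q q1; exists d => k; rewrite mnormZ normcX normc_nat.
  apply: (@le_trans _ _ (2 ^+ k * (d * 2^-1 ^+ k))); first by rewrite ler_wpM2l // exprn_ge0.
  have E : 2 ^+ k * (d * 2^-1 ^+ k) = d by rewrite mulrCA -exprMn divff ?pnatr_eq0 // expr1n mulr1.
  by rewrite E -[X in X <= _]mulr1; apply: ler_wpM2l => //; exact: exprn_ege1 (ltW q1).
have h2 : nc (2%:R^-1 : K) < 1 by rewrite Normc.normcV normc_nat invf_lt1 ?ltr1n.
have cv := mxser_cvm tc h2; set Y := mxser c _ in cv.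
have pE k : psum c (2%:R^-1) k = y k.
  elim: k => [|k IH]; first by rewrite psum0.
  rewrite psumS IH /c scalerA -exprMn mulVf ?pnatr_eq0 // expr1n scale1r.
  by rewrite /D addrC subrK.
have cy : cvm y Y by apply: cvm_ext cv.
have Yd : mnorm Y <= d := cvm_le cy yd.
exists Y => //; apply: (@cvm_unique _ _ _ (fun k => y k.+1)); last exact: cvm_shift.
move=> e e0; have [N hN] := cy e e0; exists N => k /hN hk.
by apply: le_trans (lip _ _ (yd k) Yd) _; have := mnorm_ge0 (y k - Y); lra.
Qed.

(** Differentiability at [e = 0], [Y = 0] with one constant for all bounds: [L] is the derivative in
    [Y], and the remainder is Lipschitz in [Y] with a small factor. The notion is stable under
    products, so long products are treated by induction. *)
Definition good r (f : K -> 'M[K]_r -> 'M[K]_r) (f0 : 'M[K]_r) (L : 'M[K]_r -> 'M[K]_r) :=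
  exists C, 0 <= C /\ forall e, nc e <= 1 ->
  [/\ mnorm (f e 0 - f0) <= C * nc e,
   forall Y, mnorm Y <= 1 -> mnorm (f e Y) <= C,
   forall Y, mnorm (L Y) <= C * mnorm Y,
   forall Y Y', mnorm Y <= 1 -> mnorm Y' <= 1 -> mnorm (f e Y - f e Y') <= C * mnorm (Y - Y') &
   forall Y Y', mnorm Y <= 1 -> mnorm Y' <= 1 ->
     mnorm (f e Y - f e Y' - L (Y - Y')) <= C * (nc e + mnorm Y + mnorm Y') * mnorm (Y - Y')].

Lemma goodM r (f g : K -> 'M[K]_r -> 'M[K]_r) f0 g0 Lf Lg : good f f0 Lf -> good g g0 Lg ->
  good (fun e Y => f e Y *m g e Y) (f0 *m g0) (fun Y => Lf Y *m g0 + f0 *m Lg Y).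
Proof.
move=> [Cf [Cf0 hf]] [Cg [Cg0 hg]]; pose C := Cf + Cg + mnorm f0 + mnorm g0 + 1.
have n1 := mnorm_ge0 f0; have n2 := mnorm_ge0 g0; have C1 : 1 <= C by rewrite /C; lra.
have cf : Cf <= C by rewrite /C; lra.
have cg : Cg <= C by rewrite /C; lra.
have cf0 : mnorm f0 <= C by rewrite /C; lra.
have cg0 : mnorm g0 <= C by rewrite /C; lra.
have C0 : 0 <= C by lra.
have C2 : C <= C * C by rewrite ler_pMl //; lra.
exists (8 * (C * C)); split; first by rewrite mulr_ge0 // mulr_ge0.
move=> e e1; have [f1 f2 f3 f4 f5] := hf e e1; have [g1 g2 g3 g4 g5] := hg e e1.
have z0 : mnorm (0 : 'M[K]_r) <= 1 by rewrite mnorm0.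
have E0 := normc_ge0 e.
have up (a b x : R) : 0 <= x -> a <= b * x -> b <= C -> a <= C * x.
  by move=> x0 h bC; apply: le_trans h _; rewrite ler_wpM2r.
have pr (a b : 'M[K]_r) (x y : R) : mnorm a <= x -> mnorm b <= y -> mnorm (a *m b) <= x * y.
  move=> ax by_; apply: le_trans (mnormM _ _) _; apply: ler_pM; rewrite ?mnorm_ge0 //.
have P0 : 0 <= C * C by rewrite mulr_ge0.
split.
- have -> : f e 0 *m g e 0 - f0 *m g0 = (f e 0 - f0) *m g e 0 + f0 *m (g e 0 - g0).
    by rewrite mulmxBl mulmxBr addrA subrK.
  apply: le_trans (mnormD _ _) _.
  have a1 := pr _ _ _ _ (up _ _ _ E0 f1 cf) (le_trans (g2 _ z0) cg).
  have a2 := pr _ _ _ _ cf0 (up _ _ _ E0 g1 cg).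
  apply: le_trans (lerD a1 a2) _; have : 0 <= C * C * nc e by rewrite mulr_ge0.
  by rewrite -[C * nc e * C]mulrAC mulrA; lra.
- move=> Y Y1; apply: le_trans (pr _ _ _ _ (le_trans (f2 _ Y1) cf) (le_trans (g2 _ Y1) cg)) _; lra.
- move=> Y; have Yn := mnorm_ge0 Y; apply: le_trans (mnormD _ _) _.
  have a1 := pr _ _ _ _ (up _ _ _ Yn (f3 Y) cf) cg0.
  have a2 := pr _ _ _ _ cf0 (up _ _ _ Yn (g3 Y) cg).
  apply: le_trans (lerD a1 a2) _; have : 0 <= C * C * mnorm Y by rewrite mulr_ge0.
  by rewrite -[C * mnorm Y * C]mulrAC mulrA; lra.
- move=> Y Y' Y1 Y1'; have Yn := mnorm_ge0 (Y - Y').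
  have -> : f e Y *m g e Y - f e Y' *m g e Y' = (f e Y - f e Y') *m g e Y + f e Y' *m (g e Y - g e Y').
    by rewrite mulmxBl mulmxBr addrA subrK.
  apply: le_trans (mnormD _ _) _.
  have a1 := pr _ _ _ _ (up _ _ _ Yn (f4 _ _ Y1 Y1') cf) (le_trans (g2 _ Y1) cg).
  have a2 := pr _ _ _ _ (le_trans (f2 _ Y1') cf) (up _ _ _ Yn (g4 _ _ Y1 Y1') cg).
  apply: le_trans (lerD a1 a2) _; have : 0 <= C * C * mnorm (Y - Y') by rewrite mulr_ge0.
  by rewrite -[C * mnorm (Y - Y') * C]mulrAC mulrA; lra.
- move=> Y Y' Y1 Y1'; have Yn := mnorm_ge0 (Y - Y'); have n3 := mnorm_ge0 Y; have n4 := mnorm_ge0 Y'.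
  set S := nc e + mnorm Y + mnorm Y'; have S0 : 0 <= S by rewrite /S; lra.
  have near (h : K -> 'M[K]_r -> 'M[K]_r) h0 Ch Z : 0 <= Ch -> Ch <= C -> mnorm (h e 0 - h0) <= Ch * nc e ->
     (forall Y Y', mnorm Y <= 1 -> mnorm Y' <= 1 -> mnorm (h e Y - h e Y') <= Ch * mnorm (Y - Y')) ->
     mnorm Z <= 1 -> mnorm (h e Z - h0) <= C * (nc e + mnorm Z).
    move=> Ch0 ChC h1 h4 Z1; rewrite -[h e Z](subrK (h e 0)) -addrA; apply: le_trans (mnormD _ _) _.
    have := h4 _ _ Z1 z0; rewrite subr0 => h5; have Zn := mnorm_ge0 Z.
    rewrite mulrDr [X in _ <= X]addrC; apply: lerD; first exact: (up _ _ _ Zn h5 ChC).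
    exact: (up _ _ _ E0 h1 ChC).
  have -> : f e Y *m g e Y - f e Y' *m g e Y' - (Lf (Y - Y') *m g0 + f0 *m Lg (Y - Y')) =
     (f e Y - f e Y' - Lf (Y - Y')) *m g e Y + Lf (Y - Y') *m (g e Y - g0)
     + ((f e Y' - f0) *m (g e Y - g e Y') + f0 *m (g e Y - g e Y' - Lg (Y - Y'))).
    set p := Lf _; set q := Lg _; move: (f e Y) (f e Y') (g e Y) (g e Y') p q => a b x y p q.
    have z1 (V : zmodType) (s t u : V) : s - t + (t - u) = s - u by rewrite addrA subrK.
    rewrite [(a - b - p) *m x]mulmxBl [p *m (x - g0)]mulmxBr [(b - f0) *m (x - y)]mulmxBl [f0 *m (x - y - q)]mulmxBr.
    rewrite !z1 addrACA -opprD; congr (_ - _).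
    by rewrite mulmxBl mulmxBr addrA subrK.
  apply: le_trans (mnormD _ _) _; apply: le_trans (lerD (mnormD _ _) (mnormD _ _)) _.
  have SN : 0 <= S * mnorm (Y - Y') by rewrite mulr_ge0.
  have b1 : mnorm (f e Y - f e Y' - Lf (Y - Y')) <= C * (S * mnorm (Y - Y')).
    by apply: up SN _ cf; rewrite mulrA; exact: f5.
  have b4 : mnorm (g e Y - g e Y' - Lg (Y - Y')) <= C * (S * mnorm (Y - Y')).
    by apply: up SN _ cg; rewrite mulrA; exact: g5.
  have c1 : mnorm (g e Y - g0) <= C * S.
    by apply: le_trans (near g g0 Cg Y Cg0 cg g1 g4 Y1) _; rewrite ler_wpM2l // /S; lra.
  have c2 : mnorm (f e Y' - f0) <= C * S.
    by apply: le_trans (near f f0 Cf Y' Cf0 cf f1 f4 Y1') _; rewrite ler_wpM2l // /S; lra.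
  have a1 := pr _ _ _ _ b1 (le_trans (g2 _ Y1) cg).
  have a2 := pr _ _ _ _ (up _ _ _ Yn (f3 (Y - Y')) cf) c1.
  have a3 := pr _ _ _ _ c2 (up _ _ _ Yn (g4 _ _ Y1 Y1') cg).
  have a4 := pr _ _ _ _ cf0 b4.
  apply: le_trans (lerD (lerD a1 a2) (lerD a3 a4)) _.
  have -> : C * (S * mnorm (Y - Y')) * C + C * mnorm (Y - Y') * (C * S) + (C * S * (C * mnorm (Y - Y')) + C * (C * (S * mnorm (Y - Y')))) = 4 * (C * C * (S * mnorm (Y - Y'))) by ring.
  have : 0 <= C * C * (S * mnorm (Y - Y')) by rewrite mulr_ge0.
  by rewrite -[8 * (C * C) * S * _]mulrA -[8 * (C * C) * _]mulrA; lra.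
Qed.

Lemma goodB r (f g : K -> 'M[K]_r -> 'M[K]_r) f0 g0 Lf Lg : good f f0 Lf -> good g g0 Lg ->
  good (fun e Y => f e Y - g e Y) (f0 - g0) (fun Y => Lf Y - Lg Y).
Proof.
move=> [Cf [Cf0 hf]] [Cg [Cg0 hg]]; exists (Cf + Cg); split; first exact: addr_ge0.
move=> e e1; have [f1 f2 f3 f4 f5] := hf e e1; have [g1 g2 g3 g4 g5] := hg e e1; split.
- by rewrite zmod_swap mulrDl; apply: le_trans (mnormB _ _) (lerD f1 g1).
- by move=> Y Y1; apply: le_trans (mnormB _ _) (lerD (f2 _ Y1) (g2 _ Y1)).
- by move=> Y; rewrite mulrDl; apply: le_trans (mnormB _ _) (lerD (f3 Y) (g3 Y)).
- by move=> Y Y' Y1 Y1'; rewrite zmod_swap mulrDl; apply: le_trans (mnormB _ _) (lerD (f4 _ _ Y1 Y1') (g4 _ _ Y1 Y1')).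
- move=> Y Y' Y1 Y1'; rewrite (zmod_swap (f e Y)) (zmod_swap (f e Y - f e Y')).
  rewrite (_ : (Cf + Cg) * _ * _ = Cf * (nc e + mnorm Y + mnorm Y') * mnorm (Y - Y') + Cg * (nc e + mnorm Y + mnorm Y') * mnorm (Y - Y')); last by ring.
  exact: le_trans (mnormB _ _) (lerD (f5 _ _ Y1 Y1') (g5 _ _ Y1 Y1')).
Qed.

Lemma good_aff r (T D : 'M[K]_r) : good (fun e _ => T + e *: D) T (fun=> 0).
Proof.
have n1 := mnorm_ge0 T; have n2 := mnorm_ge0 D; exists (mnorm T + mnorm D); split; first lra.
move=> e e1; have E0 := normc_ge0 e; split.
- by rewrite addrC addKr mnormZ mulrC ler_wpM2r //; lra.
- move=> Y _; apply: le_trans (mnormD _ _) _; rewrite mnormZ lerD2l ler_piMl //.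
- by move=> Y; rewrite mnorm0 mulr_ge0 ?mnorm_ge0 //; lra.
- by move=> Y Y' _ _; rewrite subrr mnorm0 mulr_ge0 ?mnorm_ge0 //; lra.
- by move=> Y Y' _ _; rewrite subrr subr0 mnorm0 !mulr_ge0 ?addr_ge0 ?mnorm_ge0.
Qed.

Lemma lin_bounded r (S : 'M[K]_r -> 'M[K]_r) : linear S -> exists2 C, 0 <= C & forall Y, mnorm (S Y) <= C * mnorm Y.
Proof.
move=> lS; have S0 := lin_fun0 lS.
pose C := \sum_a \sum_b mnorm (S (delta_mx a b)).
have C0 : 0 <= C by apply: sumr_ge0 => a _; apply: sumr_ge0 => b _; exact: mnorm_ge0.
exists C => // Y.
have entry a b : nc (Y a b) <= mnorm Y.
  rewrite /mnorm (bigD1 a) //= (bigD1 b) //= -addrA lerDl addr_ge0 //.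
    by apply: sumr_ge0 => *; exact: normc_ge0.
  by apply: sumr_ge0 => * ; apply: sumr_ge0 => *; exact: normc_ge0.
have SD X Y' : S (X + Y') = S X + S Y' by have := lS 1 X Y'; rewrite !scale1r.
have SZ k X : S (k *: X) = k *: S X by have := lS k X 0; rewrite S0 !addr0.
have Ssum (I : Type) (s : seq I) (h : I -> 'M[K]_r) : S (\sum_(i <- s) h i) = \sum_(i <- s) S (h i).
  by elim: s => [|i s IH]; rewrite ?big_nil // !big_cons SD IH.
rewrite {1}[Y]matrix_sum_delta Ssum /C mulr_suml; apply: le_trans (mnorm_sum _ _ _) _.
apply: ler_sum => a _; rewrite Ssum mulr_suml; apply: le_trans (mnorm_sum _ _ _) _.
by apply: ler_sum => b _; rewrite SZ mnormZ mulrC ler_wpM2l // mnorm_ge0.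
Qed.

Lemma good_lin r (S : 'M[K]_r -> 'M[K]_r) : linear S -> good (fun _ Y => 1%:M + S Y) 1%:M S.
Proof.
move=> lS; have [C C0 hC] := lin_bounded lS; have n1 := mnorm_ge0 (1%:M : 'M[K]_r).
have SB Y Y' : S (Y - Y') = S Y - S Y' by have := lS (-1) Y' Y; rewrite !scaleN1r => h; rewrite [Y - Y']addrC h addrC.
exists (C + mnorm (1%:M : 'M[K]_r)); split; first lra.
move=> e e1; have E0 := normc_ge0 e; split.
- by rewrite (lin_fun0 lS) addr0 subrr mnorm0 mulr_ge0 //; lra.
- move=> Y Y1; apply: le_trans (mnormD _ _) _; rewrite addrC lerD2r.
  by apply: le_trans (hC Y) _; rewrite ler_piMr.
- by move=> Y; apply: le_trans (hC Y) _; rewrite ler_wpM2r ?mnorm_ge0 //; lra.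
- move=> Y Y' _ _; rewrite opprD addrACA subrr add0r -SB.
  by apply: le_trans (hC _) _; rewrite ler_wpM2r ?mnorm_ge0 //; lra.
- move=> Y Y' _ _; rewrite opprD addrACA subrr add0r -SB subrr mnorm0.
  by rewrite !mulr_ge0 ?addr_ge0 ?mnorm_ge0.
Qed.

(** The derivative of [f] being the identity, [Y - f e Y] contracts near 0. For
    [d <= (16 * C * C)^-1] the ratio is at most [1 / 2] on the ball of radius [2 * C * d], which
    contains its own image. *)
Lemma good_zero r (f : K -> 'M[K]_r -> 'M[K]_r) (L : 'M[K]_r -> 'M[K]_r) : good f 0 L -> (forall Y, L Y = Y) ->
  exists C d0, [/\ 0 <= C, 0 < d0 & forall d e, 0 < d -> d <= d0 -> nc e <= d ->
    exists Y, mnorm Y <= C * d /\ f e Y = 0].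
Proof.
move=> [C0 [C00 hC]] LY; pose C := C0 + 1; have C1 : 1 <= C by rewrite /C; lra.
pose d0 := (16 * C * C)^-1; have CC : 1 <= C * C by rewrite mulr_ege1.
have d00 : 0 < d0 by rewrite invr_gt0; lra.
exists (2 * C), d0; split=> //; first lra.
move=> d e dp dd ed; have dC : d * (16 * C * C) <= 1.
  by rewrite -ler_pdivlMr ?mul1r //; lra.
have dCs : d * (2 * C) <= 8^-1 by nra.
have d1 : d <= 1 by nra.
have [h1 h2 h3 h4 h5] := hC e (le_trans ed d1).
pose D := 2 * C * d; have D0 : 0 <= D by rewrite /D; nra.
have D1 : D <= 8^-1 by rewrite /D mulrC.
have [||Y YD GY] := @contraction r (fun Y => Y - f e Y) D D0.
- move=> Y Y' Yd Yd'; have Yn := mnorm_ge0 (Y - Y').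
  have -> : Y - f e Y - (Y' - f e Y') = - (f e Y - f e Y' - L (Y - Y')).
    by rewrite LY [RHS]opprB [LHS]zmod_swap.
  rewrite mnormN; apply: le_trans (h5 _ _ _ _) _; try lra.
  rewrite ler_wpM2r //; apply: (@le_trans _ _ (C * (d + D + D))).
    have := mnorm_ge0 Y; have := mnorm_ge0 Y'; have := normc_ge0 e => ? ? ?.
    apply: ler_pM => //; [lra|rewrite /C; lra|lra].
  by rewrite /D; nra.
- rewrite sub0r mnormN -[f e 0]subr0; apply: le_trans h1 _.
  by rewrite /D -mulrA mulrAC divff ?pnatr_eq0 // mul1r; apply: ler_pM; rewrite ?normc_ge0 // /C; lra.
exists Y; split; first by rewrite mulrC mulrC.
by have /eqP := GY; rewrite subr_eq addrC -subr_eq subrr eq_sym => /eqP.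
Qed.
End Newton.

(** By trace duality, a matrix orthogonal to all [P X P^-1 - X] commutes with every [P i], hence is
    scalar, and orthogonality to the identity makes it zero. The full span gives preimages [S i] and
    a scalar part [kap] that depend linearly on [Y]. *)
Lemma commutator_span (F : numFieldType) r n (P : 'I_n -> 'M[F]_r) : (0 < r)%N -> (forall i, P i \in unitmx) ->
  (forall Z, (forall i, Z *m P i = P i *m Z) -> exists mu, Z = mu%:M) ->
  exists (S : 'I_n -> 'M[F]_r -> 'M[F]_r) (kap : 'M[F]_r -> F),
   [/\ forall i, linear (S i), linear (fun Y => (kap Y)%:M : 'M[F]_r) &
       forall Y, \sum_i (P i *m S i Y *m invmx (P i) - S i Y) - (kap Y)%:M = Y].
Proof.
move=> r0 Pu com; pose f i (X : 'M[F]_r) := P i *m X *m invmx (P i) - X.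
have lf i : linear (f i).
  by move=> k u v; rewrite /f mulmxDr mulmxDl -scalemxAr -scalemxAl scalerBr opprD addrACA.
pose W := (\sum_(i < n) lin_mx (f i) + mxvec (1%:M : 'M[F]_r))%MS.
have pair m (C : 'M[F]_(r * r, m)) j (X : 'M[F]_r) : (mxvec X *m C) 0 j = \tr (X *m (vec_mx (col j C)^T)^T).
  rewrite mxE sum_mxvec /mxtrace; apply: eq_bigr => a _; rewrite mxE; apply: eq_bigr => b _.
  by rewrite mxvecE !mxE.
have trd (a b : 'I_r) (X : 'M[F]_r) : \tr (delta_mx b a *m X) = X a b.
  rewrite -[delta_mx b a]mul1mx /mxtrace; under eq_bigr do rewrite mul_delta_mul.
  rewrite (bigD1 b) //= big1 => [|d /negbTE db]; rewrite !mxE ?eqxx ?db ?mul0r //.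
  by rewrite mul1r addr0.
have fullW : cokermx W = 0.
  set C := cokermx W.
  have kill m (X : 'M[F]_(m, r * r)) : (X <= W)%MS -> X *m C = 0 by rewrite submxE => /eqP.
  have k1 i X : mxvec (f i X) *m C = 0.
    rewrite -(lin_mxE (lf i)) -mulmxA kill ?mulmx0 //; apply: submx_trans (addsmxSl _ _).
    exact: (sumsmx_sup i).
  have k2 : mxvec (1%:M : 'M[F]_r) *m C = 0 := kill _ _ (addsmxSr _ _).
  apply/matrixP => k j; pose Z := (vec_mx (col j C)^T)^T.
  have tf i X : \tr (f i X *m Z) = 0 by rewrite -pair k1 mxE.
  have [i|mu Zmu] := com Z.
    have E : invmx (P i) *m Z *m P i = Z.
      apply/matrixP => a b; rewrite -[LHS]trd -[RHS]trd; apply/eqP; rewrite -subr_eq0; apply/eqP.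
      have := tf i (delta_mx b a); rewrite /f mulmxBl raddfB /= => <-; congr (_ - _).
      by rewrite -!mulmxA [RHS]mxtrace_mulC -!mulmxA.
    transitivity (P i *m (invmx (P i) *m Z *m P i)); last by rewrite E.
    by rewrite !mulmxA mulmxV // mul1mx.
  have mu0 : mu = 0.
    have := pair _ C j 1%:M; rewrite k2 mxE mul1mx -/Z Zmu mxtrace_scalar => /esym/eqP.
    by rewrite mulrn_eq0 (gtn_eqF r0) /= => /eqP.
  case/mxvec_indexP: k => a b; have : Z b a = 0 by rewrite Zmu mu0 mxE mul0rn.
  by rewrite /Z !mxE.
have : (1%:M <= W)%MS by rewrite submxE fullW mulmx0.
case/sub_addsmxP => -[u v] /= E; have /sub_sumsmxP[w Ew] := submxMl u (\sum_(i < n) lin_mx (f i))%MS.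
exists (fun i Y => vec_mx (mxvec Y *m w i)), (fun Y => - (mxvec Y *m v) 0 0); split.
- by move=> i k X Y; rewrite linearP /= mulmxDl -scalemxAl linearP.
- move=> k X Y; rewrite linearP /= mulmxDl -scalemxAl; move: (mxvec X *m v) (mxvec Y *m v) => x y.
  by apply/matrixP => a b; rewrite !mxE; case: (a == b); rewrite ?mulr1n ?mulr0n; ring.
- move=> Y; apply: (can_inj mxvecK); rewrite raddfB /= raddf_sum /=.
  have := congr1 (mulmx (mxvec Y)) E; rewrite Ew mulmx1 mulmxDr mulmx_sumr => EY.
  rewrite [RHS]EY; congr (_ + _).
    by apply: eq_bigr => i _; rewrite -/(f i _) -(lin_mxE (lf i)) vec_mxK mulmxA.
  by rewrite mulmxA [X in _ = X *m _]mx11_scalar mul_scalar_mx -[(- _)%:M]scalemx1 linearZ /= scaleNr opprK.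
Qed.

Lemma det_conj (F : fieldType) r (P X : 'M[F]_r) : P \in unitmx -> \det (P *m X *m invmx P) = \det X.
Proof. by move=> Pu; rewrite !det_mulmx mulrAC -det_mulmx mulmxV // det1 mul1r. Qed.

(** * Deformation into the conjugacy classes *)

Section Deformation.
Variable R : realType.
Local Notation K := R[i].
Local Notation nc := (@Normc.normc R).

Lemma good_ext r (f f' : K -> 'M[K]_r -> 'M[K]_r) f0 f0' L L' : good f f0 L ->
  (forall e Y, f e Y = f' e Y) -> f0 = f0' -> (forall Y, L Y = L' Y) -> good f' f0' L'.
Proof.
move=> h e1 <- e3; have <- : f = f' by apply/funext => e; apply/funext => Y; exact: e1.
by have <- : L = L' by apply/funext.
Qed.

Lemma good_prod r (T D : nat -> 'M[K]_r) (S : nat -> 'M[K]_r -> 'M[K]_r) k :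
  (forall i, T i \in unitmx) -> (forall i, linear (S i)) ->
  let pre k := \big[mulmx/1%:M]_(i < k) T i in
  good (fun e Y => \big[mulmx/1%:M]_(i < k) ((T i + e *: D i) *m (1%:M + S i Y))) (pre k)
    (fun Y => (\sum_(i < k) pre i.+1 *m S i Y *m invmx (pre i.+1)) *m pre k).
Proof.
move=> Tu lS pre; have preS j : pre j.+1 = pre j *m T j by rewrite /pre mxbig_recr.
have pu j : pre j \in unitmx.
  by elim: j => [|j IH]; [rewrite /pre big_ord0 unitmx1|rewrite preS unitmx_mul IH Tu].
elim: k => [|k IH].
  apply: good_ext (good_aff 1%:M 0) _ _ _ => [e Y||Y].
  - by rewrite big_ord0 scaler0 addr0.
  - by rewrite /pre big_ord0.
  - by rewrite big_ord0 mul0mx.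
apply: good_ext (goodM IH (goodM (good_aff (T k) (D k)) (good_lin (lS k)))) _ _ _ => [e Y||Y].
- by rewrite mxbig_recr.
- by rewrite preS mulmx1.
- by rewrite big_ord_recr /= mulmxDl mul0mx add0r mulmx1 mulmxKV // preS !mulmxA.
Qed.

(** The factors are to be conjugated by partial products of the [1%:M + S i Y]; multiplied out, this
    becomes an equation free of inverses, whose linear part in [Y] is the identity by [id]. *)
Lemma newton_product r n (T D : nat -> 'M[K]_r) (S : nat -> 'M[K]_r -> 'M[K]_r) (kap : 'M[K]_r -> K) :
  (forall i, T i \in unitmx) -> (forall i, linear (S i)) -> linear (fun Y => (kap Y)%:M : 'M[K]_r) ->
  let pre k := \big[mulmx/1%:M]_(i < k) T i in pre n = 1%:M ->
  (forall Y, \sum_(i < n) (pre i.+1 *m S i Y *m invmx (pre i.+1) - S i Y) - (kap Y)%:M = Y) ->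
  forall eta : R, 0 < eta -> exists2 d : R, 0 < d & forall e, nc e <= d -> exists2 Y, mnorm Y <= eta &
    \big[mulmx/1%:M]_(i < n) ((T i + e *: D i) *m (1%:M + S i Y)) =
    (1%:M + (kap Y)%:M) *m \big[mulmx/1%:M]_(i < n) (1%:M + S i Y).
Proof.
move=> Tu lS lk pre pn id eta eta0.
have gF := good_prod D n Tu lS.
have gG := @good_prod r (fun=> 1%:M) (fun=> 0) S n (fun=> unitmx1 _ _) lS.
have one k : \big[mulmx/1%:M]_(i < k) (1%:M : 'M[K]_r) = 1%:M.
  by elim: k => [|k IH]; rewrite ?big_ord0 // mxbig_recr IH mulmx1.
have g : good (fun e Y => \big[mulmx/1%:M]_(i < n) ((T i + e *: D i) *m (1%:M + S i Y)) -
    (1%:M + (kap Y)%:M) *m \big[mulmx/1%:M]_(i < n) (1%:M + S i Y)) 0 (fun Y => Y).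
  apply: good_ext (goodB gF (goodM (good_lin lk) gG)) _ _ _ => [e Y||Y].
  - by congr (_ - _ *m _); apply: eq_bigr => i _; rewrite scaler0 addr0 mul1mx.
  - by rewrite one mulmx1 -/(pre n) pn subrr.
  - have E1 : \sum_(i < n) (\big[mulmx/1%:M]_(j < i.+1) 1%:M) *m S i Y *m invmx (\big[mulmx/1%:M]_(j < i.+1) 1%:M) = \sum_(i < n) S i Y.
      by apply: eq_bigr => i _; rewrite one mul1mx invmx1 mulmx1.
    rewrite /= E1 -/(pre n) pn one !mulmx1 mul1mx; apply: etrans (id Y).
    by rewrite sumrB opprD addrA [LHS]addrAC.
have [C [d0 [C0 d00 h]]] := good_zero g (fun=> erefl).
pose d := Num.min d0 (eta / (C + 1)).
have C1 : 0 < C + 1 by lra.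
have dp : 0 < d by rewrite lt_min d00 divr_gt0.
have dd0 : d <= d0 by rewrite ge_min lexx.
have de : d <= eta / (C + 1) by rewrite ge_min lexx orbT.
exists d => // e ed; have [Y [Yd E]] := h d e dp dd0 ed; exists Y; last by apply/eqP; rewrite -subr_eq0; apply/eqP.
apply: le_trans Yd _; move: de; rewrite ler_pdivlMr // => de.
have : d * (C + 1) = C * d + d by ring.
lra.
Qed.

(** The [r] powers of a root of unity [w != 1] sum to zero, which is impossible when all of them are
    close to 1. *)
Lemma small_root_of_unity r (w : K) : (0 < r)%N -> r%:R * nc (w - 1) * expR 1 < 1 -> w ^+ r = 1 -> w = 1.
Proof.
move=> r0 sm wr; have d0 := normc_ge0 (w - 1); set d := nc (w - 1) in sm d0.
have e1 : 1 <= expR 1 :> R by have := expR_ge1Dx (1 : R); lra.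
have rd0 : 0 <= r%:R * d by rewrite mulr_ge0.
have rd : r%:R * d <= 1 by apply: le_trans (ltW sm); rewrite ler_peMr.
have := subrX1 w r; rewrite wr subrr => /esym/eqP; rewrite mulf_eq0 subr_eq0 => /orP[/eqP //|/eqP s0].
have : nc (\sum_(i < r) (w ^+ i - 1)) <= \sum_(i < r) (r%:R * d * expR 1).
  apply: le_trans (normc_sum _ _ _) _; apply: ler_sum => i _.
  have ir : i%:R * d <= r%:R * d by rewrite ler_wpM2r // ler_nat ltnW.
  apply: le_trans (pow_near1 d0 (lexx _) (le_trans ir rd)) _.
  by rewrite ler_wpM2r // expR_ge0.
rewrite sumrB s0 sub0r normcN !sumr_const !card_ord normc_nat => h.
have r1 : (0 : R) < r%:R by rewrite ltr0n.
have : r%:R * 1 <= r%:R * (r%:R * d * expR 1) by rewrite mulr1 mulr_natl.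
by rewrite ler_pM2l // leNgt sm.
Qed.

Lemma deformation r n (A T D : 'I_n.+1 -> 'M[K]_r) : (0 < r)%N ->
  (forall i, T i \in unitmx) -> \big[mulmx/1%:M]_(i < n.+1) T i = 1%:M -> \prod_i \det (A i) = 1 ->
  (forall Z, (forall i, Z *m T i = T i *m Z) -> exists mu, Z = mu%:M) ->
  (forall i, exists2 p : {poly K}, p != 0 & forall e, ~~ root p e -> conj_mx (A i) (T i + e *: D i)) ->
  exists T' : 'I_n.+1 -> 'M[K]_r, (forall i, conj_mx (A i) (T' i)) /\ \big[mulmx/1%:M]_(i < n.+1) T' i = 1%:M.
Proof.
move=> r0 Tu T1 dA com hp.
pose Tn k := T (inord k); pose Dn k := D (inord k).
pose pre k := \big[mulmx/1%:M]_(i < k) Tn i.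
have preS j : pre j.+1 = pre j *m Tn j by rewrite /pre mxbig_recr.
have pu j : pre j \in unitmx.
  by elim: j => [|j IH]; [rewrite /pre big_ord0 unitmx1|rewrite preS unitmx_mul IH Tu].
have pn : pre n.+1 = 1%:M by rewrite -T1; apply: eq_bigr => i _; rewrite /Tn inord_val.
(* Commuting with all partial products is the same as commuting with all factors, so [com] covers
   the matrices [pre i.+1]. *)
have [|S [kap [lS lk id]]] := @commutator_span K r n.+1 (fun i => pre i.+1) r0 (fun i => pu i.+1).
  move=> Z hZ; apply: com => i.
  have cp k : (k <= n.+1)%N -> Z *m pre k = pre k *m Z.
    case: k => [_|k kn]; first by rewrite /pre big_ord0 mulmx1 mul1mx.
    exact: (hZ (Ordinal kn)).
  have E : T i = invmx (pre i) *m pre i.+1 by rewrite preS mulKmx ?pu // /Tn inord_val.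
  have ci : Z *m invmx (pre i) = invmx (pre i) *m Z.
    apply: (can_inj (mulKmx (pu i))); rewrite /= mulKVmx ?pu // mulmxA -cp ?mulmxK ?pu //.
    exact: ltnW.
  by rewrite E mulmxA ci -mulmxA cp // mulmxA.
pose Sn k := S (inord k).
have idn Y : \sum_(i < n.+1) (pre i.+1 *m Sn i Y *m invmx (pre i.+1) - Sn i Y) - (kap Y)%:M = Y.
  by rewrite -[RHS]id; congr (_ - _); apply: eq_bigr => i _; rewrite /Sn inord_val.
have nw := @newton_product r n.+1 Tn Dn Sn kap (fun=> Tu _) (fun=> lS _) lk pn idn.
have bS i : exists C : R, 0 <= C /\ forall Y, mnorm (S i Y) <= C * mnorm Y.
  by have [C ? ?] := lin_bounded (lS i); exists C.
have [Cs hCs] := choice bS.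
have [Ck Ck0 hCk] := lin_bounded lk.
pose C := \sum_i Cs i + Ck + 1; pose q := r%:R * expR 1 : R.
have q0 : 0 <= q by rewrite mulr_ge0 // expR_ge0.
have Cs0 : 0 <= \sum_i Cs i by apply: sumr_ge0 => i _; case: (hCs i).
have CsC i : Cs i <= C.
  have h : 0 <= \sum_(j | j != i) Cs j by apply: sumr_ge0 => j _; case: (hCs j).
  by rewrite /C (bigD1 i) //=; lra.
have C1 : 1 <= C by rewrite /C; lra.
(* Chosen so that [C * eta] and [C * eta * q] are both at most [1 / 2]: the first makes the
   conjugators invertible, the second serves [small_root_of_unity]. *)
pose eta := (2 * C * (q + 1))^-1.
have den : 0 < 2 * C * (q + 1) by rewrite mulr_gt0 // ?mulr_gt0 //; lra.
have eta0 : 0 < eta by rewrite invr_gt0.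
have etaE : eta * (2 * C * (q + 1)) = 1 by rewrite mulVf // gt_eqF.
have Ceta : 0 <= C * eta by rewrite mulr_ge0 //; lra.
have etaE' : 2 * (C * eta) * q + 2 * (C * eta) = 1 by apply: etrans etaE; move: (eta) => t; ring.
have qC : 0 <= (C * eta) * q by rewrite mulr_ge0.
have [d d0 hd] := nw eta eta0.
have hp1 i : exists p : {poly K}, p != 0 /\ forall e, ~~ root p e -> conj_mx (A i) (T i + e *: D i).
  by have [p ? ?] := hp i; exists p.
have [p hp'] := choice hp1.
pose pp := \prod_i p i; have pp0 : pp != 0 by apply/prodf_neq0 => i _; case: (hp' i).
(* The parameters [k.+1%:R^-1] tend to 0, so one of them is small and avoids the finitely many
   exceptional values of all the segments. *)
have si : injective (fun k => (k.+1%:R : K)^-1) by move=> k l /invr_inj/natS_inj.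
have [k Nk rk] := nonroot (Num.bound d^-1) si pp0.
pose e : K := k.+1%:R^-1.
have ed : nc e <= d.
  rewrite /e Normc.normcV normc_nat -[d]invrK lef_pV2 ?posrE ?ltr0n ?invr_gt0 //.
  apply: ltW; apply: lt_le_trans (archi_boundP _) _; first by rewrite invr_ge0 ltW.
  by rewrite ler_nat (leq_trans Nk).
have [Y Ye E] := hd e ed; have Y0 := mnorm_ge0 Y.
have YC (c : R) : c <= C -> c * mnorm Y <= C * eta.
  by move=> cC; apply: le_trans (ler_wpM2r Y0 cC) _; rewrite ler_wpM2l //; lra.
have cM i : conj_mx (A i) (T i + e *: D i).
  by apply: (hp' i).2; apply: contra rk; rewrite /pp (bigD1 i) //= rootM => ->.
pose Q j := 1%:M + Sn j Y; pose H j := \big[mulmx/1%:M]_(l < j) Q l.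
have Qu j : Q j \in unitmx.
  apply: mnorm_unit; rewrite /Q addrC addKr; apply: le_lt_trans ((hCs (inord j)).2 Y) _.
  by apply: le_lt_trans (YC _ (CsC _)) _; lra.
have HS j : H j.+1 = H j *m Q j by rewrite /H mxbig_recr.
have Hu j : H j \in unitmx.
  by elim: j => [|j IH]; [rewrite /H big_ord0 unitmx1|rewrite HS unitmx_mul IH Qu].
(* The conjugators accumulate, so that consecutive ones telescope and the Newton equation says that
   the product of the [T' j] is scalar. *)
pose T' j := H j *m (Tn j + e *: Dn j) *m invmx (H j).
have chain j : (\big[mulmx/1%:M]_(i < j) T' i) *m H j = \big[mulmx/1%:M]_(i < j) ((Tn i + e *: Dn i) *m Q i).
  elim: j => [|j IH]; first by rewrite /H !big_ord0 mulmx1.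
  by rewrite HS !mxbig_recr /= -IH /T' !mulmxA mulmxKV.
pose w := 1 + kap Y.
have PT : \big[mulmx/1%:M]_(i < n.+1) T' i = w%:M.
  apply: (can_inj (mulmxK (Hu n.+1))); rewrite /= chain /Q E /w.
  by congr (_ *m _); rewrite raddfD.
have cM' i : conj_mx (A i) (T' (nat_of_ord i)).
  have [U Uu UE] := cM i; exists (H i *m U); first by rewrite unitmx_mul Hu.
  by rewrite /T' /Tn /Dn inord_val UE mx_invM // !mulmxA.
have w1 : w = 1.
  apply: (small_root_of_unity r0).
    have -> : w - 1 = ((kap Y)%:M : 'M[K]_r) (Ordinal r0) (Ordinal r0) by rewrite mxE eqxx mulr1n /w addrC addKr.
    have CkC : Ck <= C by rewrite /C; lra.
    have h1 := le_trans (le_normc_mnorm _ (Ordinal r0) (Ordinal r0)) (le_trans (hCk Y) (YC _ CkC)).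
    rewrite mulrAC -/q; apply: le_lt_trans (ler_wpM2l q0 h1) _; rewrite mulrC; lra.
  rewrite -det_scalar -PT (big_morph (fun X : 'M[K]_r => \det X) (@det_mulmx _ _) (@det1 _ _)).
  by apply: etrans dA; apply: eq_bigr => i _; have [U Uu ->] := cM' i; rewrite det_conj.
by exists (fun i => T' i); split=> //; rewrite PT w1.
Qed.
End Deformation.

Lemma stable_trivial (F : fieldType) r (U : 'M[F]_r) : \rank U = 0%N \/ \rank U = r ->
  (U == (0 : 'M[F]_r))%MS || (U == (1%:M : 'M[F]_r))%MS.
Proof.
case=> h; apply/orP; [left|right].
  have /eqP -> : U == 0 by rewrite -mxrank_eq0 h.
  by rewrite submx_refl.
by rewrite submx1 sub1mx /row_full h eqxx.
Qed.

Lemma char_poly_tr (F : fieldType) r (X : 'M[F]_r) : char_poly X^T = char_poly X.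
Proof.
rewrite /char_poly -[RHS]det_tr; congr (\det _); apply/matrixP => i j.
by rewrite !mxE eq_sym.
Qed.

Lemma zpt_inj (R : realType) n : injective (fun i : 'I_n => zpt R (n + 8) (rev_ord (lshift 8 i))).
Proof.
move=> i j /= zij; apply/eqP; apply: contraT => ij; have N8 : (8 <= n + 8)%N by rewrite leq_addl.
pose u : 'I_(n + 8) := rev_ord (lshift 8 i); pose v : 'I_(n + 8) := rev_ord (lshift 8 j).
have ne : (u : nat) != v.
  apply/eqP => /= e; move/eqP: ij; apply; apply: ord_inj; have := ltn_ord i; have := ltn_ord j; lia.
have := @zpt_dist R _ N8 _ _ (ltn_ord v) (ltn_ord u) ne; rewrite /u /v zij subrr.
by rewrite Normc.normc0 leNgt mulr_gt0 //; exact: si_gt0.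
Qed.

Theorem mainTheorem1 (R : realType) (n r : nat) (A : 'I_n -> 'M[R[i]]_r)
  (lam : 'I_n -> r.-tuple R[i]) :
  (3 <= n)%N -> (1 <= r)%N ->
  (forall i, A i \in unitmx) ->
  (forall i, char_poly (A i) = \prod_(x <- lam i) ('X - x%:P)) ->
  mult_generic lam ->
  \prod_(i < n) \det (A i) = 1 ->
  (forall mu : nat, (2 <= mu <= r)%N ->
     (\sum_(i < n) level (attached_partition (A i) (lam i)) mu
        < (n - 2) * mu + 2)%N) ->
  exists T : 'I_n -> 'M[R[i]]_r,
    [/\ forall i, conj_mx (A i) (T i),
        mxprod T = 1%:M &
        irreducible_family T].
Proof.
move=> n3 r1; case: n n3 A lam => [//|n] n3 A lam; case: r r1 A lam => [//|r'] _ A lam Au cp gen dA lv.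
set r := r'.+1 in A lam Au cp gen dA lv *; set K := R[i] in A lam Au cp gen dA lv *.
pose ls i := eigseq (lam i); pose B := (r * r)%N.
have fB i : fprod (A i) (ls i) B = 0 := fp_B (cp i).
pose rho i := rlab B (A i) (ls i).
have rhoB i a : (rho i a < B)%N := rlab_lt (fB i) a.
have star (p : 'I_n.+1 -> 'I_B -> nat) r1 : (forall i j, p i j <= #|[pred a | rho i a == j]|)%N ->
    (forall i, \sum_j p i j = r1)%N -> (0 < r1 < r)%N ->
    (\sum_i \sum_j p i j * (#|[pred a | rho i a == j]| - p i j) < (n.+1 - 2) * r1 * (r - r1))%N.
  move=> h1 h2 h3; apply: (@star_inequality _ B r (fun i => eigrow (A i) (lam i)) p r r1) => //.
    by move=> i; exact: eigrow_sum (cp i).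
  move=> mu hmu; have := lv mu hmu.
  rewrite (eq_bigr (fun i => lev r (eigrow (A i) (lam i)) mu)) // => i _; apply: attached_level => //; lia.
have ef i : exists Q, Q \in unitmx /\ let E := Q *m A i *m invmx Q in
    [/\ tri (rho i) E, forall a, E a a = ls i (rho i a) &
     forall j u, (j < B)%N -> gsup (rho i) j.+1 u -> exists2 y, gsup (rho i) j y & y *m (E - (ls i j)%:M) = u].
  by have [Q ? ?] := exact_form (fB i); exists Q.
have [Q hQ] := choice ef.
pose E i := Q i *m A i *m invmx (Q i).
have Qu i : Q i \in unitmx by case: (hQ i).
have tE i : tri (rho i) (E i) by case: (hQ i) => _ [].
have dE i a : E i a a = ls i (rho i a) by case: (hQ i) => _ [_ h _]; exact: h.
have sE i : forall j u, (j < B)%N -> gsup (rho i) j.+1 u -> exists2 y, gsup (rho i) j y & y *m (E i - (ls i j)%:M) = u.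
  by case: (hQ i) => _ [].
have detA i : \prod_a ls i (rho i a) = \det (A i).
  by rewrite -(det_conj (A i) (Qu i)) (det_tri (tE i)); apply: eq_bigr => a _; rewrite dE.
have ls0 i a : ls i (rho i a) != 0.
  have : \det (A i) != 0 by rewrite -unitfE -unitmxE.
  by rewrite -detA => /prodf_neq0/(_ a isT).
(* The logarithm is a function of the eigenvalue: equal eigenvalues receive equal exponents, which
   excludes resonance in [nr]. *)
have tex (x : K) : exists t, x != 0 -> expi t = x.
  by case: (boolP (x != 0)) => [x0|_]; [have [t] := expi_surj x0; exists t|exists 0].
have [tau tauP] := choice tex.
pose th0 i j := tau (ls i j).
have e0 : expi (0 : K) = 1 by have := @expi_int R 0.
have ex : expi (\sum_i \sum_a th0 i (rho i a)) = 1.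
  rewrite (big_morph (@expi R) (@expiD R) e0); apply: etrans dA; apply: eq_bigr => i _.
  rewrite (big_morph (@expi R) (@expiD R) e0) -detA; apply: eq_bigr => a _; exact: tauP (ls0 i a).
have [zz Ezz] := expi_ker ex.
(* Lowering all exponents of the first point by [q] changes their sum from [zz] to the remainder
   [k < r], the number of summands O(1). *)
pose q := (zz %/ r)%Z; pose k := `|(zz %% r)%Z|%N.
have kE : k%:Z = (zz %% r)%Z by rewrite /k gez0_abs // modz_ge0.
have kr : (k < r)%N by rewrite -ltz_nat kE ltz_pmod.
have zzE : zz = q * r%:Z + k%:Z by rewrite kE -divz_eq.
pose theta (i : 'I_n.+1) j := th0 i j - (if i == ord0 then q%:~R else 0).
pose c := [pred a : 'I_r | (a < k)%N].
have ck : #|c| = k by rewrite -sum1_card -(big_ord_widen _ (fun=> 1%N) (ltnW kr)) sum1_card card_ord.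
have degree : \sum_i \sum_a theta i (rho i a) = #|c|%:R.
  rewrite (eq_bigr (fun i => \sum_a th0 i (rho i a) - (if i == ord0 then q%:~R *+ r else 0))) => [|i _]; last first.
    by rewrite sumrB sumr_const card_ord; case: ifP => //; rewrite mul0rn.
  rewrite sumrB -big_mkcond big_pred1_eq Ezz ck zzE rmorphD rmorphM /=.
  have h (m : nat) : (m%:Z)%:~R = m%:R :> K by [].
  by rewrite !h -[q%:~R *+ r]mulr_natr addrAC subrr add0r.
have eth i a : expi (theta i (rho i a)) = ls i (rho i a).
  rewrite /theta expiD; have -> : expi (- (if i == ord0 then q%:~R else 0)) = 1 :> K.
    by case: ifP => _; [rewrite -rmorphN expi_int|rewrite oppr0].
  by rewrite mulr1 tauP.
pose z (i : 'I_n.+1) := zpt R (n.+1 + 8) (rev_ord (lshift 8 i)).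
have [g gmax] := exists_maximal c z rho.
have [N [N1 N2 N3]] := lift_entries n3 (@zpt_inj R n.+1) rhoB star gmax degree.
pose M i := \matrix_(a, b) (theta i (rho i a) *+ (a == b)) + N i.
have tM i : tri (rho i) (M i).
  move=> a b; rewrite mxE; have [->|ab] := eqVneq a b; first by left.
  by rewrite mxE (negbTE ab) mulr0n add0r => /N1; right.
have dM i a : M i a a = theta i (rho i a).
  have z0 : N i a a = 0 by apply/eqP; apply: contraT => /N1; rewrite ltnn.
  by rewrite mxE z0 addr0 mxE eqxx.
have nr i a b m : (0 < m)%N -> M i a a - M i b b <> m%:R.
  rewrite !dM => m0 e.
  have : expi (theta i (rho i a)) = expi (theta i (rho i b)).
    rewrite -(subrK (theta i (rho i b)) (theta i (rho i a))) e expiD.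
    have -> : expi (m%:R) = 1 :> K by exact: (@expi_int R m).
    by rewrite mul1r.
  rewrite !eth => el; move: e; rewrite /theta /th0 el subrr => /esym/eqP.
  by rewrite pnatr_eq0 -leqn0 leqNgt m0.
have [T [hT T1]] := riemann_hilbert_parabolic gmax.1 tM nr N2 N3.
have hT' i : exists hX : 'M[K]_r * 'M[K]_r, [/\ hX.1 \in unitmx, tri (rho i) hX.2,
    forall a, hX.2 a a = ls i (rho i a) & T i = hX.1 *m hX.2 *m invmx hX.1].
  by have [h [X [hu tX dX ->]]] := hT i; exists (h, X); split=> // a; rewrite /= dX dM eth.
have [hX hXP] := choice hT'.
pose h i := (hX i).1; pose X i := (hX i).2.
have hu i : h i \in unitmx by case: (hXP i).
have tX i : tri (rho i) (X i) by case: (hXP i).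
have dX i a : X i a a = ls i (rho i a) by case: (hXP i) => _ _ e _; exact: e.
have TE i : T i = h i *m X i *m invmx (h i) by case: (hXP i).
have cpT i : char_poly (T i) = \prod_(x <- lam i) ('X - x%:P).
  rewrite TE (char_poly_conj _ (hu i)) (char_poly_tri (tX i)) -cp -(char_poly_conj (A i) (Qu i)) (char_poly_tri (tE i)).
  by apply: eq_bigr => a _; rewrite dX dE.
have Tu i : T i \in unitmx.
  rewrite unitmxE TE det_conj // (det_tri (tX i)).
  have -> : \prod_a X i a a = \det (A i) by rewrite -detA; apply: eq_bigr => a _.
  by rewrite -unitmxE.
have com Z : (forall i, Z *m T i = T i *m Z) -> exists mu, Z = mu%:M.
  exact: (schur cpT gen (perm_refl _) T1).
pose D i := h i *m (E i - X i) *m invmx (h i).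
have hp i : exists2 p : {poly K}, p != 0 & forall e, ~~ root p e -> conj_mx (A i) (T i + e *: D i).
  have [p p0 hp] := path_conj (rhoB i) (tE i) (dE i) (tX i) (dX i) (sE i).
  exists p => // e /hp[Y Yu YE]; exists (h i *m invmx Y *m Q i).
    by rewrite !unitmx_mul unitmx_inv hu Yu Qu.
  have -> : T i + e *: D i = h i *m (X i + e *: (E i - X i)) *m invmx (h i).
    by rewrite TE /D [in RHS]mulmxDr [in RHS]mulmxDl -[in RHS]scalemxAr -[in RHS]scalemxAl.
  rewrite -[X i + _](mulKmx Yu) YE /E.
  rewrite mx_invM ?unitmx_mul ?unitmx_inv ?hu ?Yu ?Qu // mx_invM ?unitmx_inv ?hu ?Yu // invmxK.
  by rewrite !mulmxA.
have [T' [cT' T'1]] := deformation (ltn0Sn _) Tu T1 dA com hp.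
exists T'; split=> // U st; apply: stable_trivial.
(* Subspaces of columns are encoded by rows, so the transposes act and the product is reversed.
   Conjugation preserves the characteristic polynomial, so genericity applies to the deformed family
   as well. *)
apply: (@generic_stable K n.+1 r lam (fun i => (T' i)^T) (rev (index_enum _))).
- by move=> i; rewrite char_poly_tr; have [P Pu ->] := cT' i; rewrite char_poly_conj.
- exact: gen.
- by rewrite perm_rev.
- by rewrite -mxbig_tr T'1 trmx1.
- exact: st.
Qed.
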